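(* Let $G$ be a circular-arc graph with $\varrho(G)\ge 3$. If $G$ has the $\varrho(G)$-property, then $\delta(G)=\varrho(G)/4$. Furthermore, if $\delta(G)=\varrho(G)/4$ and $3\le\varrho(G)\le 4$, then $G$ has the $\varrho(G)$-property.
   Context: Graphs are simple, possibly infinite, edges of length $1$, viewed as metric spaces (edges identified with $[0,1]$, shortest-path distance). A geodesic triangle is $\delta$-thin if each side lies in the $\delta$-neighborhood of the union of the other two; $\delta(G)$ is the supremum over geodesic triangles of their sharp thinness constants (supremum over components if disconnected). A circular-arc graph is given by arcs $\{I_v\}$ of the unit circle $\mathbb{S}^1$, distinct vertices adjacent iff their arcs intersect. A finite vertex set is total if its arcs cover $\mathbb{S}^1$; $\varrho(G)$ is the minimum size of a total set. For an interval graph given by intervals: the $0$-intersection property means any three intervals have empty common intersection; the $(3/4)$-intersection property means it lacks the $0$-intersection property and for any four intervals $I',I'',I''',I''''$ we have $I'\cap I''\cap I'''=\emptyset$ or $I'\cap I''\cap I''''=\emptyset$; a couple of intervals in a cycle $C$ is the union of two non-disjoint intervals whose vertices belong to $C$; the $1$-intersection property means it lacks the $0$- and $(3/4)$-intersection properties and for every cycle $C$ each interval and each couple of intervals corresponding to vertices of $C$ are not disjoint; the $(3/2)$-intersection property means there are two disjoint intervals $I',I''$ corresponding to vertices of a cycle $C$ such that no interval $I$ of a vertex satisfies $I\cap I'\ne\emptyset$ and $I\cap I''\ne\emptyset$. A circular-arc graph $G$ with $\varrho(G)\ge3$ has the $\varrho(G)$-property if there are $\varrho(G)$ arcs $I_1,\dots,I_{\varrho(G)}$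 of vertices with union $\mathbb{S}^1$ such that every other arc of a vertex intersects exactly one of them, and, with $G_j$ the interval graph corresponding to the arcs intersecting $I_j$: if $\varrho(G)=3$, each $G_j$ has the $0$- or $(3/4)$-intersection property; if $\varrho(G)=4$, each $G_j$ has the $0$-, $(3/4)$- or $1$-intersection property; if $\varrho(G)=5$, no $G_j$ has the $(3/2)$-intersection property (no extra condition if $\varrho(G)\ge6$).
   Formalization: The arcs are assumed to be either all closed (single points allowed) or all open; with half-open or mixed arcs the claim fails, e.g. three disjoint half-open arcs partitioning the circle have ϱ=3 and the 3-property, but δ=0. *)

(* Defs.v *)
From mathcomp Require Import all_boot all_order all_algebra.
From mathcomp Require Import all_classical all_reals all_analysis.
Import Order.TTheory GRing.Theory Num.Theory.

Set Implicit Arguments.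
Unset Strict Implicit.
Unset Printing Implicit Defensive.

Local Open Scope classical_set_scope.
Local Open Scope card_scope.
Local Open Scope ring_scope.

Record sgraph (V : Type) := SGraph {
  adj : V -> V -> Prop;
  adj_sym : forall u v, adj u v -> adj v u;
  adj_irrefl : forall u, ~ adj u u }.

Definition is_cycle (V : Type) (G : sgraph V) (n : nat) (c : 'I_n -> V) : Prop :=
  [/\ (3 <= n)%N, injective c & forall i, adj G (c i) (c (ordS i))].

(** * Graphs as metric spaces

  A point of the metric graph is given by its barycentric coordinates with
  respect to the vertices, so that the edges [u v] and [v u] carry the same
  points and edges are glued at common end points without taking a quotient. *)

Section MetricGraph.
Context (R : realType) (V : Type) (G : sgraph V).

Definition vpoint (v : V) : V -> R := \1_[set v].

Definition epoint (u v : V) (t : R) : V -> R :=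
  fun w => (1 - t) * vpoint u w + t * vpoint v w.

Definition gpoints : set (V -> R) :=
  [set p | (exists v, p = vpoint v) \/
           (exists u v t, [/\ adj G u v, 0 <= t <= 1 & p = epoint u v t])].

(** [chain p q l]: there is a path of length [l] from [p] to [q] made of
    finitely many straight segments, each contained in a single edge. *)
Inductive chain : (V -> R) -> (V -> R) -> R -> Prop :=
| chain_nil p : chain p p 0
| chain_cons u v s t q l :
    adj G u v -> 0 <= s <= 1 -> 0 <= t <= 1 ->
    chain (epoint u v t) q l -> chain (epoint u v s) q (`|s - t| + l).

(** Equal to [+oo] between different connected components. *)
Definition gdist (p q : V -> R) : \bar R :=
  ereal_inf [set l%:E | l in [set l | chain p q l]].

Definition gdist_set (p : V -> R) (A : set (V -> R)) : \bar R :=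
  ereal_inf [set gdist p a | a in A].

Definition is_geodesic (x y : V -> R) (S : set (V -> R)) : Prop :=
  exists (L : R) (g : R -> V -> R),
    [/\ 0 <= L, g 0 = x /\ g L = y,
        (forall s, 0 <= s <= L -> gpoints (g s)),
        (forall s t, 0 <= s <= L -> 0 <= t <= L ->
           gdist (g s) (g t) = `|s - t|%:E) &
        S = g @` [set s | 0 <= s <= L]].

Definition geodesic_triangle (S1 S2 S3 : set (V -> R)) : Prop :=
  exists x y z, [/\ is_geodesic x y S1, is_geodesic y z S2 & is_geodesic z x S3].

Definition thin (d : R) (S1 S2 S3 : set (V -> R)) : Prop :=
  [/\ (forall p, S1 p -> (gdist_set p (S2 `|` S3) <= d%:E)%E),
      (forall p, S2 p -> (gdist_set p (S3 `|` S1) <= d%:E)%E) &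
      (forall p, S3 p -> (gdist_set p (S1 `|` S2) <= d%:E)%E)].

Definition triangle_delta (S1 S2 S3 : set (V -> R)) : \bar R :=
  ereal_inf [set d%:E | d in [set d | 0 <= d /\ thin d S1 S2 S3]].

(** A geodesic triangle lies in one connected component, so this is also the
    supremum of the hyperbolicity constants of the components. *)
Definition delta : \bar R :=
  ereal_sup [set e | exists S1 S2 S3,
    geodesic_triangle S1 S2 S3 /\ e = triangle_delta S1 S2 S3].

End MetricGraph.

Arguments delta R {V} G.

(** * Intersection graphs and intersection properties *)

Section Intersection.
Context (T W : Type) (J : W -> set T).

Definition meets (A B : set T) : Prop := A `&` B !=set0.

Lemma meetsC A B : meets A B -> meets B A.
Proof. by rewrite /meets setIC. Qed.

Definition igraph_adj (u v : W) : Prop := u <> v /\ meets (J u) (J v).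

Lemma igraph_adj_sym u v : igraph_adj u v -> igraph_adj v u.
Proof. by move=> [uv /meetsC vu]; split => // /esym. Qed.

Lemma igraph_adj_irrefl u : ~ igraph_adj u u.
Proof. by case. Qed.

Definition igraph : sgraph W := SGraph igraph_adj_sym igraph_adj_irrefl.

(** Below, "three (four) intervals" are those of pairwise distinct vertices;
    the sets themselves may coincide. *)

Definition inter0_property : Prop :=
  forall a b c, a <> b -> a <> c -> b <> c -> J a `&` J b `&` J c = set0.

Definition inter34_property : Prop :=
  ~ inter0_property /\
  forall a b c d, a <> b -> a <> c -> a <> d -> b <> c -> b <> d -> c <> d ->
    J a `&` J b `&` J c = set0 \/ J a `&` J b `&` J d = set0.

Definition inter1_property : Prop :=
  [/\ ~ inter0_property, ~ inter34_property &
      forall n (c : 'I_n -> W), is_cycle igraph c ->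
        forall i j k : 'I_n, j <> k -> meets (J (c j)) (J (c k)) ->
          meets (J (c i)) (J (c j) `|` J (c k))].

Definition inter32_property : Prop :=
  exists n (c : 'I_n -> W), is_cycle igraph c /\
    exists i j : 'I_n, ~ meets (J (c i)) (J (c j)) /\
      ~ exists w, meets (J w) (J (c i)) /\ meets (J w) (J (c j)).

End Intersection.

(** * Circular-arc graphs *)

Section CircularArc.
Context (R : realType).

Definition circle : set (R * R) := [set p | p.1 ^+ 2 + p.2 ^+ 2 = 1].

Definition circle_pt (t : R) : R * R := (cos t, sin t).

Definition closed_arc (A : set (R * R)) : Prop :=
  exists a b : R, a <= b /\ A = circle_pt @` [set t | a <= t <= b].

Definition open_arc (A : set (R * R)) : Prop :=
  exists a b : R, a < b /\ A = circle_pt @` [set t | a < t < b].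

Context (V : Type) (I : V -> set (R * R)).

(** Arcs must be uniformly closed or uniformly open for a cover of the circle to
    be seen by the intersection graph: the circle is also a disjoint union of
    three half-open arcs. *)
Definition arc_family : Prop :=
  (forall v, closed_arc (I v)) \/ (forall v, open_arc (I v)).

Definition total_set (A : set V) : Prop :=
  finite_set A /\ \bigcup_(v in A) I v = circle.

(** Equal to [+oo] when there is no total set. *)
Definition rho : \bar R :=
  ereal_inf [set n%:R%:E | n in
    [set n : nat | exists A : set V, total_set A /\ A #= `I_n]].

(** The arcs meeting [I v], including [I v] itself; intersections are taken on
    the circle, not on an unrolling to the line. *)
Definition nbr_arcs (v : V) : {w : V | meets (I w) (I v)} -> set (R * R) :=
  fun w => I (sval w).

Arguments nbr_arcs : clear implicits.

Definition rho_property : Prop :=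
  exists (n : nat) (v : 'I_n -> V),
    [/\ rho = n%:R%:E,
        injective v /\ \bigcup_(i in setT) I (v i) = circle,
        (forall w, (forall i, w <> v i) -> exists! i, meets (I w) (I (v i))) &
        [/\ n = 3%N -> forall j,
              inter0_property (nbr_arcs (v j)) \/
              inter34_property (nbr_arcs (v j)),
            n = 4%N -> forall j,
              [\/ inter0_property (nbr_arcs (v j)),
                  inter34_property (nbr_arcs (v j)) |
                  inter1_property (nbr_arcs (v j))] &
            n = 5%N -> forall j, ~ inter32_property (nbr_arcs (v j))]].

End CircularArc.

(* Main.v *)
Require Import Defs.
From mathcomp Require Import all_boot all_order all_algebra.
From mathcomp Require Import all_classical all_reals all_analysis.
From mathcomp Require Import ring lra zify.
Import Order.TTheory GRing.Theory Num.Theory.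

(** Let [n] be the minimal size of a total set.  In a minimal total set every
    arc has a private point, so its arcs are cyclically ordered and meet exactly
    when they are consecutive.  Under the [rho]-property the graph is therefore
    an [n]-cycle with, at each vertex [b] of the cycle, some pendant vertices
    which are all adjacent to [b] and otherwise only to each other.

    Sending a pendant vertex to its hub and lifting to the universal cover of
    the cycle shows that the cycle is isometrically embedded; its two halves
    form a geodesic bigon of thinness [n / 4].  Conversely, a path with the same
    ends as a geodesic has to pass the two points where the geodesic enters and
    leaves a block (the cycle, or the pendant vertices at one hub), so it is
    within [n / 4] of the geodesic as soon as the blocks have diameter at most
    [n / 2].  The intersection properties guarantee this for [n = 3, 4], and
    diameter [3] suffices for [n >= 6].  For [n = 5] a pendant block may have
    diameter [3]; there a geodesic point at distance more than [5 / 4] from both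
    ends is within [1 / 4] of a pendant vertex [m], and the arcs missing the one
    of [m] lie on its two sides, so that the path passes a neighbour of [m].

    For the converse, a cycle of length [4] forces [delta >= 1] and a cycle of
    length [5] with a vertex not adjacent to the two opposite ones forces
    [delta >= 5 / 4].  Excluding these configurations inside the neighbourhood
    of one arc gives the intersection properties, and excluding them along the
    minimal total set shows that every other arc meets exactly one arc of it. *)

Set Implicit Arguments.
Unset Strict Implicit.
Unset Printing Implicit Defensive.

Local Open Scope classical_set_scope.
Local Open Scope ring_scope.

(** * Paths and distances *)

(** The distance is an infimum over chains in a possibly infinite graph, so no shortest chain is
    ever picked. Upper bounds come from explicit chains, up to an arbitrary [e]. Lower bounds at
    short cycles come from potentials, functions of the coordinates that are 1-Lipschitz on every
    edge; they are checked edge by edge by linear arithmetic and tolerate chords, so the forbidden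
    cycles of length 4 and 5 need not be induced.

    For the upper bound, two sides of a triangle are only remembered as one Lipschitz path with the
    ends of the third. Its length does not matter: what counts is that a path can lose a vertex
    condition only at a vertex.

    Arcs are studied through their periodic sets of angles on the line. Two angles of an arc only
    tell that one of the two segments joining them around the circle lies in it; private angles of
    the minimal cover decide which. *)

Section Points.
Context (R : realType) (V : Type).
Implicit Types (u v w : V) (p q : V -> R).

Lemma vpoint_same v : vpoint R v v = 1.
Proof. by rewrite /vpoint indicE mem_set. Qed.

Lemma vpoint_neq v w : w <> v -> vpoint R v w = 0.
Proof. by move=> wv; rewrite /vpoint indicE memNset. Qed.

Lemma epoint_sym u v (t : R) : epoint u v t = epoint v u (1 - t).
Proof. by apply/funext => w; rewrite /epoint; ring. Qed.

Lemma epoint0 u v : epoint u v 0 = vpoint R u.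
Proof. by apply/funext => w; rewrite /epoint; ring. Qed.

Lemma epoint1 u v : epoint u v 1 = vpoint R v.
Proof. by apply/funext => w; rewrite /epoint; ring. Qed.

Lemma epointl u v (t : R) : u <> v -> epoint u v t u = 1 - t.
Proof. by move=> uv; rewrite /epoint vpoint_same vpoint_neq//; ring. Qed.

Lemma epointr u v (t : R) : u <> v -> epoint u v t v = t.
Proof.
move=> uv; rewrite /epoint vpoint_same vpoint_neq//; first by ring.
by move=> vu; apply: uv.
Qed.

Lemma epoint_out u v w (t : R) : w <> u -> w <> v -> epoint u v t w = 0.
Proof. by move=> wu wv; rewrite /epoint !vpoint_neq//; ring. Qed.

Lemma epoint_supp u v w (t : R) : 0 < epoint u v t w -> w = u \/ w = v.
Proof.
move=> h; apply: contrapT => /not_orP[wu wv].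
by move: h; rewrite epoint_out// ltxx.
Qed.

(** An interior point has exactly two positive coordinates, which give back the edge up to reversal;
    a vertex lies on many edges, so the last two cases only retain the vertex. *)
Lemma epoint_eq u v u' v' (s s' : R) : u <> v -> u' <> v' ->
    0 <= s <= 1 -> 0 <= s' <= 1 -> epoint u v s = epoint u' v' s' ->
  [\/ [/\ u' = u, v' = v & s' = s], [/\ u' = v, v' = u & s' = 1 - s],
      s = 0 /\ epoint u' v' s' = vpoint R u |
      s = 1 /\ epoint u' v' s' = vpoint R v].
Proof.
move=> uv uv' s01 s01' e.
have [s0|s0] := eqVneq s 0; first by constructor 3; rewrite -e s0 epoint0.
have [s1|s1] := eqVneq s 1; first by constructor 4; rewrite -e s1 epoint1.
have eu := congr1 (@^~ u) e; have ev := congr1 (@^~ v) e.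
rewrite /= epointl// in eu; rewrite /= epointr// in ev.
have [] := @epoint_supp u' v' u s'; first by rewrite -eu; lra.
  move=> uu; have [] := @epoint_supp u' v' v s'; first by rewrite -ev; lra.
    by move=> vu; case: uv; rewrite uu vu.
  move=> vv; constructor 1; split=> //.
  by rewrite vv epointr in ev.
move=> uu; have [] := @epoint_supp u' v' v s'; first by rewrite -ev; lra.
  move=> vu; constructor 2; split=> //.
  by rewrite uu epointr in eu.
by move=> vv; case: uv; rewrite uu vv.
Qed.

End Points.

Section Metric.
Context (R : realType) (V : Type) (G : sgraph V).
Implicit Types (u v w : V) (p q r : V -> R).

Lemma adj_neq u v : adj G u v -> u <> v.
Proof. by move=> /[swap] ->; exact: adj_irrefl. Qed.

Lemma chain_ge0 p q (l : R) : chain G p q l -> 0 <= l.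
Proof. by elim=> // *; rewrite addr_ge0. Qed.

Lemma chain_trans p q r (k l : R) :
  chain G p q k -> chain G q r l -> chain G p r (k + l).
Proof.
move=> h; elim: h => [p'|u v s t q' k' uv s01 t01 _ IH] hr; first by rewrite add0r.
by rewrite -addrA; apply: chain_cons => //; exact: IH.
Qed.

Lemma chain_edge u v (s t : R) : adj G u v -> 0 <= s <= 1 -> 0 <= t <= 1 ->
  chain G (epoint u v s) (epoint u v t) `|s - t|.
Proof.
by move=> uv s01 t01; rewrite -[X in chain _ _ _ X]addr0; apply: chain_cons => //;
  exact: chain_nil.
Qed.

Lemma chain_symm p q (l : R) : chain G p q l -> chain G q p l.
Proof.
elim=> [p'|u v s t q' k uv s01 t01 _ IH]; first exact: chain_nil.
by rewrite addrC distrC; apply: chain_trans IH _; exact: chain_edge.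
Qed.

Lemma gdistC p q : gdist G p q = gdist G q p.
Proof.
by rewrite /gdist; congr (ereal_inf (_ @` _)); apply/seteqP; split=> l; exact: chain_symm.
Qed.

Lemma gdist_lb p q (x : \bar R) :
  (forall l, chain G p q l -> (x <= l%:E)%E) -> (x <= gdist G p q)%E.
Proof. by move=> h; apply: le_ereal_inf_tmp => _ [l hl <-]; exact: h. Qed.

(** A real upper bound keeps the arithmetic out of [\bar R], and does not claim that some chain
    attains it. *)
Definition dle p q (l : R) : Prop := (gdist G p q <= l%:E)%E.

Lemma chain_dle p q (l : R) : chain G p q l -> dle p q l.
Proof. by move=> h; apply: ereal_inf_lbound; exists l. Qed.

Lemma dle_approx p q (l e : R) : dle p q l -> 0 < e ->
  exists2 k, chain G p q k & k < l + e.
Proof.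
move=> h e0; have : (gdist G p q < (l + e)%:E)%E.
  by apply: le_lt_trans h _; rewrite lte_fin; lra.
by move=> /ereal_inf_lt[_ [k hk <-]]; rewrite lte_fin => kl; exists k.
Qed.

Lemma dle_of_approx p q (l : R) :
  (forall e, 0 < e -> exists2 k, chain G p q k & k < l + e) -> dle p q l.
Proof.
move=> h; apply/lee_addgt0Pr => e e0; have [k hk kl] := h e e0.
by apply: le_trans (chain_dle hk) _; rewrite -EFinD lee_fin ltW.
Qed.

Lemma dleC p q (l : R) : dle p q l -> dle q p l.
Proof. by rewrite /dle gdistC. Qed.

Lemma dle_trans p q r (k l : R) : dle p q k -> dle q r l -> dle p r (k + l).
Proof.
move=> hk hl; apply: dle_of_approx => e e0.
have e2 : 0 < e / 2 by lra.
have [a ha ak] := dle_approx hk e2; have [b hb bl] := dle_approx hl e2.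
by exists (a + b); [exact: chain_trans hb|lra].
Qed.

Lemma dle_weak p q (k l : R) : dle p q k -> k <= l -> dle p q l.
Proof. by move=> h kl; apply: le_trans h _; rewrite lee_fin. Qed.

Lemma dle_refl p (l : R) : 0 <= l -> dle p p l.
Proof. by move=> l0; apply: dle_weak l0; apply: chain_dle; exact: chain_nil. Qed.

Lemma dle_edge u v (s t : R) : adj G u v -> 0 <= s <= 1 -> 0 <= t <= 1 ->
  dle (epoint u v s) (epoint u v t) `|s - t|.
Proof. by move=> *; apply: chain_dle; exact: chain_edge. Qed.

Lemma dle_epointl u v (t : R) : adj G u v -> 0 <= t <= 1 ->
  dle (vpoint R u) (epoint u v t) t.
Proof.
move=> uv t01; rewrite -(epoint0 _ u v); apply: dle_weak (dle_edge uv _ t01) _; first lra.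
by rewrite sub0r normrN ger0_norm; lra.
Qed.

Lemma dle_epointr u v (t : R) : adj G u v -> 0 <= t <= 1 ->
  dle (vpoint R v) (epoint u v t) (1 - t).
Proof.
move=> uv t01; rewrite epoint_sym; apply: dle_epointl; [exact: adj_sym|lra].
Qed.

Lemma dle_adj u v : adj G u v -> dle (vpoint R u) (vpoint R v) 1.
Proof. by move=> uv; rewrite -(epoint1 _ u v); apply: dle_epointl => //; lra. Qed.

Definition edge_lip (F : (V -> R) -> R) : Prop := forall u v s t, adj G u v ->
  0 <= s <= 1 -> 0 <= t <= 1 -> `|F (epoint u v s) - F (epoint u v t)| <= `|s - t|.

(** Summing along a chain, a potential that varies no faster than length on each edge cannot
    separate two points by more than their distance. *)
Lemma edge_lip_gdist F p q : edge_lip F -> (`|F p - F q|%:E <= gdist G p q)%E.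
Proof.
move=> hF; apply: gdist_lb => l; rewrite lee_fin.
elim=> [p'|u v s t q' k uv s01 t01 _ IH]; first by rewrite subrr normr0.
have -> : F (epoint u v s) - F q' =
  (F (epoint u v s) - F (epoint u v t)) + (F (epoint u v t) - F q') by ring.
by apply: le_trans (ler_normD _ _) _; apply: lerD => //; exact: hF.
Qed.

Lemma edge_lip_dle F p q (l : R) : edge_lip F -> dle p q l -> `|F p - F q| <= l.
Proof. by move=> /edge_lip_gdist h /(le_trans (h _ _)); rewrite lee_fin. Qed.

Lemma coord_lip w : edge_lip (fun p => p w).
Proof.
move=> u v s t /adj_neq uv _ _ /=.
have [wu|wu] := pselect (w = u); first by
    rewrite wu !epointl// distrC le_eqVlt; apply/orP; left; apply/eqP; congr Num.norm; ring.
have [wv|wv] := pselect (w = v); first by rewrite wv !epointr.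
by rewrite !epoint_out// subrr normr0.
Qed.

Lemma dle_coord p q w (l : R) : dle p q l -> `|p w - q w| <= l.
Proof. exact: edge_lip_dle (coord_lip w). Qed.

Lemma gpoints_epoint u v (t : R) : adj G u v -> 0 <= t <= 1 ->
  gpoints G (epoint u v t).
Proof. by move=> uv t01; right; exists u, v, t. Qed.

Lemma delta_ge (S1 S2 S3 : set (V -> R)) p (l : R) :
    geodesic_triangle G S1 S2 S3 -> S1 p ->
    (forall q, S2 q \/ S3 q -> (l%:E <= gdist G p q)%E) ->
  (l%:E <= delta R G)%E.
Proof.
move=> tri S1p far.
apply: le_trans (_ : triangle_delta G S1 S2 S3 <= _)%E; last first.
  by apply: ereal_sup_ubound; exists S1, S2, S3.
apply: le_ereal_inf_tmp => _ [d [d0 [thin1 _ _]] <-].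
apply: le_trans (thin1 _ S1p).
by apply: le_ereal_inf_tmp => _ [q qS <-]; exact: far.
Qed.

(** If an inner piece could be shortened, replacing it would join the ends by less than [b - a]. *)
Lemma geodesic_param (g : R -> V -> R) (a b : R) : a <= b ->
    (forall s, a <= s <= b -> gpoints G (g s)) ->
    (forall s t, a <= s -> s <= t -> t <= b -> dle (g s) (g t) (t - s)) ->
    ((b - a)%:E <= gdist G (g a) (g b))%E ->
  is_geodesic G (g a) (g b) (g @` [set s | a <= s <= b]).
Proof.
move=> ab gG glip gab.
have key s t : a <= s -> s <= t -> t <= b -> gdist G (g s) (g t) = (t - s)%:E.
  move=> as_ st tb; apply/le_anti/andP; split; first exact: glip.
  apply: gdist_lb => l /chain_dle hl; rewrite lee_fin.
  have := dle_trans (dle_trans (glip a s _ _ _) hl) (glip t b _ _ _).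
  move=> /(_ ltac:(lra) ltac:(lra) ltac:(lra) ltac:(lra) ltac:(lra) ltac:(lra)).
  by move=> /(le_trans gab); rewrite lee_fin; lra.
exists (b - a), (fun s => g (a + s)); split; first lra.
- by rewrite addr0; split=> //; congr g; ring.
- by move=> s sL; apply: gG; lra.
- move=> s t sL tL; have [st|ts] := leP s t.
    by rewrite key; [rewrite distrC ger0_norm; [congr EFin; ring|lra]|lra..].
  by rewrite gdistC key; [rewrite ger0_norm; [congr EFin; ring|lra]|lra..].
- apply/seteqP; split=> _ [s /= sab <-].
    by exists (s - a); [rewrite /=; lra|congr g; ring].
  by exists (a + s) => //=; lra.
Qed.

Lemma geodesic_refl p : gpoints G p -> is_geodesic G p p [set p].
Proof.
move=> hp; have -> : [set p] = (fun=> p) @` [set s : R | 0 <= s <= 0].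
  apply/seteqP; split=> [_ ->|_ [s _ <-]]//=; exists 0 => //=; lra.
apply: (@geodesic_param (fun=> p) 0 0) => //.
- by move=> s t _ st _; apply: dle_refl; lra.
- by rewrite subrr; apply: gdist_lb => l /chain_ge0; rewrite lee_fin.
Qed.

Lemma geodesic_sym p q (S : set (V -> R)) : is_geodesic G p q S -> is_geodesic G q p S.
Proof.
move=> [L [g [L0 [g0 gL] gG gd ->]]].
exists L, (fun s => g (L - s)); split=> //.
- by rewrite subr0 subrr.
- by move=> s sL; apply: gG; lra.
- move=> s t sL tL; rewrite gd; [|lra..].
  by rewrite distrC; congr EFin; congr Num.norm; ring.
- apply/seteqP; split=> _ [s /= sL <-].
    by exists (L - s); [rewrite /=; lra|congr g; ring].
  by exists (L - s) => //=; lra.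
Qed.

End Metric.

(** * Walks and potentials *)

Section Walks.
Context (R : realType) (V : Type) (G : sgraph V).
Implicit Types (u v w : V) (p q r : V -> R) (C : nat -> V).

(** Unit speed motion along [C 0], [C 1], and so on. At an integer the truncation takes the later
    edge; [walkE] with [t = 1] shows that the earlier one gives the same point. *)
Definition walk C (a : R) : V -> R :=
  let k := Num.truncn a in epoint (C k) (C k.+1) (a - k%:R).

Lemma walkE C k (t : R) : 0 <= t <= 1 ->
  walk C (k%:R + t) = epoint (C k) (C k.+1) t.
Proof.
move=> t01; have k0 : 0 <= k%:R :> R := ler0n _ k.
have [->|t1] := eqVneq t 1.
  rewrite /walk; have -> : k%:R + 1 = k.+1%:R :> R by rewrite -natr1.
  by rewrite natrK subrr epoint0 epoint1.
rewrite /walk (_ : Num.truncn _ = k); first by congr epoint; ring.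
by apply: truncn_def; rewrite -natr1; lra.
Qed.

Lemma walk_nat C k : walk C k%:R = vpoint R (C k).
Proof. by rewrite -[k%:R]addr0 walkE ?epoint0//; lra. Qed.

Lemma walk_split (a : R) n : 0 <= a <= n.+1%:R ->
  exists k t, [/\ (k <= n)%N, 0 <= t <= 1 & a = k%:R + t].
Proof.
move=> an; have [<-|an1] := eqVneq n.+1%:R a.
  by exists n, 1; split=> //; [lra|rewrite -natr1].
have /truncn_itv : 0 <= a by lra.
rewrite -natr1; set k := Num.truncn a => ka; exists k, (a - k%:R); split; [|lra|ring].
rewrite leqNgt; apply/negP => nk; have : n.+1%:R <= k%:R :> R by rewrite ler_nat.
by move/eqP: an1 => an1; lra.
Qed.

Lemma dle_walk_nat C n i j : (forall k, (k < n)%N -> adj G (C k) (C k.+1)) ->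
  (i <= j <= n)%N -> dle G (vpoint R (C i)) (vpoint R (C j)) (j%:R - i%:R).
Proof.
move=> hC /andP[]; elim: j => [|j IH]; first by case: i => // _ _; apply: dle_refl; rewrite subrr.
rewrite leq_eqVlt => /orP[/eqP <- _|]; first by apply: dle_refl; rewrite subrr.
rewrite ltnS => ij jn; apply: dle_weak (dle_trans (IH ij (ltnW jn)) (dle_adj _ (hC j jn))) _.
by rewrite -[j.+1%:R]natr1; lra.
Qed.

Lemma dle_walk C n (a b : R) : (forall k, (k <= n)%N -> adj G (C k) (C k.+1)) ->
  0 <= a -> a <= b -> b <= n.+1%:R -> dle G (walk C a) (walk C b) (b - a).
Proof.
move=> hC a0; rewrite le_eqVlt => /orP[/eqP <- _|ab bn]; first by apply: dle_refl; rewrite subrr.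
have [|i [s [iN s01 ae]]] := @walk_split a n; first lra.
have [|j [t [jn t01 be]]] := @walk_split b n; first lra.
rewrite ae be !walkE//.
case: (eqVneq i j) => [ij|ij].
  subst j.
  apply: dle_weak (dle_edge (hC _ jn) s01 t01) _.
  have [st|ts] := leP s t; first by rewrite distrC ger0_norm; lra.
  by rewrite ger0_norm; lra.
have {}ij : (i < j)%N.
  move: ij; rewrite neq_ltn => /orP[//|ji].
  have : j.+1%:R <= i%:R :> R by rewrite ler_nat.
  rewrite -natr1 => ji'; exfalso; lra.
have hij := @dle_walk_nat C n.+1 i.+1 j (fun k => hC k).
have h1 := dleC (dle_epointr (hC _ iN) s01).
have h2 := dle_epointl (hC _ jn) t01.
apply: dle_weak (dle_trans (dle_trans h1 (hij _)) h2) _; first by rewrite ij ltnW.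
by rewrite -natr1; lra.
Qed.

Lemma walk_geodesic C n (a b : R) : (forall k, (k <= n)%N -> adj G (C k) (C k.+1)) ->
    0 <= a -> a <= b -> b <= n.+1%:R ->
    ((b - a)%:E <= gdist G (walk C a) (walk C b))%E ->
  is_geodesic G (walk C a) (walk C b) (walk C @` [set s | a <= s <= b]).
Proof.
move=> hC a0 ab bn h; apply: geodesic_param => //.
- move=> s sab; have [|i [t [iN t01 ->]]] := @walk_split s n; first lra.
  by rewrite walkE//; apply: gpoints_epoint => //; exact: hC.
- by move=> s t sa st tb; apply: (dle_walk hC); lra.
Qed.

(** A bigon is a triangle whose third side is the point [x]; it lies on [S2], so it adds no
    condition. *)
Lemma bigon_delta x y (S1 S2 : set (V -> R)) p (l : R) :
    is_geodesic G x y S1 -> is_geodesic G x y S2 -> S1 p ->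
    (forall q, S2 q -> (l%:E <= gdist G p q)%E) ->
  (l%:E <= delta R G)%E.
Proof.
move=> g1 g2 S1p far.
have xS2 : S2 x by case: g2 => L [g [L0 [<- _] _ _ ->]]; exists 0 => //=; lra.
have gx : is_geodesic G x x [set x].
  case: g1 => L [g [L0 [<- _] gG _ _]]; apply: geodesic_refl; apply: gG; lra.
apply: (delta_ge (p := p) (S1 := S1) (S2 := S2) (S3 := [set x])) => //.
- by exists x, y, x; split=> //; exact: geodesic_sym.
- by move=> q [|->]; exact: far.
Qed.

Lemma walk_bigon C D n m (a b c d : R) p (l : R) :
    (forall k, (k <= n)%N -> adj G (C k) (C k.+1)) ->
    (forall k, (k <= m)%N -> adj G (D k) (D k.+1)) ->
    0 <= a -> a <= b -> b <= n.+1%:R -> 0 <= c -> c <= d -> d <= m.+1%:R ->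
    b - a = d - c ->
    walk C a = walk D c -> walk C b = walk D d ->
    ((b - a)%:E <= gdist G (walk C a) (walk C b))%E ->
    (exists2 s, a <= s <= b & p = walk C s) ->
    (forall s, c <= s <= d -> (l%:E <= gdist G p (walk D s))%E) ->
  (l%:E <= delta R G)%E.
Proof.
move=> hC hD a0 ab bn c0 cd dm e ea eb h [s sab ->] far.
apply: (bigon_delta (walk_geodesic hC a0 ab bn h) _ (p := walk C s)).
- by rewrite ea eb; apply: (walk_geodesic hD) => //; rewrite -ea -eb -e.
- by exists s.
- by move=> q [t tcd <-]; exact: far.
Qed.

Lemma edge_lip_le (F : (V -> R) -> R) :
    (forall u v s t, adj G u v -> u <> v -> 0 <= s -> s <= t -> t <= 1 ->
       F (epoint u v s) <= F (epoint u v t) + (t - s)) ->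
  edge_lip G F.
Proof.
move=> hF; have one u v s t : adj G u v -> 0 <= s <= 1 -> 0 <= t <= 1 ->
    F (epoint u v s) - F (epoint u v t) <= `|s - t|.
  move=> uv s01 t01; have [st|ts] := leP s t.
    have := hF u v s t uv (adj_neq uv); rewrite distrC ger0_norm; lra.
  have vu := adj_sym uv; rewrite [epoint u v s]epoint_sym [epoint u v t]epoint_sym.
  have := hF v u (1 - s) (1 - t) vu (adj_neq vu); rewrite ger0_norm; lra.
move=> u v s t uv s01 t01; rewrite ler_norml one// andbT lerNl opprB distrC.
exact: one.
Qed.

Lemma min0x (x : R) : 0 <= x -> Num.min 0 x = 0.
Proof. exact: min_l. Qed.

Lemma minx0 (x : R) : 0 <= x -> Num.min x 0 = 0.
Proof. exact: min_r. Qed.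

(** The routes [sg + t] and [2 - sg - t] pass through one end of the edge and come back; the second
    term removes what is run twice. *)
Lemma min_tent (t sg : R) : 0 <= t <= 1 -> 0 <= sg <= 2^-1 ->
  Num.min (sg + t) (2 - sg - t) - 2 * Num.min (1 - t) (Num.min t sg) = `|t - sg|.
Proof.
move=> t01 sg01; rewrite !minEle.
by have [ts|ts] := leP sg t; [rewrite ger0_norm|rewrite distrC ger0_norm];
  try lra; repeat case: ifPn; rewrite -?ltNge; lra.
Qed.

(* The potential vanishes at [epoint a b sg]; its first term is the distance to that
   point through [a] or [b] for points at most one edge away from the edge [a b]. *)
Lemma tent_lip a b (sg : R) : a <> b -> 0 <= sg <= 2^-1 ->
  edge_lip G (fun q => Num.min (sg + 1 - q a) (2 - sg - q b)
                       - 2 * Num.min (q a) (Num.min (q b) sg)).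
Proof.
move=> ab sg01; apply: edge_lip_le => u v s t auv uv s0 st t1.
have h (x : R) : 0 <= x <= 1 -> 0 <= Num.min x sg.
  by move=> x01; rewrite le_min; apply/andP; split; lra.
have onedge (x : R) : 0 <= x <= 1 ->
    Num.min (sg + 1 - epoint a b x a) (2 - sg - epoint a b x b)
      - 2 * Num.min (epoint a b x a) (Num.min (epoint a b x b) sg) = `|x - sg|.
  move=> x01; rewrite epointl// epointr// -min_tent//.
  by congr (Num.min _ _ - _); ring.
have [au|au] := pselect (a = u).
  have [bv|bv] := pselect (b = v).
    subst u v; rewrite !onedge; try lra.
    have := ler_normD (t - sg) (s - t); rewrite [`|s - t|]distrC [`|t - s|]ger0_norm; last lra.
    by rewrite (_ : t - sg + (s - t) = s - sg)//; ring.
  subst u; have ba : b <> a by congruence.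
  rewrite !epointl// !epoint_out// !min0x ?minx0//; try lra.
  by rewrite !minEle; repeat case: ifPn; rewrite -?ltNge; lra.
have [av|av] := pselect (a = v).
  have [bu|bu] := pselect (b = u).
    subst u v; rewrite ![epoint b a _]epoint_sym !onedge; try lra.
    have := ler_normD (1 - t - sg) (t - s); rewrite [`|t - s|]ger0_norm; last lra.
    by rewrite (_ : 1 - t - sg + (t - s) = 1 - s - sg)//; ring.
  subst v; have ba : b <> a by congruence.
  rewrite !epointr// !epoint_out// !min0x ?minx0//; try lra.
  by rewrite !minEle; repeat case: ifPn; rewrite -?ltNge; lra.
rewrite ![epoint u v _ a]epoint_out//.
have [bu|bu] := pselect (b = u).
  subst u; rewrite !epointl//.
  rewrite !(@min0x (Num.min _ _)) ?h//; try lra.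
  by rewrite !minEle; repeat case: ifPn; rewrite -?ltNge; lra.
have [bv|bv] := pselect (b = v).
  subst v; rewrite !epointr//.
  rewrite !(@min0x (Num.min _ _)) ?h//; try lra.
  by rewrite !minEle; repeat case: ifPn; rewrite -?ltNge; lra.
by rewrite !epoint_out//; lra.
Qed.

(** At the vertices: [-1/2] at [a], [b], [1/2] at [c], [d], and 0 elsewhere. The minima push it to
    -1 at the midpoint of [a b] and to 1 at that of [c d], so these are at least 2 apart whatever
    other edges there are. *)
Definition quad_pot a b c d (q : V -> R) : R :=
  (q c + q d - q a - q b) / 2 + Num.min (q c) (q d) - Num.min (q a) (q b).

Lemma quad_pot_lip a b c d : a <> b -> a <> c -> a <> d -> b <> c -> b <> d -> c <> d ->
  edge_lip G (quad_pot a b c d).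
Proof.
move=> ab ac ad bc bd cd; apply: edge_lip_le => u v s t auv uv s0 st t1; rewrite /quad_pot.
have s0s := min0x s0; have s01 := minx0 s0.
have hu : 0 <= 1 - s by lra. have hu0 := min0x hu. have hu1 := minx0 hu.
have ht : 0 <= t by lra. have ht0 := min0x ht. have ht1 := minx0 ht.
have hv : 0 <= 1 - t by lra. have hv0 := min0x hv. have hv1 := minx0 hv.
have h0 := min0x (lexx 0).
have [au|au] := pselect (a = u); have [av|av] := pselect (a = v); try congruence;
have [bu|bu] := pselect (b = u); have [bv|bv] := pselect (b = v); try congruence;
have [cu|cu] := pselect (c = u); have [cv|cv] := pselect (c = v); try congruence;
have [du|du] := pselect (d = u); have [dv|dv] := pselect (d = v); try congruence;
  try subst a; try subst b; try subst c; try subst d; rewrite ?epointl ?epointr ?epoint_out//;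
  rewrite ?s0s ?s01 ?hu0 ?hu1 ?ht0 ?ht1 ?hv0 ?hv1 ?h0;
  rewrite ?minEle; repeat case: ifPn; rewrite -?ltNge; lra.
Qed.

(** At the vertices: -1 at [a], 1 at [b], [c], and 0 elsewhere; [3/2] at the midpoint of [b c]. An
    edge from [a] to [b] or [c] would carry a jump of 2, whence the two non-adjacencies below. *)
Definition pent_pot a b c (q : V -> R) : R := q b + q c - q a + Num.min (q b) (q c).

Lemma pent_pot_lip a b c : a <> b -> a <> c -> b <> c -> ~ adj G a b -> ~ adj G a c ->
  edge_lip G (pent_pot a b c).
Proof.
move=> ab ac bc nab nac; apply: edge_lip_le => u v s t auv uv s0 st t1; rewrite /pent_pot.
have avu := adj_sym auv.
have s0s := min0x s0; have s01 := minx0 s0.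
have hu : 0 <= 1 - s by lra. have hu0 := min0x hu. have hu1 := minx0 hu.
have ht : 0 <= t by lra. have ht0 := min0x ht. have ht1 := minx0 ht.
have hv : 0 <= 1 - t by lra. have hv0 := min0x hv. have hv1 := minx0 hv.
have h0 := min0x (lexx 0).
have [au|au] := pselect (a = u); have [av|av] := pselect (a = v); try congruence;
have [bu|bu] := pselect (b = u); have [bv|bv] := pselect (b = v); try congruence;
have [cu|cu] := pselect (c = u); have [cv|cv] := pselect (c = v); try congruence;
  try subst a; try subst b; try subst c; rewrite ?epointl ?epointr ?epoint_out//;
  rewrite ?s0s ?s01 ?hu0 ?hu1 ?ht0 ?ht1 ?hv0 ?hv1 ?h0;
  rewrite ?minEle; repeat case: ifPn; rewrite -?ltNge; lra.
Qed.

End Walks.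

(** * Lower bounds *)

Section LowerBounds.
Context (R : realType) (V : Type) (G : sgraph V).
Implicit Types (u v w : V) (p q r : V -> R) (C : nat -> V).

(** A point off the edge is reached only through [a] or [b]: going to [a] costs [sg], and at least
    [1 - q a] remains from there; likewise for [b]. *)
Lemma gdist_off_edge a b (sg l : R) q : a <> b -> 0 <= sg <= 2^-1 ->
    0 <= q a -> 0 <= q b -> q a = 0 \/ q b = 0 ->
    l <= sg + 1 - q a -> l <= 2 - sg - q b ->
  (l%:E <= gdist G (epoint a b sg) q)%E.
Proof.
move=> ab sg01 qa qb qab la lb.
apply: le_trans (edge_lip_gdist _ _ (tent_lip ab sg01)); rewrite lee_fin distrC ler_normr.
have -> : Num.min (q a) (Num.min (q b) sg) = 0.
  have h : 0 <= Num.min (q b) sg by rewrite le_min qb; lra.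
  by case: qab => qz; rewrite qz !min0x ?minx0//; rewrite -?qz//; lra.
rewrite epointl// epointr//.
have -> : sg + 1 - (1 - sg) = sg + sg by ring.
rewrite min_tent; try lra; rewrite subrr normr0 mulr0 !subr0 le_min.
by apply/orP; left; apply/andP; split; lra.
Qed.

(** The midpoints of [a b] and [c d] are joined by two geodesics of length 2, along [a d] and along
    [b c]. The midpoint of [a d] is at distance at least 1 from the second one. *)
Lemma delta_ge_quad a b c d : adj G a b -> adj G b c -> adj G c d -> adj G d a ->
  a <> c -> b <> d -> (1%:E <= delta R G)%E.
Proof.
move=> ab bc cd da ac bd.
have hab := adj_neq ab; have hbc := adj_neq bc; have hcd := adj_neq cd; have hda := adj_neq da.
pose C k := nth a [:: b; a; d; c] k; pose D k := nth a [:: a; b; c; d] k.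
have h12 : (2^-1 : R) = 0%:R + 2^-1 by rewrite add0r.
have h52 : (5 / 2 : R) = 2%:R + 2^-1 by lra.
have Cx : walk C 2^-1 = epoint a b (2^-1 : R).
  by rewrite {1}h12 walkE; [rewrite epoint_sym; congr epoint; lra|lra].
have Cy : walk C (5 / 2) = epoint c d (2^-1 : R).
  by rewrite {1}h52 walkE; [rewrite epoint_sym; congr epoint; lra|lra].
have Dx : walk D 2^-1 = epoint a b (2^-1 : R) by rewrite {1}h12 walkE//; lra.
have Dy : walk D (5 / 2) = epoint c d (2^-1 : R) by rewrite {1}h52 walkE//; lra.
have mid : walk C (3 / 2) = epoint a d (2^-1 : R).
  have -> : (3 / 2 : R) = 1%:R + 2^-1 by lra.
  by rewrite walkE//; lra.
apply: (@walk_bigon R V G C D 2%N 2%N 2^-1 (5/2) 2^-1 (5/2) (epoint a d (2^-1)));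
  [| |lra|lra|lra|lra|lra|lra|lra| | | | |].
- by move=> [|[|[|]]]//= _; apply: adj_sym.
- by move=> [|[|[|]]]//= _.
- by rewrite Cx Dx.
- by rewrite Cy Dy.
- have hl : edge_lip G (@quad_pot R V a b c d) by apply: quad_pot_lip; congruence.
  rewrite Cx Cy; apply: le_trans (edge_lip_gdist _ _ hl).
  rewrite lee_fin /quad_pot !epointl// !epointr// !epoint_out//; try congruence.
  have -> : 1 - 2^-1 = 2^-1 :> R by lra.
  rewrite !minxx ler_normr; apply/orP; right; lra.
- by exists (3 / 2); [lra|rewrite mid].
- move=> s s12; have [|k [t [k2 t01 se]]] := @walk_split _ s 2; first lra.
  rewrite se walkE//.
  apply: gdist_off_edge; rewrite /D; case: k k2 se => [|[|[|]]]//= _ se;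
      rewrite ?epointl ?epointr ?epoint_out//; try congruence.
  all: by move=> *; try (by left); try (by right); lra.
Qed.

(** The bigon joins [a] to the midpoint of [b c], at distance [5/2]. The middle of one side lies on
    [u b], at [1/4] from [u]: leaving through [u] costs [1/4 + 1], and through [b] it costs
    [3/4 + 1/2], because the other side stops halfway on [c b]. *)
Lemma delta_ge_pent a u b c v : adj G a u -> adj G u b -> adj G b c ->
    adj G c v -> adj G v a -> u <> c -> u <> v -> b <> v -> a <> b -> a <> c ->
    ~ adj G a b -> ~ adj G a c ->
  ((5 / 4)%:E <= delta R G)%E.
Proof.
move=> au ub bc cv va huc huv hbv hab hac nab nac.
have hau := adj_neq au; have hub := adj_neq ub; have hbc := adj_neq bc.
have hcv := adj_neq cv; have hva := adj_neq va.
pose C k := nth a [:: a; u; b; c] k; pose D k := nth a [:: a; v; c; b] k.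
have h52 : (5 / 2 : R) = 2%:R + 2^-1 by lra.
have Cy : walk C (5 / 2) = epoint b c (2^-1 : R) by rewrite {1}h52 walkE//; lra.
have Dy : walk D (5 / 2) = epoint b c (2^-1 : R).
  by rewrite {1}h52 walkE; [rewrite epoint_sym; congr epoint; lra|lra].
have C0 : walk C (0 : R) = vpoint R a by rewrite -(walk_nat R C 0).
have D0 : walk D (0 : R) = vpoint R a by rewrite -(walk_nat R D 0).
have mid : walk C (5 / 4) = epoint u b (4^-1 : R).
  have -> : (5 / 4 : R) = 1%:R + 4^-1 by lra.
  by rewrite walkE//; lra.
apply: (@walk_bigon R V G C D 2%N 2%N 0 (5/2) 0 (5/2) (epoint u b 4^-1));
  [| |lra|lra|lra|lra|lra|lra|lra| | | | |].
- by move=> [|[|[|]]]//= _.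
- by move=> [|[|[|]]]//= _; apply: adj_sym.
- by rewrite C0 D0.
- by rewrite Cy Dy.
- rewrite C0 Cy; apply: le_trans (edge_lip_gdist _ _ (pent_pot_lip hab hac hbc nab nac)).
  rewrite lee_fin /pent_pot vpoint_same !vpoint_neq ?epointl ?epointr ?epoint_out//; try congruence.
  rewrite !minEle; repeat case: ifPn; rewrite -?ltNge ler_normr => *; apply/orP; right; lra.
- by exists (5 / 4) => //; lra.
- move=> s s12; have [|k [t [k2 t01 se]]] := @walk_split _ s 2; first lra.
  rewrite se walkE//.
  apply: gdist_off_edge; rewrite /D; case: k k2 se => [|[|[|]]]//= _ se;
      rewrite ?epointl ?epointr ?epoint_out//; try congruence.
  all: by move=> *; try (by left); try (by right); lra.
Qed.

End LowerBounds.

(** * Lifting chains along a map to a cycle *)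

Section CycleLift.
Context (R : realType) (V : Type) (G : sgraph V).
Implicit Types (u v w : V) (p q r : V -> R).
Variables (n : nat) (C : nat -> V) (kappa : V -> int).
Hypothesis n3 : (3 <= n)%N.
Hypothesis C_adj : forall k, adj G (C k) (C k.+1).
Hypothesis C_per : forall k, C (k + n) = C k.
Hypothesis kappaC : forall k, exists m : int, kappa (C k) = k%:Z + m * n%:Z.
Hypothesis kappa_adj : forall u v, adj G u v ->
  exists e m : int, [/\ -1 <= e, e <= 1 & kappa v = kappa u + e + m * n%:Z].

(* [lift_of u A] and [lpos p a]: the values in the universal cover, identified with the
   line and of period [n], of the map to the cycle given by [kappa]. *)
Definition lift_of u (A : int) : Prop := exists m : int, A = kappa u + m * n%:Z.

Definition lpos p (a : R) : Prop := exists u v t A B,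
  [/\ adj G u v /\ p = epoint u v t, 0 <= t <= 1, lift_of u A /\ lift_of v B,
      -1 <= B - A <= 1 & a = (1 - t) * A%:~R + t * B%:~R].

Lemma lift_adj u v A : adj G u v -> lift_of u A -> exists2 B, lift_of v B & -1 <= B - A <= 1.
Proof.
move=> /kappa_adj[e [m [e1 e2 ev]]] [m' ->].
exists (kappa u + e + m' * n%:Z); last by apply/andP; split; lia.
by exists (m' - m); rewrite ev; ring.
Qed.

Lemma lift_int (A B : int) (c : R) : 0 <= c -> -1 <= B - A <= 1 ->
  `|c * (B%:~R - A%:~R)| <= c.
Proof.
move=> c0 AB; rewrite normrM ger0_norm// ler_piMr// -intrB.
have : (-1)%:~R <= ((B - A)%:~R : R) <= 1%:~R by rewrite !ler_int.
by rewrite ler_norml mulrN1z mulr1z.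
Qed.

Lemma lpos_vertex z (a : R) : lpos (vpoint R z) a -> exists2 A, lift_of z A & a = A%:~R.
Proof.
move=> [u [v [t [A [B [[uv e] t01 [hA hB] AB ->]]]]]].
have nuv := adj_neq uv; have ez := congr1 (@^~ z) e; rewrite /= vpoint_same in ez.
have [] := @epoint_supp R V u v z t; first by rewrite -ez.
  by move=> zu; subst z; rewrite epointl// in ez; exists A => //; rewrite (_ : t = 0); [ring|lra].
by move=> zv; subst z; rewrite epointr// in ez; exists B => //; rewrite -ez; ring.
Qed.

(** Inside an edge the lifts of both ends are carried over; at a vertex the chain may change edges,
    and [lift_adj] chooses the lift of the other end anew. *)
Lemma lpos_step u v (s t a : R) : adj G u v -> 0 <= s <= 1 -> 0 <= t <= 1 ->
  lpos (epoint u v s) a -> exists2 b, lpos (epoint u v t) b & `|a - b| <= `|s - t|.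
Proof.
move=> uv s01 t01 h; have nuv := adj_neq uv.
have mk A B : lift_of u A -> lift_of v B -> -1 <= B - A <= 1 ->
    a = (1 - s) * A%:~R + s * B%:~R ->
    exists2 b, lpos (epoint u v t) b & `|a - b| <= `|s - t|.
  move=> hA hB AB ->; exists ((1 - t) * A%:~R + t * B%:~R).
    by exists u, v, t, A, B.
  have [st|ts] := leP s t.
    rewrite distrC [X in _ <= X]distrC [X in _ <= X]ger0_norm; last lra.
    rewrite (_ : _ - _ = (t - s) * (B%:~R - A%:~R)); last by ring.
    by apply: lift_int => //; lra.
  rewrite [X in _ <= X]ger0_norm; last lra.
  rewrite (_ : _ - _ = (s - t) * (B%:~R - A%:~R)); last by ring.
  by apply: lift_int => //; lra.
have [u' [v' [s' [A [B [[uv' e] s01' [hA hB] AB ae]]]]]] := h.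
have [[? ? ?]|[? ? ?]|[s0 e0]|[s1 e1]] := epoint_eq nuv (adj_neq uv') s01 s01' e.
- by subst; exact: (mk A B).
- subst u' v' s'; apply: (mk B A) => //; first by lia.
  by rewrite ae; ring.
- move: h; rewrite e e0 => /lpos_vertex[A' hA' aA'].
  have [B' hB' AB'] := lift_adj uv hA'.
  by apply: (mk A' B') => //; rewrite s0 aA'; ring.
- move: h; rewrite e e1 => /lpos_vertex[B' hB' aB'].
  have [A' hA' AB'] := lift_adj (adj_sym uv) hB'.
  by apply: (mk A' B') => //; [lia|rewrite s1 aB'; ring].
Qed.

Lemma lpos_chain p q (l a : R) : chain G p q l -> lpos p a ->
  exists2 b, lpos q b & `|a - b| <= l.
Proof.
move=> h; elim: h a => [p' a ha|u v s t q' k uv s01 t01 _ IH a ha].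
  by exists a => //; rewrite subrr normr0.
have [b hb ab] := lpos_step uv s01 t01 ha; have [c hc bc] := IH b hb.
exists c => //; rewrite (_ : a - c = (a - b) + (b - c)); last by ring.
by apply: le_trans (ler_normD _ _) _; exact: lerD.
Qed.

(** Two steps of size at most 1 that agree modulo [n] differ by at most 2, so they are equal because
    [n >= 3]. *)
Lemma lift_rigid (A B A' B' : int) u v : lift_of u A -> lift_of v B ->
    lift_of u A' -> lift_of v B' -> -1 <= B - A <= 1 -> -1 <= B' - A' <= 1 ->
  exists m : int, A = A' + m * n%:Z /\ B = B' + m * n%:Z.
Proof.
move=> [a ->] [b ->] [a' ->] [b' ->] h h'.
have e : (b - a) - (b' - a') = 0 :> int.
  have h3 : 3 <= n%:Z by lia.
  have [//|k0] := eqVneq ((b - a) - (b' - a')) 0.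
  have : (1 <= (b - a) - (b' - a')) || ((b - a) - (b' - a') <= -1) by lia.
  by move=> /orP[] hk; nia.
exists (a - a'); split; first by ring.
by rewrite (_ : b = b' + (a - a')); [ring|lia].
Qed.

Lemma lpos_uniq p (a b : R) : lpos p a -> lpos p b ->
  exists m : int, a = b + m%:~R * n%:R.
Proof.
have vtx z : p = vpoint R z -> lpos p a -> lpos p b -> exists m : int, a = b + m%:~R * n%:R.
  move=> -> /lpos_vertex[A [m ->] ->] /lpos_vertex[B [m' ->] ->].
  by exists (m - m'); rewrite !intrD !intrM intrN; ring.
move=> ha hb; have [u [v [t [A [B [[uv e] t01 [hA hB] AB ae]]]]]] := ha.
have [u' [v' [t' [A' [B' [[uv' e'] t01' [hA' hB'] AB' be]]]]]] := hb.
have := epoint_eq (adj_neq uv) (adj_neq uv') t01 t01'.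
rewrite -e -e' => /(_ erefl)[[? ? ?]|[? ? ?]|[_ e0]|[_ e1]]; [| |exact: (vtx u)|exact: (vtx v)].
- subst; have [m [-> ->]] := lift_rigid hA hB hA' hB' AB AB'.
  by exists m; rewrite !intrD !intrM; ring.
- subst u' v' t'; have AB'' : -1 <= A' - B' <= 1 by lia.
  have [m [eA eB]] := lift_rigid hA hB hB' hA' AB AB''.
  by exists m; rewrite ae be eA eB !intrD !intrM; ring.
Qed.

Lemma lpos_walk (a : R) : 0 <= a -> lpos (walk C a) a.
Proof.
move=> a0; have [|k [t [_ t01 ->]]] := @walk_split R a (Num.truncn a).
  by rewrite a0 ltW// truncnS_gt.
rewrite walkE//; exists (C k), (C k.+1), t, k%:Z, k.+1%:Z; split=> //.
- split; [have [m e] := kappaC k|have [m e] := kappaC k.+1]; exists (- m); rewrite e; ring.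
- by lia.
- by rewrite -!pmulrn -natr1; ring.
Qed.

(** A chain lifts to a motion on the line that is no longer and ends at some lift of the end point,
    hence at [b] up to a multiple of [n]. *)
Lemma gdist_walk_ge (a b r : R) : 0 <= a -> 0 <= b ->
    (forall m : int, r <= `|a - b + m%:~R * n%:R|) ->
  (r%:E <= gdist G (walk C a) (walk C b))%E.
Proof.
move=> a0 b0 h; apply: gdist_lb => l hl; rewrite lee_fin.
have [c hc ac] := lpos_chain hl (lpos_walk a0).
have [m e] := lpos_uniq (lpos_walk b0) hc.
apply: le_trans (h m) _; rewrite (_ : a - b + _ = a - c)//.
by rewrite e; ring.
Qed.

Lemma delta_ge_cycle : ((n%:R / 4)%:E <= delta R G)%E.
Proof.
have n0 : 3 <= n%:R :> R by rewrite ler_nat.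
(* On each of these ranges of [m] the lifted differences considered below have a constant sign. *)
have intP (m : int) : [\/ m = 0, m%:~R >= 1 :> R, m%:~R = -1 :> R | m%:~R <= -2 :> R].
  have [->|m0] := eqVneq m 0; first by constructor 1.
  have [m1|m1] := leP 1 m; first by constructor 2; rewrite (ler_int R 1).
  have [->|m2] := eqVneq m (-1); first by constructor 3.
  constructor 4; have : m%:~R <= (-2)%:~R :> R by rewrite ler_int; lia.
  by rewrite mulrNz.
have perC : walk C n%:R = walk C 0 :> (V -> R).
  transitivity (vpoint R (C 0)); last exact: esym (walk_nat R C 0).
  by rewrite walk_nat -(C_per 0).
have far (a b : R) : 0 <= a -> a <= b -> b <= n%:R -> b - a <= n%:R / 2 ->
    ((b - a)%:E <= gdist G (walk C a) (walk C b))%E.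
  move=> a0 ab bn abn; apply: gdist_walk_ge; [lra|lra|] => m.
  rewrite ler_normr; apply/orP; case: (intP m) => [->|hm|->|hm]; [right|left|right|right]; nra.
have geo (a b : R) : 0 <= a -> a <= b -> b <= n%:R -> b - a <= n%:R / 2 ->
    is_geodesic G (walk C a) (walk C b) (walk C @` [set s | a <= s <= b]).
  move=> a0 ab bn abn; apply: (@walk_geodesic _ _ _ _ n) => //; last exact: far.
  by apply: le_trans bn _; rewrite ler_nat.
have g1 := geo 0 (n%:R / 2); have g2 := geo (n%:R / 2) n%:R.
rewrite perC in g2.
apply: (bigon_delta (g1 _ _ _ _) (geodesic_sym (g2 _ _ _ _)) (p := walk C (n%:R / 4))); try lra.
- by exists (n%:R / 4) => //=; lra.
- move=> q [s /= hs <-]; apply: gdist_walk_ge; [lra|lra|] => m.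
  rewrite ler_normr; apply/orP; case: (intP m) => [->|hm|->|hm]; [right|left|right|right]; nra.
Qed.

End CycleLift.

(** * Thinness from path separation *)

Section Exit.
Context (R : realType) (V : Type) (G : sgraph V).
Implicit Types (u v w z : V) (p q r : V -> R) (f : R -> V -> R).

Definition supp p : set V := [set w | 0 < p w].

Lemma supp_vpoint z : supp (vpoint R z) = [set z].
Proof.
apply/seteqP; split=> w; rewrite /supp /=; last by move=> ->; rewrite vpoint_same.
by move=> h; apply: contrapT => wz; move: h; rewrite vpoint_neq// ltxx.
Qed.

Lemma supp_epoint u v (t : R) : u <> v -> 0 < t < 1 -> supp (epoint u v t) = [set u; v].
Proof.
move=> uv t01; apply/seteqP; split=> w; rewrite /supp /=; first exact: epoint_supp.
by move=> [->|->]; [rewrite epointl//; lra|rewrite epointr//; lra].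
Qed.

Lemma gpoints_cases p : gpoints G p ->
  (exists z, p = vpoint R z) \/
  (exists u v t, [/\ adj G u v, 0 < t < 1 & p = epoint u v t]).
Proof.
move=> [[z ->]|[u [v [t [uv t01 ->]]]]]; first by left; exists z.
have [->|t0] := eqVneq t 0; first by left; exists u; rewrite epoint0.
have [->|t1] := eqVneq t 1; first by left; exists v; rewrite epoint1.
right; exists u, v, t; split=> //.
by move: t01; rewrite !le_eqVlt (negbTE t1) [0 == t]eq_sym (negbTE t0).
Qed.

Lemma gpoints_supp_adj p u v : gpoints G p -> supp p u -> supp p v -> u = v \/ adj G u v.
Proof.
move=> /gpoints_cases[[z ->]|[a [b [t [ab t01 ->]]]]].
  by rewrite supp_vpoint => -> ->; left.
rewrite supp_epoint//; last exact: adj_neq ab.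
by move=> [->|->] [->|->]; [left|right|right; exact: adj_sym|left].
Qed.

(** Coordinates are 1-Lipschitz, so the positive ones stay positive nearby; further vertices may
    enter the support. *)
Lemma supp_open p : gpoints G p -> exists2 e, 0 < e &
  forall q (l : R), dle G p q l -> l < e -> supp p `<=` supp q.
Proof.
move=> /gpoints_cases[[z ->]|[a [b [t [ab t01 ->]]]]].
  exists 1 => [//|q l h l1]; rewrite supp_vpoint => _ ->.
  have := dle_coord z h; rewrite vpoint_same ler_norml /supp /=; lra.
have nab := adj_neq ab.
exists (Num.min t (1 - t)); first by rewrite lt_min; apply/andP; split; lra.
move=> q l h; rewrite lt_min => /andP[lt1 lt2]; rewrite supp_epoint// => _ [->|->].
- by have := dle_coord a h; rewrite epointl// ler_norml /supp /=; lra.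
- by have := dle_coord b h; rewrite epointr// ler_norml /supp /=; lra.
Qed.

Definition lip_path f (a b : R) : Prop :=
  (forall t, a <= t <= b -> gpoints G (f t)) /\
  (forall s t, a <= s -> s <= t -> t <= b -> dle G (f s) (f t) (t - s)).

Lemma lip_path_sub f (a b c d : R) : lip_path f a b -> a <= c -> d <= b -> lip_path f c d.
Proof. by move=> [h1 h2] ac db; split=> [t tcd|s t cs st td]; [apply: h1|apply: h2]; lra. Qed.

Lemma lip_path_rev f (a b : R) : lip_path f a b -> lip_path (fun t => f (- t)) (- b) (- a).
Proof.
move=> [h1 h2]; split=> [t tab|s t bs st ta]; first by apply: h1; lra.
by apply: dleC; apply: dle_weak (h2 _ _ _ _ _) _; lra.
Qed.

(* Upward closed conditions on the support are open, and within an open edge the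
   support does not change, so they can be lost only at a vertex. *)
Lemma path_exit f (a b : R) (K : set V -> Prop) : a <= b -> lip_path f a b ->
    (forall A B : set V, K A -> A `<=` B -> K B) ->
    K (supp (f a)) -> ~ K (supp (f b)) ->
  exists t z d, [/\ a <= t <= b, f t = vpoint R z, ~ K [set z], adj G z d & K [set z; d]].
Proof.
move=> ab [fG flip] Kmon Ka Kb.
(* [K] fails at [sup S]: if it held there, it would hold slightly beyond by [supp_open]. *)
pose S := [set t | a <= t <= b /\ forall r : R, a <= r <= t -> K (supp (f r))].
have Sa : S a.
  by split=> [|r ra]; [lra|rewrite (_ : r = a)//; lra].
have Sub : has_ubound S by exists b => t [tab _]; lra.
have Ssup : has_sup S by split=> //; exists a.
set t0 := sup S.
have at0 : a <= t0 by exact: ub_le_sup.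
have t0b : t0 <= b by apply: ge_sup => [|t [tab _]]; [exists a|lra].
have before (r : R) : a <= r -> r < t0 -> K (supp (f r)).
  move=> ar rt0; have e0 : 0 < t0 - r by lra.
  have [s [sab hs]] := sup_adherent e0 Ssup; rewrite -/t0 => rs.
  by apply: hs; lra.
have Kt0 : ~ K (supp (f t0)).
  move=> Kt0; have t0b' : t0 < b.
    by rewrite lt_neqAle t0b andbT; apply/eqP => e; apply: Kb; rewrite -e.
  have [|e e0 he] := @supp_open (f t0); first by apply: fG; lra.
  pose t1 := Num.min b (t0 + e / 2).
  have t1b : t1 <= b by rewrite /t1 ge_min lexx.
  have t1e : t1 <= t0 + e / 2 by rewrite /t1 ge_min lexx orbT.
  have t01 : t0 < t1 by rewrite /t1 lt_min t0b'; lra.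
  suff : t1 <= t0 by lra.
  apply: ub_le_sup => //; split=> [|r rt1]; first lra.
  have [rt0|t0r] := ltP r t0; first by apply: before; lra.
  apply: Kmon Kt0 (he _ (r - t0) _ _); last lra.
  by apply: flip; lra.
have at0' : a < t0.
  by rewrite lt_neqAle at0 andbT; apply/eqP => e; apply: Kt0; rewrite -e.
have ft0 : gpoints G (f t0) by apply: fG; lra.
have [e e0 he] := supp_open ft0.
pose t1 := Num.max a (t0 - e / 2).
have at1 : a <= t1 by rewrite /t1 le_max lexx.
have t1e : t0 - e / 2 <= t1 by rewrite /t1 le_max lexx orbT.
have t10 : t1 < t0 by rewrite /t1 gt_max at0'; lra.
have Kt1 := before t1 at1 t10.
have ft1 : gpoints G (f t1) by apply: fG; lra.
have sub : supp (f t0) `<=` supp (f t1).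
  by apply: (he _ (t0 - t1)); [apply: dleC; apply: flip; lra|lra].
move: (ft0) => /gpoints_cases[[z fz]|[u [v [t [uv t01 fe]]]]]; last first.
  (* Inside an edge the inclusion [sub] relates supports of two elements, hence is an equality, and
     [K] would hold at [t0]. *)
  exfalso; apply: Kt0; apply: Kmon Kt1 _ => w hw.
  have nuv := adj_neq uv; move: sub; rewrite fe supp_epoint// => sub.
  have [] := gpoints_cases ft1 => [[z ez]|[u' [v' [t' [uv' t01' fe']]]]].
    move: sub; rewrite ez supp_vpoint => sub; case: nuv.
    by rewrite (sub u)//; [rewrite (sub v)//; right|left].
  have nuv' := adj_neq uv'; move: sub hw; rewrite fe' supp_epoint// => sub hw.
  have su : u = u' \/ u = v' by apply: (sub u); left.
  have sv : v = u' \/ v = v' by apply: (sub v); right.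
  have {}hw : w = u' \/ w = v' by [].
  have : w = u \/ w = v; last by [].
  by case: su => su; case: sv => sv; case: hw => hw; try congruence;
    [left|right|right|left]; congruence.
exists t0, z; move: sub Kt0; rewrite fz supp_vpoint => sub Kt0.
have [[z' ez]|[u' [v' [t' [uv' t01' fe']]]]] := gpoints_cases ft1.
  by exfalso; apply: Kt0; move: Kt1; rewrite ez supp_vpoint;
    rewrite ez supp_vpoint in sub; rewrite (sub z).
have nuv' := adj_neq uv'; rewrite fe' supp_epoint// in sub Kt1.
have [zu|zv] := sub z erefl.
- by exists v'; split=> //; [lra|rewrite zu|rewrite zu].
- exists u'; split=> //; [lra|rewrite zv; exact: adj_sym|].
  by apply: Kmon Kt1 _ => w; rewrite zv => -[->|->]; [right|left].
Qed.

Lemma path_exit_rev f (a b : R) (K : set V -> Prop) : a <= b -> lip_path f a b ->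
    (forall A B : set V, K A -> A `<=` B -> K B) ->
    K (supp (f b)) -> ~ K (supp (f a)) ->
  exists t z d, [/\ a <= t <= b, f t = vpoint R z, ~ K [set z], adj G z d & K [set z; d]].
Proof.
move=> ab hf Kmon Kb Ka; have [|||||t [z [d [tab ? ? ? ?]]]] :=
  @path_exit (fun t => f (- t)) (- b) (- a) K.
- lra.
- exact: lip_path_rev.
- exact: Kmon.
- by rewrite opprK.
- by rewrite opprK.
- by exists (- t), z, d; split=> //; lra.
Qed.

Definition geo_path g (L : R) : Prop := [/\ 0 <= L, lip_path g 0 L &
  forall s t l, 0 <= s <= L -> 0 <= t <= L -> dle G (g s) (g t) l -> `|s - t| <= l].

Lemma geo_path_rev g (L : R) : geo_path g L -> geo_path (fun t => g (L - t)) L.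
Proof.
move=> [L0 [gG glip] gd]; split=> //; first split.
- by move=> t tL; apply: gG; lra.
- by move=> s t s0 st tL; apply: dleC; apply: dle_weak (glip _ _ _ _ _) _; lra.
- move=> s t l sL tL /gd => /(_ ltac:(lra) ltac:(lra)).
  by rewrite distrC; congr (Num.norm _ <= _); ring.
Qed.

Definition on_path q (f : R -> V -> R) (M : R) : Prop := exists2 t, 0 <= t <= M & f t = q.

(** * Gates of a block *)

Section Block.
(* [D b] is what hangs at the vertex [b] of the block [B]. *)
Variables (B : set V) (D : V -> set V).
Hypothesis B_cover : forall w, ~ B w -> exists2 b, B b & D b w.
Hypothesis D_out : forall b w, D b w -> ~ B w.
Hypothesis D_bd : forall b d z, B b -> D b d -> adj G d z -> D b z \/ z = b.

(** If [g 0] hangs at [b], then [g] enters the block at the vertex [b], and [f] has to pass [b] too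
    unless [g L] also hangs there. In that case [g] leaves through [b] as well; a geodesic visits a
    point only once, so [g s] is [b], which the last hypothesis excludes. *)
Lemma block_gate g f (L M s : R) : geo_path g L -> 0 <= M -> lip_path f 0 M ->
    f 0 = g 0 -> f M = g L -> 0 <= s <= L -> supp (g s) `<=` B ->
    (forall b, g s = vpoint R b ->
       ~ ((supp (g 0) `&` D b !=set0) /\ (supp (g L) `&` D b !=set0))) ->
  exists s1, [/\ 0 <= s1 <= s, supp (g s1) `<=` B & on_path (g s1) f M].
Proof.
move=> [L0 gl gd] M0 fl f0 fM sL sB side.
have [xB|] := pselect (supp (g 0) `<=` B).
  by exists 0; split=> //; [lra|exists 0 => //; lra].
move=> /existsNP[w /not_implyP[xw /B_cover[b Bb Dw]]].
pose K (A : set V) := A `&` D b !=set0.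
have Kmon A A' : K A -> A `<=` A' -> K A'.
  by move=> [v [Av Dv]] AA'; exists v; split=> //; exact: AA'.
have Kx : K (supp (g 0)) by exists w.
have Ks : ~ K (supp (g s)) by move=> [v [/sB Bv /D_out]].
have gate z d : ~ K [set z] -> adj G z d -> K [set z; d] -> z = b.
  move=> Kz zd [v [[->|->] Dv]]; first by exfalso; apply: Kz; exists z.
  have [Dz|//] := D_bd Bb Dv (adj_sym zd).
  by exfalso; apply: Kz; exists z.
have s0 : 0 <= s by lra.
have gs : lip_path g 0 s by apply: lip_path_sub gl _ _; lra.
have [s1 [z [d [s1s gz Kz zd Kzd]]]] := path_exit s0 gs Kmon Kx Ks.
have zb := gate _ _ Kz zd Kzd; subst z.
exists s1; split=> //; first by rewrite gz supp_vpoint => _ ->.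
have [Ky|Ky] := pselect (K (supp (g L))); last first.
  rewrite -f0 in Kx; rewrite -fM in Ky.
  have [t [z [d' [tM fz Kz' zd' Kzd']]]] := path_exit M0 fl Kmon Kx Ky.
  by exists t => //; rewrite fz gz (gate _ _ Kz' zd' Kzd').
have sL' : s <= L by lra.
have gs' : lip_path g s L by apply: lip_path_sub gl _ _; lra.
have [s2 [z [d' [s2s gz' Kz' zd' Kzd']]]] := path_exit_rev sL' gs' Kmon Ky Ks.
have zb := gate _ _ Kz' zd' Kzd'; subst z.
have : `|s1 - s2| <= 0.
  by apply: gd; [lra|lra|rewrite gz gz'; exact: dle_refl].
rewrite normr_le0 subr_eq0 => /eqP e.
by exfalso; apply: (side b); [rewrite (_ : s = s1)//; lra|split].
Qed.

Lemma block_gates g f (L M s : R) : geo_path g L -> 0 <= M -> lip_path f 0 M ->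
    f 0 = g 0 -> f M = g L -> 0 <= s <= L -> supp (g s) `<=` B ->
    (forall b, g s = vpoint R b ->
       ~ ((supp (g 0) `&` D b !=set0) /\ (supp (g L) `&` D b !=set0))) ->
  exists s1 s2, [/\ 0 <= s1 <= s, s <= s2 <= L, supp (g s1) `<=` B /\ supp (g s2) `<=` B,
    on_path (g s1) f M & on_path (g s2) f M].
Proof.
move=> hg M0 fl f0 fM sL sB side.
have [s1 [h1 h2 h3]] := block_gate hg M0 fl f0 fM sL sB side.
have fl' : lip_path (fun t => f (M - t)) 0 M.
  case: fl => fG flip; split=> [t tM|a b a0 ab bM]; first by apply: fG; lra.
  by apply: dleC; apply: dle_weak (flip _ _ _ _ _) _; lra.
have [|||||s2 [k1 k2 [t tM k3]]] :=
    @block_gate (fun t => g (L - t)) (fun t => f (M - t)) L M (L - s)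
   (geo_path_rev hg) M0 fl'.
- by rewrite !subr0.
- by rewrite !subrr.
- lra.
- by rewrite (_ : L - (L - s) = s)//; ring.
- rewrite (_ : L - (L - s) = s); last by ring.
  by move=> b e [h h']; apply: (side b e); rewrite subr0 in h; rewrite subrr in h'.
exists s1, (L - s2); split=> //; first lra.
by exists (M - t) => //; lra.
Qed.

End Block.

(** The other two sides, run backwards and joined at [z], form one 1-Lipschitz path with the same
    ends as the first; the cyclic symmetry of triangles treats the three sides alike. *)
Lemma delta_le_paths (tau : R) : 0 <= tau ->
    (forall g f L M s, geo_path g L -> 0 <= M -> lip_path f 0 M -> f 0 = g 0 ->
       f M = g L -> 0 <= s <= L -> exists2 t, 0 <= t <= M & dle G (g s) (f t) tau) ->
  (delta R G <= tau%:E)%E.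
Proof.
move=> tau0 H.
have one S1 S2 S3 : geodesic_triangle G S1 S2 S3 -> forall p, S1 p ->
    (gdist_set G p (S2 `|` S3) <= tau%:E)%E.
  move=> [x [y [z [[L [g [L0 [g0 gL] gG gd ->]]] [L2 [g2 [L20 [g20 g2L] g2G g2d ->]]]
    [L3 [g3 [L30 [g30 g3L] g3G g3d ->]]]]]]] p [s /= sL <-].
  pose f t := if t <= L3 then g3 (L3 - t) else g2 (L2 - (t - L3)).
  have f1 t : 0 <= t <= L3 -> f t = g3 (L3 - t) by move=> tL; rewrite /f ifT//; lra.
  have f2 t : L3 <= t <= L3 + L2 -> f t = g2 (L2 - (t - L3)).
    move=> tL; rewrite /f; case: ifP => // tL3.
    have -> : t = L3 by lra.
    by rewrite !subrr subr0 g30 g2L.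
  have [||||||t tM hd] := H g f L (L3 + L2) s.
  - split=> //; [split=> // a b a0 ab bL|move=> a b l aL bL].
    + by rewrite /dle gd; [rewrite distrC ger0_norm//; lra|lra..].
    + by rewrite /dle gd// lee_fin.
  - lra.
  - have d1 a b : 0 <= a -> a <= b -> b <= L3 -> dle G (f a) (f b) (b - a).
      move=> a0 ab bL; rewrite !f1; [|lra..]; rewrite /dle g3d; [|lra..].
      by rewrite lee_fin ger0_norm; lra.
    have d2 a b : L3 <= a -> a <= b -> b <= L3 + L2 -> dle G (f a) (f b) (b - a).
      move=> a0 ab bL; rewrite !f2; [|lra..]; rewrite /dle g2d; [|lra..].
      by rewrite lee_fin ger0_norm; lra.
    split=> [t tM|a b a0 ab bM].
      have [tL|tL] := leP t L3; first by rewrite f1; [apply: g3G; lra|lra].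
      by rewrite f2; [apply: g2G; lra|lra].
    have [bL|bL] := leP b L3; first exact: d1.
    have [aL|aL] := leP L3 a; first by apply: d2; lra.
    have h1 := d1 a L3 ltac:(lra) ltac:(lra) ltac:(lra).
    have h2 := d2 L3 b ltac:(lra) ltac:(lra) ltac:(lra).
    by apply: dle_weak (dle_trans h1 h2) _; lra.
  - by rewrite f1; [rewrite subr0 g3L g0|lra].
  - by rewrite f2; [rewrite (_ : L2 - _ = 0) ?g20 ?gL//; ring|lra].
  - done.
  apply: le_trans hd; apply: ereal_inf_lbound; exists (f t) => //.
  have [tL|tL] := leP t L3.
    by right; exists (L3 - t); [rewrite /=; lra|rewrite f1//; lra].
  by left; exists (L2 - (t - L3)); [rewrite /=; lra|rewrite f2//; lra].
apply: ge_ereal_sup => _ [S1 [S2 [S3 [tri ->]]]].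
apply: ereal_inf_lbound; exists tau => //; split=> //.
have [x [y [z [h1 h2 h3]]]] := tri; split.
- exact: (one S1 S2 S3).
- by apply: (one S2 S3 S1); exists y, z, x.
- by apply: (one S3 S1 S2); exists z, x, y.
Qed.

End Exit.

(** * Blocks of small diameter *)

Section Blocks.
Context (R : realType) (V : Type) (G : sgraph V).
Implicit Types (u v w z m : V) (p q r : V -> R).

Lemma dle_neq u v (l : R) : u <> v -> dle G (vpoint R u) (vpoint R v) l -> 1 <= l.
Proof.
move=> uv h; have := dle_coord u h; rewrite vpoint_same vpoint_neq//.
by rewrite subr0 normr1.
Qed.

Lemma dle_nonadj u v (l : R) : u <> v -> ~ adj G u v ->
  dle G (vpoint R u) (vpoint R v) l -> 2 <= l.
Proof.
move=> uv nuv; have hl : edge_lip G (fun q : V -> R => q u - q v).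
  apply: edge_lip_le => a b s t ab nab s0 st t1; have ba := adj_sym ab.
  have [ua|ua] := pselect (u = a); have [ub|ub] := pselect (u = b); try congruence;
  have [va|va] := pselect (v = a); have [vb|vb] := pselect (v = b); try congruence;
    try subst u; try subst v; rewrite ?epointl ?epointr ?epoint_out//; lra.
move=> /(edge_lip_dle hl); rewrite !vpoint_same !vpoint_neq//; last by congruence.
by rewrite ler_norml; lra.
Qed.

Lemma chain_edge_exit p (z : V -> R) (l : R) : chain G p z l ->
  forall u v (t : R), adj G u v -> 0 <= t <= 1 -> p = epoint u v t ->
  [\/ exists2 t', 0 <= t' <= 1 & z = epoint u v t',
      exists2 k, chain G (vpoint R u) z k & t + k <= l |
      exists2 k, chain G (vpoint R v) z k & (1 - t) + k <= l].
Proof.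
elim=> [p' u v t uv t01 ->|a b s t0 q k ab s01 t001 hc IH u v t uv t01 e].
  by constructor 1; exists t.
have hfull := chain_cons ab s01 t001 hc.
have step (t1 : R) : 0 <= t1 <= 1 -> epoint a b t0 = epoint u v t1 -> `|t - t1| = `|s - t0| ->
  [\/ exists2 t', 0 <= t' <= 1 & q = epoint u v t',
      exists2 k', chain G (vpoint R u) q k' & t + k' <= `|s - t0| + k |
      exists2 k', chain G (vpoint R v) q k' & (1 - t) + k' <= `|s - t0| + k].
  move=> t101 e1 <-; have h1 := ler_norm (t - t1); have h2 := ler_norm (t1 - t).
  rewrite distrC in h2.
  have [h|[k' h hk]|[k' h hk]] := IH u v t1 uv t101 e1.
  - by constructor 1.
  - by constructor 2; exists k' => //; lra.
  - by constructor 3; exists k' => //; lra.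
have nuv := adj_neq uv.
have [[? ? ?]|[? ? ts]|[-> e0]|[-> e1]] := epoint_eq nuv (adj_neq ab) t01 s01 (esym e).
- by subst; exact: (step t0).
- subst a b; apply: (step (1 - t0)); [lra|by rewrite epoint_sym|].
  by rewrite ts distrC; congr Num.norm; ring.
- by constructor 2; exists (`|s - t0| + k); [rewrite -e0|rewrite add0r].
- by constructor 3; exists (`|s - t0| + k); [rewrite -e1|rewrite subrr add0r].
Qed.

(** Which end is used may depend on the chain approximating the distance. If both bounds failed,
    they would fail by a margin, and a chain that is shortest up to this margin contradicts one of
    them. *)
Lemma dle_edge_exit u v (t : R) (z : V -> R) (l : R) : adj G u v -> 0 <= t <= 1 ->
    dle G (epoint u v t) z l ->
  [\/ exists2 t', 0 <= t' <= 1 & z = epoint u v t',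
      dle G (vpoint R u) z (l - t) | dle G (vpoint R v) z (l - (1 - t))].
Proof.
move=> uv t01 h; have [on|off] := pselect (exists2 t' : R, 0 <= t' <= 1 & z = epoint u v t').
  by constructor 1.
have gap w c : ~ dle G (vpoint R w) z (l - c) ->
    exists2 e, 0 < e & ~ dle G (vpoint R w) z (l - c + e).
  move=> hn; apply: contrapT => hc; apply: hn; apply/lee_addgt0Pr => e e0.
  rewrite -EFinD; apply: contrapT => he; apply: hc; exists e => //.
have [hu|/gap[e1 e10 hu]] := pselect (dle G (vpoint R u) z (l - t)); first by constructor 2.
have [hv|/gap[e2 e20 hv]] := pselect (dle G (vpoint R v) z (l - (1 - t))); first by constructor 3.
have e0 : 0 < Num.min e1 e2 by rewrite lt_min e10.
have [k hk kl] := dle_approx h e0.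
have me1 : Num.min e1 e2 <= e1 by rewrite ge_min lexx.
have me2 : Num.min e1 e2 <= e2 by rewrite ge_min lexx orbT.
have [//|[k' hk' kk]|[k' hk' kk]] := chain_edge_exit hk uv t01 erefl.
- by exfalso; apply: hu; apply: dle_weak (chain_dle hk') _; lra.
- by exfalso; apply: hv; apply: dle_weak (chain_dle hk') _; lra.
Qed.

Definition nbhd1 u v : Prop := u = v \/ adj G u v.

Lemma near_sym u v : nbhd1 u v -> nbhd1 v u.
Proof. by move=> [->|h]; [left|right; exact: adj_sym]. Qed.

Lemma dle_near u v : nbhd1 u v -> dle G (vpoint R u) (vpoint R v) 1.
Proof. by move=> [->|h]; [apply: dle_refl; lra|exact: dle_adj]. Qed.

Definition edge_in (B : set V) p : Prop := exists u v t,
  [/\ B u, B v, adj G u v, 0 <= t <= 1 & p = epoint u v t].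

Lemma edge_in_supp B p : gpoints G p -> supp p `<=` B ->
  (forall u, B u -> exists2 v, B v & adj G u v) -> edge_in B p.
Proof.
move=> /gpoints_cases[[z ->]|[u [v [t [uv t01 ->]]]]] sB hB.
  rewrite supp_vpoint in sB; have Bz := sB z erefl; have [v Bv zv] := hB z Bz.
  by exists z, v, 0; split=> //; [lra|rewrite epoint0].
rewrite supp_epoint// in sB; last exact: adj_neq uv.
by exists u, v, t; split=> //; [apply: sB; left|apply: sB; right|lra].
Qed.

Lemma dle_hub B c p : edge_in B p -> (forall w, B w -> nbhd1 w c) ->
  dle G p (vpoint R c) (3 / 2).
Proof.
move=> [u [v [t [Bu Bv uv t01 ->]]]] hB.
have du := dle_trans (dleC (dle_epointl uv t01)) (dle_near (hB u Bu)).
have dv := dle_trans (dleC (dle_epointr uv t01)) (dle_near (hB v Bv)).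
by have [t2|t2] := leP t (2^-1); [apply: dle_weak du _|apply: dle_weak dv _]; lra.
Qed.

Lemma dle_hub_diam B c p q : edge_in B p -> edge_in B q ->
  (forall w, B w -> nbhd1 w c) -> dle G p q 3.
Proof.
move=> hp hq hB; apply: dle_weak (dle_trans (dle_hub hp hB) (dleC (dle_hub hq hB))) _; lra.
Qed.

(** Each end of one edge is near an end of the other; asking this in both directions yields a
    matching of the ends. The two routes along it have total length at most 4, so one has length at
    most 2. *)
Lemma dle_dominating_diam B p q : edge_in B p -> edge_in B q ->
    (forall a d e, B a -> B d -> B e -> adj G d e -> nbhd1 a d \/ nbhd1 a e) ->
  dle G p q 2.
Proof.
move=> [u [v [s [Bu Bv uv s01 ->]]]] [a [b [t [Ba Bb ab t01 ->]]]] dom.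
have pu := dleC (dle_epointl uv s01); have pv := dleC (dle_epointr uv s01).
have qa := dle_epointl ab t01; have qb := dle_epointr ab t01.
have par : nbhd1 u a -> nbhd1 v b -> dle G (epoint u v s) (epoint a b t) 2.
  move=> /dle_near h1 /dle_near h2.
  have [st|st] := leP (s + t) 1.
    by apply: dle_weak (dle_trans (dle_trans pu h1) qa) _; lra.
  by apply: dle_weak (dle_trans (dle_trans pv h2) qb) _; lra.
have anti : nbhd1 u b -> nbhd1 v a -> dle G (epoint u v s) (epoint a b t) 2.
  move=> /dle_near h1 /dle_near h2.
  have [st|st] := leP (s + (1 - t)) 1.
    by apply: dle_weak (dle_trans (dle_trans pu h1) qb) _; lra.
  by apply: dle_weak (dle_trans (dle_trans pv h2) qa) _; lra.
have [ua|ub] := dom u a b Bu Ba Bb ab; have [va|vb] := dom v a b Bv Ba Bb ab.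
- have [/near_sym h|/near_sym h] := dom b u v Bb Bu Bv uv; [exact: anti|exact: par].
- exact: par.
- exact: anti.
- have [/near_sym h|/near_sym h] := dom a u v Ba Bu Bv uv; [exact: par|exact: anti].
Qed.

(** The last hypothesis makes any two edges share a vertex. The route through it and the route
    through the two other ends have total length at most 3. *)
Lemma dle_triangle_diam B p q : edge_in B p -> edge_in B q ->
    (forall a b, B a -> B b -> nbhd1 a b) ->
    (forall a b c d, B a -> B b -> B c -> B d ->
       [\/ a = b, c = d, a = c | a = d \/ b = c \/ b = d]) ->
  dle G p q (3 / 2).
Proof.
move=> [u [v [s [Bu Bv uv s01 ->]]]] [a [b [t [Ba Bb ab t01 ->]]]] near_B share.
have common z x y (s' t' : R) : adj G z x -> adj G z y -> nbhd1 x y ->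
    0 <= s' <= 1 -> 0 <= t' <= 1 ->
    dle G (epoint z x s') (epoint z y t') (3 / 2).
  move=> zx zy /dle_near xy s'01 t'01.
  have [st|st] := leP (s' + t') (3 / 2).
    by apply: dle_weak (dle_trans (dleC (dle_epointl zx s'01)) (dle_epointl zy t'01)) _; lra.
  have xt := dle_trans (dleC (dle_epointr zx s'01)) xy.
  apply: dle_weak (dle_trans xt (dle_epointr zy t'01)) _; lra.
have h1 : 0 <= 1 - s <= 1 by lra. have h2 : 0 <= 1 - t <= 1 by lra.
have vu := adj_sym uv; have ba := adj_sym ab.
have [/(adj_neq uv)//|/(adj_neq ab)//|e|[e|[e|e]]] := share u v a b Bu Bv Ba Bb.
- by subst a; apply: common => //; exact: near_B.
- by subst b; rewrite [epoint a u t]epoint_sym; apply: common => //; exact: near_B.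
- by subst a; rewrite [epoint u v s]epoint_sym; apply: common => //; exact: near_B.
- by subst b; rewrite [epoint u v s]epoint_sym [epoint a v t]epoint_sym;
    apply: common => //; exact: near_B.
Qed.

Lemma path_exit_between (f : R -> V -> R) (M : R) (K : set V -> Prop) q q' :
    lip_path G f 0 M -> (forall A B : set V, K A -> A `<=` B -> K B) ->
    on_path q f M -> on_path q' f M -> K (supp q) -> ~ K (supp q') ->
  exists z d, [/\ ~ K [set z], adj G z d, K [set z; d] & on_path (vpoint R z) f M].
Proof.
move=> fl Kmon [s sM <-] [t tM <-] Ks Kt; have [st|ts] := leP s t.
  have fst : lip_path G f s t by apply: lip_path_sub fl _ _; lra.
  have [r [z [d [rst fr ? ? ?]]]] := path_exit st fst Kmon Ks Kt.
  by exists z, d; split=> //; exists r => //; lra.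
have ts' := ltW ts; have fst : lip_path G f t s by apply: lip_path_sub fl _ _; lra.
have [r [z [d [rst fr ? ? ?]]]] := path_exit_rev ts' fst Kmon Ks Kt.
by exists z, d; split=> //; exists r => //; lra.
Qed.

(** The point [q'] is too far from [q] to lie on the same edge, so the path has to leave that edge
    through one of its ends. *)
Lemma edge_pass (B : set V) (f : R -> V -> R) (M : R) u v (t : R) q q' :
    lip_path G f 0 M -> adj G u v -> 0 <= t <= 1 -> q = epoint u v t ->
    on_path q f M -> on_path q' f M -> edge_in B q' ->
    (forall l : R, dle G q q' l -> 5 / 2 < l) ->
  exists z, (z = u \/ z = v) /\ on_path (vpoint R z) f M.
Proof.
move=> f_lip uv t01 qe q_on q'_on q'B qq'.
have [t0|t0] := eqVneq t 0; first by exists u; split; [left|rewrite -(epoint0 R u v) -t0 -qe].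
have [t1|t1] := eqVneq t 1; first by exists v; split; [right|rewrite -(epoint1 R u v) -t1 -qe].
have t01' : 0 < t < 1 by rewrite !lt_neqAle t1 eq_sym t0 /=.
have nuv := adj_neq uv.
pose K (A : set V) := A u /\ A v.
have Kmon A A' : K A -> A `<=` A' -> K A' by move=> [? ?] AA'; split; exact: AA'.
have Kq : K (supp q) by rewrite qe supp_epoint//; split; [left|right].
have Kq' : ~ K (supp q').
  have [u' [v' [t' [_ _ uv' t'01 q'e]]]] := q'B.
  rewrite q'e => -[hu hv]; have hu' := epoint_supp hu; have hv' := epoint_supp hv.
  have [t'' t''01 q'e'] : exists2 t'', 0 <= t'' <= 1 & q' = epoint u v t''.
    case: hu' => hu'; case: hv' => hv'; try congruence; subst u' v'.
      by exists t'.
    by exists (1 - t'); [lra|rewrite -epoint_sym].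
  have := dle_edge uv t01 t''01; rewrite -qe -q'e' => /qq'.
  have : `|t - t''| <= 1 by rewrite ler_norml; lra.
  lra.
have [z [e [_ ez Kze z_on]]] := path_exit_between f_lip Kmon q_on q'_on Kq Kq'.
exists z; split=> //.
have [[hu|hu] [hv|hv]] := Kze; try (by left); try (by right).
by exfalso; apply: nuv; rewrite hu hv.
Qed.

(** * Pendant vertices with two sides, for [n = 5] *)

Section Fan.
(** [side m w] is meant for [w] not near [m]: it tells on which side of the arc of [m] the arc of
    [w] lies. Arcs that meet [m] and reach out on the same side overlap there, which is
    [side_clique]. *)
Variables (c : V) (W : set V) (side : V -> V -> bool).
Hypothesis W_hub : forall w, W w -> adj G w c.
Hypothesis W_closed : forall w z, W w -> adj G w z -> W z \/ z = c.
Hypothesis side_adj : forall m w w', W m -> W w -> W w' -> ~ nbhd1 w m -> ~ nbhd1 w' m ->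
  adj G w w' -> side m w = side m w'.
Hypothesis side_clique : forall m u u' d d', W m -> W u -> W u' -> W d -> W d' ->
  adj G u m -> adj G u' m -> ~ nbhd1 d m -> ~ nbhd1 d' m -> adj G d u -> adj G d' u' ->
  side m d = side m d' -> nbhd1 u u'.

Let B : set V := [set w | W w \/ w = c].

Lemma fan_near w : B w -> nbhd1 w c.
Proof. by move=> [/W_hub|]; [right|left]. Qed.

Lemma fan_hub_dle m (z : V -> R) : edge_in B z ->
  (exists e : R, [/\ 0 <= e <= 1, dle G z (vpoint R m) e & dle G z (vpoint R c) (2 - e)]) \/
  (forall l, dle G z (vpoint R m) l -> dle G z (vpoint R c) l).
Proof.
move=> [u [v [t [Bu Bv uv t01 ->]]]].
have du := dleC (dle_epointl uv t01); have dv := dleC (dle_epointr uv t01).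
have cu := dle_trans du (dle_near (fan_near Bu)).
have cv := dle_trans dv (dle_near (fan_near Bv)).
have [mu|mu] := pselect (u = m).
  by subst m; left; exists t; split=> //; apply: dle_weak cv _; lra.
have [mv|mv] := pselect (v = m).
  by subst m; left; exists (1 - t); split=> //; [lra|apply: dle_weak cu _; lra].
right=> l /(dle_edge_exit uv t01)[[t' t'01 e]|/(dle_neq mu) h|/(dle_neq mv) h].
- have [] := @epoint_supp R V u v m t'; [by rewrite -e vpoint_same; lra|congruence|congruence].
- by apply: dle_weak cu _; lra.
- by apply: dle_weak cv _; lra.
Qed.

Variables (x p y : V -> R) (a b : R).
Hypothesis (xB : edge_in B x) (pB : edge_in B p) (yB : edge_in B y).
Hypothesis xp : dle G x p a.
Hypothesis py : dle G p y b.
Hypothesis xp_ge : forall l : R, dle G x p l -> a <= l.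
Hypothesis py_ge : forall l : R, dle G p y l -> b <= l.
Hypothesis xy_ge : forall l : R, dle G x y l -> a + b <= l.
Hypothesis a_gt : 5 / 4 < a.
Hypothesis b_gt : 5 / 4 < b.

(** Reaching [x] and [y] through the same end would save length. Through opposite ends, the detour
    by the hub is shorter than [a + b]: the mixed cases need [1 + 2 * s < 2 * a] or
    [3 - 2 * s < 2 * b], which is how [1/4] and [3/4] fit with [5/4]. *)
Lemma fan_no_mid m m' (t : R) : adj G m m' -> 4^-1 <= t <= 3 / 4 -> p = epoint m m' t -> False.
Proof.
have ha := a_gt; have hb := b_gt.
move=> mm' t01 pe.
have opp n n' (s : R) : adj G n n' -> 4^-1 <= s <= 3 / 4 -> p = epoint n n' s ->
    dle G (vpoint R n) x (a - s) -> dle G (vpoint R n') y (b - (1 - s)) -> False.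
  move=> nn' s01 pe' /dleC dx /dleC dy.
  have pn : dle G (vpoint R n) p s by rewrite pe'; apply: dle_epointl => //; lra.
  have pn' : dle G (vpoint R n') p (1 - s) by rewrite pe'; apply: dle_epointr => //; lra.
  have [[e [e01 dxm dxc]]|/(_ _ dx) dxc] := fan_hub_dle n xB.
    have h1 := xp_ge (dle_trans dxm pn).
    have [[e' [e'01 dym dyc]]|/(_ _ dy) dyc] := fan_hub_dle n' yB.
      have h2 := py_ge (dleC (dle_trans dym pn')).
      by have := xy_ge (dle_trans dxc (dleC dyc)); lra.
    by have := xy_ge (dle_trans dxc (dleC dyc)); lra.
  have [[e' [e'01 dym dyc]]|/(_ _ dy) dyc] := fan_hub_dle n' yB.
    have h2 := py_ge (dleC (dle_trans dym pn')).
    by have := xy_ge (dle_trans dxc (dleC dyc)); lra.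
  by have := xy_ge (dle_trans dxc (dleC dyc)); lra.
have t01' : 0 <= t <= 1 by lra.
have off q (l : R) : 5 / 4 < l -> (forall k, dle G p q k -> l <= k) ->
    ~ exists2 t' : R, 0 <= t' <= 1 & q = epoint m m' t'.
  move=> l54 hq [t' t'01 qe]; have := dle_edge mm' t01' t'01; rewrite -pe -qe => /hq.
  have := ler_normB t t'; have : `|t - t'| <= 1 by rewrite ler_norml; lra.
  by move=> *; lra.
have px : dle G (epoint m m' t) x a by rewrite -pe; exact: dleC.
have py' : dle G (epoint m m' t) y b by rewrite -pe.
have [on|xm|xm'] := dle_edge_exit mm' t01' px.
- by apply: off a_gt _ on => k /dleC; exact: xp_ge.
- have [on|ym|ym'] := dle_edge_exit mm' t01' py'.
  + exact: off b_gt py_ge on.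
  + by have := xy_ge (dle_trans (dleC xm) ym); lra.
  + exact: (opp m m' t).
- have [on|ym|ym'] := dle_edge_exit mm' t01' py'.
  + exact: off b_gt py_ge on.
  + apply: (opp m' m (1 - t)) => //; [exact: adj_sym|lra|by rewrite pe epoint_sym|].
    by apply: dle_weak ym _; lra.
  + by have := xy_ge (dle_trans (dleC xm') ym'); lra.
Qed.

Lemma fan_near_vertex : exists m (d : R), [/\ B m, dle G p (vpoint R m) d & d < 4^-1].
Proof.
have [u [v [t [Bu Bv uv t01 pe]]]] := pB.
have [t4|t4] := ltP t (4^-1).
  by exists u, t; split=> //; rewrite pe; exact: dleC (dle_epointl uv t01).
have [t34|t34] := leP t (3 / 4).
  by exfalso; apply: (fan_no_mid uv _ pe); lra.
by exists v, (1 - t); split=> //; [rewrite pe; exact: dleC (dle_epointr uv t01)|lra].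
Qed.

Section FanPath.
Variables (f : R -> V -> R) (M : R).
Hypothesis f_lip : lip_path G f 0 M.
Hypothesis (x_on : on_path x f M) (y_on : on_path y f M).

(** Since [q] is at distance less than 2 from [m], its edge has an end near [m]. The other end is
    not near [m], because the path leaves this edge through an end and avoids the vertices near [m].
    The end near [m] is not the hub, which is within [3/2] of [q']. *)
Lemma fan_outer m (d : R) q q' (k : R) : W m -> dle G p (vpoint R m) d -> d < 4^-1 ->
    edge_in B q -> edge_in B q' -> on_path q f M -> on_path q' f M ->
    dle G p q k -> k < 7 / 4 -> (forall l : R, dle G q q' l -> 5 / 2 < l) ->
    (forall z, nbhd1 z m -> ~ on_path (vpoint R z) f M) ->
  exists u v (t : R), [/\ W u /\ W v, adj G u v /\ adj G u m, ~ nbhd1 v m,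
    0 < t <= 1 /\ q = epoint u v t & t + 1 <= k + d].
Proof.
move=> Wm pm d4 qB q'B q_on q'_on pq k74 qq' avoid.
have mc : nbhd1 c m by right; exact: adj_sym (W_hub Wm).
have wlog_ u v (t : R) : B u -> B v -> adj G u v -> 0 <= t <= 1 -> q = epoint u v t ->
    ~ nbhd1 v m -> exists u v (t : R), [/\ W u /\ W v, adj G u v /\ adj G u m, ~ nbhd1 v m,
    0 < t <= 1 /\ q = epoint u v t & t + 1 <= k + d].
  move=> Bu Bv uv t01 qe vm.
  have mq := dle_trans (dleC pq) pm.
  have vm' : v <> m by move=> e; apply: vm; left.
  have avm : ~ adj G v m by move=> h; apply: vm; right.
  have [um|um] := pselect (nbhd1 u m); last first.
    exfalso; rewrite qe in mq.
    have um' : u <> m by move=> e; apply: um; left.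
    have aum : ~ adj G u m by move=> h; apply: um; right.
    have [[t' _ e]|/(dle_nonadj um' aum) h|/(dle_nonadj vm' avm) h] :=
      dle_edge_exit uv t01 mq; [|lra..].
    by have [] := @epoint_supp R V u v m t'; [rewrite -e vpoint_same; lra|congruence|congruence].
  have t0 : 0 < t.
    rewrite lt_neqAle; have [-> _] := andP t01; rewrite andbT; apply/eqP => t0.
    by apply: (avoid u um); rewrite -(epoint0 R u v) t0 -qe.
  have [uc|uc] := pselect (u = c).
    exfalso; subst u; have h1 := dleC (dle_epointl uv t01); rewrite -qe in h1.
    have := qq' _ (dle_trans h1 (dleC (dle_hub q'B fan_near))).
    lra.
  have Wu : W u by case: Bu.
  have Wv : W v by case: Bv => // vc; case: vm; rewrite vc.
  have aum : adj G u m.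
    by case: um => // e; case: vm; right; rewrite -e; exact: adj_sym.
  have um' := adj_neq aum.
  exists u, v, t; split=> //; first by split=> //; lra.
  rewrite qe in mq.
  have [[t' _ e]|/(dle_neq um') h|/(dle_nonadj vm' avm) h] := dle_edge_exit uv t01 mq; [|lra..].
  by have [] := @epoint_supp R V u v m t'; [rewrite -e vpoint_same; lra|congruence|congruence].
have [u [v [t [Bu Bv uv t01 qe]]]] := qB.
have [vm|vm] := pselect (nbhd1 v m); last exact: (wlog_ u v t).
have [um|um] := pselect (nbhd1 u m); last first.
  by apply: (wlog_ v u (1 - t)) => //; [exact: adj_sym|lra|rewrite -epoint_sym].
exfalso; have [z [zuv z_on]] := edge_pass f_lip uv t01 qe q_on q'_on q'B qq'.
by case: zuv => e'; subst z; [apply: (avoid u um)|apply: (avoid v vm)].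
Qed.

Lemma fan_path : exists2 t, 0 <= t <= M & dle G p (f t) (5 / 4).
Proof.
have ha := a_gt; have hb := b_gt.
apply: contrapT => no.
have far q (l : R) : on_path q f M -> dle G p q l -> 5 / 4 < l.
  move=> [t tM <-] h; rewrite ltNge; apply/negP => l54; apply: no; exists t => //.
  exact: dle_weak h _.
have [m [d [Bm pm d4]]] := fan_near_vertex.
(* As [1 + d < 5/4], a vertex near [m] on the path would be close enough to [p]. *)
have avoid z : nbhd1 z m -> ~ on_path (vpoint R z) f M.
  move=> /near_sym/dle_near zm /far h; have := h _ (dle_trans pm zm); lra.
have xc := dle_hub xB fan_near; have yc := dle_hub yB fan_near.
have ab3 := xy_ge (dle_trans xc (dleC yc)).
have xy l : dle G x y l -> 5 / 2 < l by move=> /xy_ge; lra.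
have yx l : dle G y x l -> 5 / 2 < l by move=> /dleC; exact: xy.
have [mc|mc] := pselect (m = c).
  have [u [v [t [Bu Bv uv t01 xe]]]] := xB.
  have um : nbhd1 u m by rewrite mc; exact: fan_near.
  have vm : nbhd1 v m by rewrite mc; exact: fan_near.
  have [z [zuv z_on]] := edge_pass f_lip uv t01 xe x_on y_on yB xy.
  by case: zuv => e; subst z; [apply: (avoid u um)|apply: (avoid v vm)].
have Wm : W m by case: Bm.
have mc' : nbhd1 c m by right; exact: adj_sym (W_hub Wm).
(* [a + b <= 3], while both exceed [5/4]. *)
have a74 : a < 7 / 4 by lra. have b74 : b < 7 / 4 by lra.
have [u [v [t [[Wu Wv] [uv um] vm [t01 xe] ta]]]] :=
  fan_outer Wm pm d4 xB yB x_on y_on (dleC xp) a74 xy avoid.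
have [u' [v' [t' [[Wu' Wv'] [uv' um'] vm' [t'01 ye] tb]]]] :=
  fan_outer Wm pm d4 yB xB y_on x_on py b74 yx avoid.
(* On the same side [u] and [u'] are near, and the route of length [t + 1 + t'] from [x] to [y] is
   at most [a + b + 2 * d - 1], which is too short. *)
have [sv|sv] := pselect (side m v = side m v').
  have /dle_near uu' := side_clique Wm Wu Wu' Wv Wv' um um' vm vm' (adj_sym uv) (adj_sym uv') sv.
  have t01b : 0 <= t <= 1 by lra. have t'01b : 0 <= t' <= 1 by lra.
  have xu := dle_epointl uv t01b; have yu := dle_epointl uv' t'01b.
  rewrite -xe in xu; rewrite -ye in yu.
  have := xy_ge (dle_trans (dle_trans (dleC xu) uu') yu); lra.
(* On different sides, the path has to leave the vertices on the side of [v], and can do so only at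
   the hub or at another vertex near [m]. *)
pose K (A : set V) := exists2 w, A w & [/\ W w, ~ nbhd1 w m & side m w = side m v].
have Kmon A A' : K A -> A `<=` A' -> K A' by move=> [w Aw h] AA'; exists w => //; exact: AA'.
have Kx : K (supp x).
  exists v; last by [].
  have nuv := adj_neq uv; rewrite xe /supp /= epointr//; lra.
have Ky : ~ K (supp y).
  move=> [w hw [_ wm ws]]; rewrite ye in hw.
  have [wu|wv] := epoint_supp hw; first by apply: wm; right; rewrite wu.
  by apply: sv; rewrite -ws wv.
have [z [e [Kz ze [w zew [Ww wm ws]] z_on]]] := path_exit_between f_lip Kmon x_on y_on Kx Ky.
have {zew} we : w = e.
  by case: zew => // wz; exfalso; apply: Kz; exists w.
subst w; have [Wz|zc] := W_closed Ww (adj_sym ze); last by apply: (avoid c mc'); rewrite -zc.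
have [zm|zm] := pselect (nbhd1 z m); first exact: (avoid z zm).
by apply: Kz; exists z => //; split=> //; rewrite -ws (side_adj Wm Wz Ww).
Qed.

End FanPath.
End Fan.
End Blocks.

(** * Cycles with pendant neighbourhoods *)

Section Cactus.
Context (R : realType) (V : Type) (G : sgraph V).
Implicit Types (u v w z b : V) (p q r : V -> R).
Variables (n : nat) (C : nat -> V) (kappa : V -> nat).
Hypothesis n3 : (3 <= n)%N.
Hypothesis C_per : forall k, C (k + n) = C k.
Hypothesis C_adj : forall k, adj G (C k) (C k.+1).
Hypothesis kappaC : forall k, kappa (C k) = (k %% n)%N.
Hypothesis adj_kappa : forall u v, adj G u v -> kappa u = kappa v \/
  exists k, (u = C k /\ v = C k.+1) \/ (v = C k /\ u = C k.+1).
Hypothesis hub_adj : forall w, w <> C (kappa w) -> adj G w (C (kappa w)).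

Definition pendant b : set V := [set w | C (kappa w) = b /\ w <> b].

Lemma cycle_mod k : C (k %% n) = C k.
Proof.
rewrite {2}(divn_eq k n) addnC; elim: (k %/ n)%N => [|m IH]; first by rewrite mul0n addn0.
by rewrite mulSn [(n + _)%N]addnC addnA C_per.
Qed.

Lemma C_kappaC k : C (kappa (C k)) = C k.
Proof. by rewrite kappaC cycle_mod. Qed.

Lemma pendant_hub b w : pendant b w -> adj G w b.
Proof. by move=> [<-]; exact: hub_adj. Qed.

Lemma pendant_closed b w z : pendant b w -> adj G w z -> pendant b z \/ z = b.
Proof.
move=> [wb wnb] /adj_kappa[e|[k [[wk _]|[_ wk]]]].
- by have [->|zb] := pselect (z = b); [right|left; split; rewrite // -e].
- by case: wnb; rewrite -wb wk C_kappaC.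
- by case: wnb; rewrite -wb wk C_kappaC.
Qed.

Lemma delta_ge_cactus : ((n%:R / 4)%:E <= delta R G)%E.
Proof.
have n0 : (0 < n)%N by case: n n3.
apply: (@delta_ge_cycle R V G n C (fun v => (kappa v)%:Z)) => //.
- move=> k; exists (- (k %/ n)%N%:Z); rewrite kappaC {2}(divn_eq k n) PoszD PoszM; ring.
- have succ k : exists m : int, (k.+1 %% n)%N%:Z = (k %% n)%N%:Z + 1 + m * n%:Z.
    exists ((k %/ n)%N%:Z - (k.+1 %/ n)%N%:Z).
    have e1 := divn_eq k n; have e2 := divn_eq k.+1 n.
    have : (k.+1)%:Z = k%:Z + 1 by rewrite -addn1 PoszD.
    rewrite {1}e2 {1}e1 !PoszD !PoszM => e; lia.
  move=> u v /adj_kappa[->|[k [[-> ->]|[-> ->]]]].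
  + by exists 0, 0; split=> //; ring.
  + by have [m e] := succ k; exists 1, m; split=> //; rewrite !kappaC e.
  + by have [m e] := succ k; exists (-1), (- m); split=> //; rewrite !kappaC e; ring.
Qed.

Lemma cycle_walk p : gpoints G p -> supp p `<=` range C ->
  exists2 a, 0 <= a <= n%:R & p = walk C a.
Proof.
have n0 : (0 < n)%N by case: n n3.
move=> /gpoints_cases[[z ->]|[u [v [t [uv t01 ->]]]]] sp.
  have [k _ <-] : range C z by apply: sp; rewrite supp_vpoint.
  exists (k %% n)%N%:R; last by rewrite walk_nat cycle_mod.
  by rewrite ler0n ler_nat ltnW// ltn_mod.
have nuv := adj_neq uv; rewrite supp_epoint// in sp.
have [i _ ui] : range C u by apply: sp; left.
have [j _ vj] : range C v by apply: sp; right.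
have on k (s : R) : 0 <= s <= 1 -> exists2 a, 0 <= a <= n%:R & epoint (C k) (C k.+1) s = walk C a.
  move=> s01; exists ((k %% n)%N%:R + s).
    have : (k %% n)%N.+1%:R <= n%:R :> R by rewrite ler_nat ltn_mod.
    have : 0 <= (k %% n)%N%:R :> R := ler0n _ _.
    rewrite -natr1; lra.
  rewrite walkE//; congr epoint; first by rewrite cycle_mod.
  by rewrite -(cycle_mod k.+1) -addn1 -modnDml addn1 cycle_mod.
have [e|[k [[-> ->]|[-> ->]]]] := adj_kappa uv.
- by exfalso; apply: nuv; rewrite -ui -vj -(C_kappaC i) -(C_kappaC j) ui vj e.
- by apply: on; lra.
- by rewrite epoint_sym; apply: on; lra.
Qed.

Lemma cycle_diam p q : gpoints G p -> gpoints G q -> supp p `<=` range C ->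
  supp q `<=` range C -> dle G p q (n%:R / 2).
Proof.
have one (a b : R) : 0 <= a -> a <= b -> b <= n%:R -> dle G (walk C a) (walk C b) (n%:R / 2).
  move=> a0 ab bn; have nn : n%:R <= n.+1%:R :> R by rewrite ler_nat.
  have lip := @dle_walk R V G C n _ _ (fun k _ => C_adj k).
  have [h|h] := leP (b - a) (n%:R / 2); first by apply: dle_weak (lip a b _ _ _) h; lra.
  have h1 : dle G (walk C 0) (walk C a) (a - 0) by apply: lip; lra.
  have h2 : dle G (walk C b) (walk C n%:R) (n%:R - b) by apply: lip; lra.
  have e : walk C (0 : R) = walk C n%:R.
    by transitivity (vpoint R (C 0)); [exact: (walk_nat R C 0)|rewrite walk_nat -(C_per 0)].
  by rewrite e in h1; apply: dle_weak (dleC (dle_trans h2 h1)) _; lra.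
move=> hp hq /(cycle_walk hp)[a a0 ->] /(cycle_walk hq)[b b0 ->].
by have [ab|ba] := leP a b; [apply: one; lra|apply: dleC; apply: one; lra].
Qed.

(** * Geodesic points on the cycle and in pendant cones *)

Section Thin.
Variables (g f : R -> V -> R) (L M s : R).
Hypothesis (hg : geo_path G g L) (M0 : 0 <= M) (hf : lip_path G f 0 M).
Hypothesis (f0 : f 0 = g 0) (fM : f M = g L) (sL : 0 <= s <= L).

(** Both gates are on the path and on the geodesic, at most [2 * tau] apart, so the one nearer to
    [g s] is within [tau]. *)
Lemma thin_of_gates (s1 s2 tau : R) : 0 <= s1 <= s -> s <= s2 <= L ->
    on_path (g s1) f M -> on_path (g s2) f M -> dle G (g s1) (g s2) (2 * tau) ->
  exists2 t, 0 <= t <= M & dle G (g s) (f t) tau.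
Proof.
move=> s1s s2L [t1 t1M e1] [t2 t2M e2] h; case: hg => L0 [gG glip] gd.
have := gd _ _ _ _ _ h => /(_ ltac:(lra) ltac:(lra)).
rewrite distrC ger0_norm; last lra.
move=> s12; have [h1|h1] := leP (s - s1) tau.
  by exists t1 => //; rewrite e1; apply: dleC; apply: dle_weak (glip _ _ _ _ _) h1; lra.
exists t2 => //; rewrite e2; apply: dle_weak (glip _ _ _ _ _) _; lra.
Qed.

Lemma thin_cycle : supp (g s) `<=` range C ->
    (forall b, g s = vpoint R b ->
       ~ ((supp (g 0) `&` pendant b !=set0) /\ (supp (g L) `&` pendant b !=set0))) ->
  exists2 t, 0 <= t <= M & dle G (g s) (f t) (n%:R / 4).
Proof.
move=> sC side.
have [|||//|//|//|//||s1 [s2 [h1 h2 [h3 h4] h5 h6]]] :=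
  @block_gates R V G (range C) pendant _ _ _ g f L M s hg M0 hf.
- by move=> w wC; exists (C (kappa w)) => //; split=> // e; apply: wC; exists (kappa w).
- by move=> b w [wb wnb] [k _ e]; apply: wnb; rewrite -wb -e C_kappaC.
- by move=> b d z _; exact: pendant_closed.
- exact: side.
case: (hg) => L0 [gG _] _; apply: (thin_of_gates h1 h2 h5 h6).
by apply: dle_weak (cycle_diam _ _ h3 h4) _; [apply: gG; lra|apply: gG; lra|lra].
Qed.

(** The block is the cone over [D] with apex [b], and the whole rest of the graph hangs at [b]. When
    [g s] is the apex, [g 0] lies in the cone, so the two ends do not both lie in the rest. *)
Lemma cone_gates b w (D : set V) : D w -> ~ D b ->
    (forall u z, D u -> adj G u z -> D z \/ z = b) -> (forall u, D u -> adj G u b) ->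
    0 < g s w \/ (g s = vpoint R b /\ 0 < g 0 w) ->
  let B := [set u | D u \/ u = b] in
  exists s1 s2, [/\ 0 <= s1 <= s, s <= s2 <= L,
    [/\ edge_in G B (g s1), edge_in G B (g s) & edge_in G B (g s2)],
    on_path (g s1) f M & on_path (g s2) f M].
Proof.
move=> Dw Db Dcl Dhub hw B; case: (hg) => L0 [gG _] _.
have in_edge t : 0 <= t <= L -> supp (g t) `<=` B -> edge_in G B (g t).
  move=> tL sB; apply: edge_in_supp sB _; first exact: gG.
  move=> u [Du|->]; first by exists b; [right|exact: Dhub].
  by exists w; [left|exact: adj_sym (Dhub _ Dw)].
have sB : supp (g s) `<=` B.
  case: hw => [sw u su|[-> _]]; last by rewrite supp_vpoint => _ ->; right.
  have [<-|wu] := gpoints_supp_adj (gG s sL) sw su; first by left.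
  by have [Du|->] := Dcl _ _ Dw wu; [left|right].
have [|||//|//|//|//||s1 [s2 [h1 h2 [h3 h4] h5 h6]]] :=
  @block_gates R V G B (fun b' => [set u | b' = b /\ ~ B u]) _ _ _ g f L M s hg M0 hf.
- by move=> u Bu; exists b => //; right.
- by move=> b' u [].
- move=> b' d z Bb' [e Bd] dz; subst b'.
  have [Bz|] := pselect (B z); last by left.
  right; case: Bz => // Dz; exfalso; apply: Bd.
  by have [Dd|->] := Dcl _ _ Dz (adj_sym dz); [left|right].
- move=> b' gb' [[u [xu [e Bu]]] _]; subst b'.
  case: hw => [|[_ xw]]; first by rewrite gb' vpoint_neq ?ltxx// => e; apply: Db; rewrite -e.
  have g0 : gpoints G (g 0) by apply: gG; rewrite lexx.
  have [uw|uw] := gpoints_supp_adj g0 xu xw; first by apply: Bu; left; rewrite uw.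
  by apply: Bu; have [Du|->] := Dcl _ _ Dw (adj_sym uw); [left|right].
exists s1, s2; split=> //; split; apply: in_edge => //; lra.
Qed.

End Thin.

(** For [n = 3] the components of [pendant b] have at most two vertices; for [n = 4] each edge
    dominates its component. The cones over them then have diameter at most [3/2] and 2
    respectively, that is [n / 2]. *)
Hypothesis pendant3 : n = 3%N -> forall b a u c, pendant b a -> pendant b u -> pendant b c ->
  adj G a u -> adj G u c -> a = c.
Hypothesis pendant4 : n = 4%N -> forall b a u c d, pendant b a -> pendant b u ->
  pendant b c -> pendant b d -> adj G a u -> adj G u c -> adj G c d ->
  a <> c -> a <> d -> u <> d -> adj G a c \/ adj G a d.
Hypothesis pendant5 : n = 5%N -> forall b, exists side : V -> V -> bool,
  (forall m w w', pendant b m -> pendant b w -> pendant b w' ->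
     ~ nbhd1 G w m -> ~ nbhd1 G w' m -> adj G w w' -> side m w = side m w') /\
  (forall m u u' d d', pendant b m -> pendant b u -> pendant b u' -> pendant b d ->
     pendant b d' -> adj G u m -> adj G u' m -> ~ nbhd1 G d m -> ~ nbhd1 G d' m ->
     adj G d u -> adj G d' u' -> side m d = side m d' -> nbhd1 G u u').

(* For [n = 3, 4] this is the connected component of [w] in [pendant b]. *)
Definition ball2 b w : set V := [set u | pendant b u /\
  (u = w \/ adj G u w \/ exists2 w', pendant b w' & adj G u w' /\ adj G w' w)].

(** A third step away from [w] is undone by the chord that [pendant4] gives; under [pendant3]
    already two steps return to their start. *)
Lemma ball2_closed b w u z : (n <= 4)%N -> pendant b w -> ball2 b w u -> adj G u z ->
  ball2 b w z \/ z = b.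
Proof.
move=> n4 bw [bu hu] uz; have [bz|->] := pendant_closed bu uz; [left|by right].
split=> //; have zu := adj_sym uz.
have [zw|zw] := pselect (z = w); first by left.
have [uw|uw] := pselect (u = w); first by right; left; rewrite -uw.
have [auw|auw] := pselect (adj G u w); first by right; right; exists u.
case: hu => [//|[//|[w' bw' [uw' w'w]]]].
have [zw'|zw'] := pselect (z = w'); first by right; left; rewrite zw'.
have : n = 3 \/ n = 4 by move: n3 n4; case: n => [|[|[|[|[|]]]]]//; [left|right].
move=> [/pendant3 h|/pendant4 h].
  by case: zw'; exact: (h b z u w').
by have [h1|h1] := h b z u w' w bz bu bw' bw zu uw' w'w zw' zw uw; right; [right; exists w'|left].
Qed.

(** Being near the edge [d e] passes on to neighbours: a path of three edges ending with this one
    has a chord at its first vertex. Both [d] and [a] are connected to [w]. *)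
Lemma ball2_dominating b w a d e : n = 4 -> pendant b w ->
  ball2 b w a -> ball2 b w d -> ball2 b w e -> adj G d e -> nbhd1 G a d \/ nbhd1 G a e.
Proof.
move=> n4 bw [ba ha] [bd hd] [be _] de.
pose T u := nbhd1 G u d \/ nbhd1 G u e.
have Tcl u z : pendant b u -> pendant b z -> T u -> adj G u z -> T z.
  move=> bu bz Tu uz; have zu := adj_sym uz.
  have [zd|zd] := pselect (z = d); first by left; left.
  have [ze|ze] := pselect (z = e); first by right; left.
  have [ud|ud] := pselect (u = d); first by left; right; rewrite -ud.
  have [ue|ue] := pselect (u = e); first by right; right; rewrite -ue.
  case: Tu => -[//|h].
    by have [h1|h1] := pendant4 n4 bz bu bd be zu h de zd ze ue; [left|right]; right.
  by have [h1|h1] := pendant4 n4 bz bu be bd zu h (adj_sym de) ze zd ud; [right|left]; right.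
have Tw : T w.
  case: hd => [<-|[dw|[w' bw' [dw' w'w]]]]; first by left; left.
    by left; right; exact: adj_sym.
  by apply: (Tcl w') => //; left; right; exact: adj_sym.
case: ha => [->//|[aw|[w' bw' [aw' w'w]]]]; first exact: Tcl Tw (adj_sym aw).
apply: (Tcl w') (adj_sym aw') => //.
by apply: (Tcl w) (adj_sym w'w).
Qed.

Lemma delta_le_cactus : (delta R G <= (n%:R / 4)%:E)%E.
Proof.
have n0 : 3 <= n%:R :> R by rewrite ler_nat.
apply: delta_le_paths; first lra.
move=> g f L M s hg M0 hf f0 fM sL; case: (hg) => L0 [gG glip] gd.
(* Either a pendant vertex carries [g s], or [g s] is a hub at which both ends of [g] hang, or the
   cycle can serve as the block. *)
have [|none] := pselect (exists b w, pendant b w /\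
    (0 < g s w \/ (g s = vpoint R b /\ 0 < g 0 w /\ supp (g L) `&` pendant b !=set0))); last first.
  apply: (thin_cycle hg M0 hf f0 fM sL).
    move=> w sw; apply: contrapT => wC; apply: none; exists (C (kappa w)), w; split; last by left.
    by split=> // e; apply: wC; exists (kappa w).
  move=> b gb [[w [xw bw]] yb]; apply: none; exists b, w; split=> //.
  by right.
move=> [b [w [bw hw]]].
have {}hw : 0 < g s w \/ (g s = vpoint R b /\ 0 < g 0 w) by case: hw => [|[? []]]; auto.
have bb : ~ pendant b b by case.
have nb2 : ~ ball2 b w b by case.
have [n5|n4] := leqP 5 n; last first.
  have bw2 : ball2 b w w by split=> //; left.
  have hub2 u : ball2 b w u -> adj G u b by case=> /pendant_hub.
  have [s1 [s2 [h1 h2 [e1 e e2] p1 p2]]] := cone_gates hg M0 hf f0 fM sL bw2 nb2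
    (fun u z => @ball2_closed b w u z n4 bw) hub2 hw.
  apply: (thin_of_gates hg h1 h2 p1 p2).
  have [n3'|n4'] : n = 3 \/ n = 4 by move: n3 n4; case: n => [|[|[|[|[|]]]]]//; [left|right].
    have P3 u : ball2 b w u -> u = w \/ adj G u w.
      move=> [bu [->|[uw|[w' bw' [uw' w'w]]]]]; [by left|by right|left].
      exact: (pendant3 n3' bu bw' bw).
    have uniq2 u u' : ball2 b w u -> ball2 b w u' -> u <> w -> u' <> w -> u = u'.
      move=> hu hu' uw u'w; have [//|auw] := P3 u hu; have [//|au'w] := P3 u' hu'.
      by case: hu hu' => bu _ [bu' _]; apply: (pendant3 n3' bu bw bu') => //; exact: adj_sym.
    apply: dle_weak (dle_triangle_diam e1 e2 _ _) _; last by rewrite n3'; lra.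
      move=> u v [hu|->] [hv|->]; last by left.
      - have [uw|uw] := pselect (u = w); have [vw|vw] := pselect (v = w).
        + by left; rewrite uw vw.
        + by have [//|h] := P3 v hv; right; rewrite uw; exact: adj_sym.
        + by have [//|h] := P3 u hu; right; rewrite vw.
        + by left; exact: uniq2.
      - by right; exact: hub2.
      - by right; apply: adj_sym; exact: hub2.
    (* Pigeonhole: the cone has at most three vertices, [b], [w] and one more, coded by 0, 1, 2, so
       two of any four coincide. *)
    pose col u : nat := if `[< u = b >] then 0 else if `[< u = w >] then 1 else 2.
    have col_inj u u' : ball2 b w u \/ u = b -> ball2 b w u' \/ u' = b ->
        col u = col u' -> u = u'.
      move=> hu hu'; rewrite /col.
      do ![case: asboolP => ?]; move=> // _; try congruence.
      by case: hu hu' => // hu [] // hu'; exact: uniq2.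
    have col3 u : (col u < 3)%N by rewrite /col; case: ifP => // _; case: ifP.
    move=> u v u' v' hu hv hu' hv'.
    have [e0|uv] := eqVneq (col u) (col v); first by constructor 1; exact: col_inj.
    have [e0|uv'] := eqVneq (col u') (col v'); first by constructor 2; exact: col_inj.
    have [e0|uu'] := eqVneq (col u) (col u'); first by constructor 3; exact: col_inj.
    constructor 4; have [e0|uv''] := eqVneq (col u) (col v'); first by left; exact: col_inj.
    right; have [e0|vu'] := eqVneq (col v) (col u'); first by left; exact: col_inj.
    right; apply: col_inj => //; have := col3 u; have := col3 v; have := col3 u'; have := col3 v'.
    by clear -uv uv' uu' uv'' vu'; lia.
  apply: dle_weak (dle_dominating_diam e1 e2 _) _; last by rewrite n4'; lra.
  move=> a d e' ha hd he de.
  case: ha => [ha|->]; last first.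
    by case: hd => [hd|->]; [left; right; apply: adj_sym; exact: hub2|left; left].
  case: hd de => [hd|->] de; last by left; right; exact: hub2.
  case: he de => [he|->] de; last by right; right; exact: hub2.
  exact: (ball2_dominating n4' bw ha hd he de).
have [s1 [s2 [h1 h2 [e1 e e2] p1 p2]]] := cone_gates hg M0 hf f0 fM sL bw bb
  (@pendant_closed b) (@pendant_hub b) hw.
have Bhub u : [set u | pendant b u \/ u = b] u -> nbhd1 G u b.
  by move=> [/pendant_hub|]; [right|left].
have [n6|n5'] := leqP 6 n.
  have n6' : 6 <= n%:R :> R by rewrite ler_nat.
  apply: (thin_of_gates hg h1 h2 p1 p2).
  by apply: dle_weak (dle_hub_diam e1 e2 Bhub) _; lra.
have {n5 n5'} en : n = 5 by apply/eqP; rewrite eqn_leq n5 -ltnS n5'.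
(* A gate within [5/4] of [g s] settles the claim; otherwise both are farther, as [fan_path]
   requires. *)
have [a1|a1] := leP (s - s1) (5 / 4).
  have [t1 t1M et] := p1; exists t1 => //; rewrite et en; apply: dleC.
  by apply: dle_weak (glip _ _ _ _ _) a1; lra.
have [a2|a2] := leP (s2 - s) (5 / 4).
  have [t2 t2M et] := p2; exists t2 => //; rewrite et en.
  by apply: dle_weak (glip _ _ _ _ _) a2; lra.
have [sd [sd1 sd2]] := pendant5 en b; rewrite en.
apply: (@fan_path R V G b (pendant b) sd (@pendant_hub b) (@pendant_closed b) sd1 sd2
  (g s1) (g s) (g s2) (s - s1) (s2 - s)) => //.
- by apply: glip; lra.
- by apply: glip; lra.
- move=> l h; have := gd _ _ _ _ _ h => /(_ ltac:(lra) ltac:(lra)).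
  by rewrite distrC ger0_norm; lra.
- move=> l h; have := gd _ _ _ _ _ h => /(_ ltac:(lra) ltac:(lra)).
  by rewrite distrC ger0_norm; lra.
- move=> l h; have := gd _ _ _ _ _ h => /(_ ltac:(lra) ltac:(lra)).
  by rewrite distrC ger0_norm; lra.
Qed.

Lemma delta_cactus : delta R G = (n%:R / 4)%:E.
Proof. by apply/le_anti; rewrite delta_le_cactus delta_ge_cactus. Qed.

End Cactus.

(** * Angles of arcs *)

Section Circle.
Import numFieldNormedType.Exports.
Context (R : realType).
Implicit Types (s t a b : R).

Definition turn : R := pi *+ 2.

Lemma turn_gt0 : 0 < turn.
Proof. by rewrite /turn mulr2n; have := pi_gt0 R; lra. Qed.

Lemma circle_pt_turn t (k : int) : circle_pt (t + k%:~R * turn) = circle_pt t.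
Proof.
have pos u (n : nat) : circle_pt (u + n%:R * turn) = circle_pt u.
  by rewrite /circle_pt mulr_natl (periodicn (@cosD2pi R)) (periodicn (@sinD2pi R)).
case: k => n; first by rewrite -pmulrn pos.
by rewrite NegzE mulrNz -pmulrn mulNr -[in RHS](subrK (n.+1%:R * turn) t) pos.
Qed.

Lemma shift_turn a t : exists k : int, a <= t + k%:~R * turn < a + turn.
Proof.
have T0 := turn_gt0; have := floor_itv ((t - a) / turn).
set m := Num.floor _; rewrite intrD; set c := m%:~R : R => h.
have e : (t - a) / turn * turn = t - a by rewrite mulfVK// gt_eqF.
exists (- m); rewrite mulrNz mulNr -/c.
move: h e; set q := (t - a) / turn => h e; nra.
Qed.

Lemma circle_pt_eq s t : circle_pt s = circle_pt t -> exists k : int, s = t + k%:~R * turn.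
Proof.
move=> [ec es]; have [k hk] := shift_turn 0 (s - t).
exists (- k); suff : s - t + k%:~R * turn = 0 by rewrite mulrNz mulNr => h; lra.
set r := s - t + _ in hk *; have cr : cos r = 1.
  have [-> _] : (cos r, sin r) = (cos (s - t), sin (s - t)) by exact: circle_pt_turn.
  by rewrite cosB ec es -!expr2 cos2Dsin2.
have e2 : turn = pi + pi by rewrite /turn mulr2n.
have pi0 := pi_gt0 R; have [rpi|rpi] := leP r pi.
  by apply: (@cos_inj R); rewrite ?in_itv /= ?cos0//; lra.
suff : turn - r = 0 by lra.
apply: (@cos_inj R); rewrite ?in_itv /= ?cos0; [lra|lra|].
by rewrite -cosN opprB -cr; have [] := circle_pt_turn r (-1); rewrite mulrNz mulr1z mulN1r.
Qed.

Lemma circle_pt_surj (p : R * R) : circle p -> exists t, circle_pt t = p.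
Proof.
case: p => x y; rewrite /circle /= => xy.
have x1 : -1 <= x <= 1 by have := sqr_ge0 y; nra.
have cx : cos (acos x) = x by rewrite acosK// in_itv.
have sx : sin (acos x) = `|y|.
  by rewrite sin_acos// -sqrtr_sqr; congr Num.sqrt; lra.
have [y0|y0] := leP 0 y.
  by exists (acos x); rewrite /circle_pt cx sx ger0_norm.
by exists (- acos x); rewrite /circle_pt cosN sinN cx sx ltr0_norm// opprK.
Qed.

Lemma circle_pt_circle t : circle (circle_pt t).
Proof. exact: cos2Dsin2. Qed.

Definition angles (A : set (R * R)) : set R := [set t | A (circle_pt t)].

Lemma angles_turn A t (k : int) : angles A (t + k%:~R * turn) <-> angles A t.
Proof. by rewrite /angles /= circle_pt_turn. Qed.

Definition is_arc (A : set (R * R)) : Prop := closed_arc A \/ open_arc A.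

Lemma is_arc_convex A : is_arc A ->
  exists X : set R, [/\ X !=set0, forall x y z, X x -> X z -> x <= y -> y <= z -> X y &
    A = @circle_pt R @` X].
Proof.
move=> [[a [b [ab ->]]]|[a [b [ab ->]]]].
- exists [set t | a <= t <= b]; split=> //=; first by exists a; rewrite /= lexx.
  by move=> x y z; lra.
- exists [set t | a < t < b]; split=> //=; first by exists ((a + b) / 2); rewrite /=; lra.
  by move=> x y z; lra.
Qed.

Lemma arc_circle A p : is_arc A -> A p -> exists t, circle_pt t = p.
Proof. by move=> /is_arc_convex[X [_ _ ->]] [t _ <-]; exists t. Qed.

Lemma arc_nonempty A : is_arc A -> angles A !=set0.
Proof. by move=> /is_arc_convex[X [[x Xx] _ ->]]; exists x, x. Qed.

Lemma anglesE A X : A = @circle_pt R @` X ->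
  angles A = [set t | exists k : int, X (t + k%:~R * turn)].
Proof.
move=> ->; apply/seteqP; split=> t.
  move=> [x Xx /circle_pt_eq[k e]]; exists k; by rewrite -e.
by move=> [k Xk]; exists (t + k%:~R * turn) => //; exact: circle_pt_turn.
Qed.

(** An arc is connected but may join two of its points either way round the circle. *)
Lemma angles_convex A s t : is_arc A -> angles A s -> angles A t -> s <= t <= s + turn ->
  (forall u, s <= u <= t -> angles A u) \/ (forall u, t <= u <= s + turn -> angles A u).
Proof.
have T0 := turn_gt0.
move=> /is_arc_convex[X [_ Xc /anglesE ->]] [k Xs] [m Xt] st.
have [km|mk] := leP k m.
  left=> u su; exists k; apply: Xc Xs Xt _ _; first lra.
  have : k%:~R <= m%:~R :> R by rewrite ler_int.
  by nra.
right=> u tu; exists m; apply: Xc Xt Xs _ _; first lra.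
have : (m + 1)%:~R <= k%:~R :> R by rewrite ler_int; lia.
by rewrite intrD; nra.
Qed.

Lemma open_arc_angles A : open_arc A -> open (angles A).
Proof.
move=> [a [b [ab /anglesE ->]]].
have -> : [set t | exists k : int, [set t0 | a < t0 < b] (t + k%:~R * turn)] =
    \bigcup_(k in [set: int]) ([set t | a - k%:~R * turn < t] `&` [set t | t < b - k%:~R * turn]).
  apply/seteqP; split=> t /=.
    by move=> [k h]; exists k => //; split; rewrite /=; lra.
  by move=> [k _ [/= h1 h2]]; exists k; lra.
by apply: bigcup_open => k _; apply: openI; [exact: open_gt|exact: open_lt].
Qed.

(** The gaps between the translates of a short arc are open; an arc of at least a full turn leaves
    none. *)
Lemma closed_arc_angles A : closed_arc A -> closed (angles A).
Proof.
have T0 := turn_gt0.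
move=> [a [b [ab /anglesE ->]]].
have [full|short] := leP turn (b - a).
  rewrite (_ : [set t | _] = setT); first exact: closedT.
  by apply/seteqP; split=> // t _; have [k hk] := shift_turn a t; exists k; rewrite /=; lra.
rewrite -openC (_ : ~` _ =
    \bigcup_(k in [set: int]) ([set t | b - k%:~R * turn < t] `&`
       [set t | t < a + turn - k%:~R * turn])).
  by apply: bigcup_open => k _; apply: openI; [exact: open_gt|exact: open_lt].
apply/seteqP; split=> t /=.
  move=> h; have [k hk] := shift_turn a t; exists k => //; split; rewrite /=; last lra.
  by rewrite ltNge; apply/negP => hb; apply: h; exists k; lra.
move=> [k _ [/= h1 h2]] [m hm].
have [mk|km] := leP m k.
  have : m%:~R <= k%:~R :> R by rewrite ler_int.
  case: (eqVneq m k) => [mk'|mk']; first by subst m; lra.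
  have : (m + 1)%:~R <= k%:~R :> R by rewrite ler_int; lia.
  by rewrite intrD; nra.
have : (k + 1)%:~R <= m%:~R :> R by rewrite ler_int; lia.
by rewrite intrD; nra.
Qed.

(** A segment is connected, so two sets of the same kind, open or closed, that cover it and both
    occur in it overlap. This is where the uniform kind of the arcs enters. *)
Lemma segment_meets (X Y : set R) s t : (open X /\ open Y) \/ (closed X /\ closed Y) ->
    s <= t -> X s -> Y t -> (forall u, s <= u <= t -> X u \/ Y u) ->
  exists2 u, s <= u <= t & X u /\ Y u.
Proof.
move=> XY st Xs Yt cov; apply: contrapT => no.
have XnY u : s <= u <= t -> X u -> ~ Y u by move=> su Xu Yu; apply: no; exists u.
have XE : [set` `[s, t]] `&` X = [set` `[s, t]] `&` ~` Y.
  apply/seteqP; split=> u /= [us h]; split=> //; move: us; rewrite in_itv /= => us.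
    exact: XnY.
  by have [] := cov u us.
have sin : [set` `[s, t]] s by rewrite /= in_itv /= lexx.
have full : [set` `[s, t]] `&` X = [set` `[s, t]].
  apply: (@segment_connected R s t).
  - by exists s; split.
  - by case: XY => -[hX hY]; [exists X|exists (~` Y); rewrite ?openC ?XE].
  - by case: XY => -[hX hY]; [exists (~` Y); rewrite ?closedC ?XE|exists X].
have tin : [set` `[s, t]] t by rewrite /= in_itv /= st lexx.
by move: (tin); rewrite -full => -[_ Xt]; apply: (XnY t) => //; rewrite st lexx.
Qed.

End Circle.

(** * Cyclic order of a minimal cover *)

Section CyclicOrder.
Context (R : realType) (V : Type) (T : R) (A : V -> set R).
Hypothesis T_gt0 : 0 < T.
Hypothesis A_per : forall v t, A v (t + T) <-> A v t.
Hypothesis A_conv : forall v s t, A v s -> A v t -> s <= t <= s + T ->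
  (forall u, s <= u <= t -> A v u) \/ (forall u, t <= u <= s + T -> A v u).
Hypothesis A_meet : forall u v s t, s <= t -> A u s -> A v t ->
  (forall r, s <= r <= t -> A u r \/ A v r) -> exists2 r, s <= r <= t & A u r /\ A v r.
Variables (n : nat) (v : 'I_n -> V).
Hypothesis n2 : (2 <= n)%N.
Hypothesis v_cover : forall t, exists i, A (v i) t.
Hypothesis v_min : forall m (u : 'I_m -> V), (forall t, exists i, A (u i) t) -> (n <= m)%N.

Lemma A_per_nat w t k : A w (t + k%:R * T) <-> A w t.
Proof.
elim: k => [|k IH]; first by rewrite mul0r addr0.
by rewrite -natr1 mulrDl mul1r addrA; split=> [/A_per/IH|/IH/A_per].
Qed.

Lemma window_turn a t : exists t', [/\ a <= t', t' < a + T & forall w, A w t' <-> A w t].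
Proof.
have T0 := T_gt0.
have per_int w s (k : int) : A w (s + k%:~R * T) <-> A w s.
  case: k => k; first by rewrite -pmulrn; exact: A_per_nat.
  by rewrite NegzE mulrNz -pmulrn mulNr -{2}(subrK (k.+1%:R * T) s); split=> /A_per_nat.
have := floor_itv ((t - a) / T); set m := Num.floor _; rewrite intrD; set c := m%:~R : R => h.
have e : (t - a) / T * T = t - a by rewrite mulfVK// gt_eqF.
exists (t + (- m)%:~R * T); rewrite mulrNz mulNr -/c.
move: h e; set q := (t - a) / T => h e; split; [nra|nra|move=> w].
by have := per_int w t (- m); rewrite mulrNz mulNr.
Qed.

(** Otherwise the [n - 1] other arcs would still cover. *)
Lemma private_point i : exists t, [/\ 0 <= t, t < T, A (v i) t & forall j, A (v j) t -> j = i].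
Proof.
apply: contrapT => none.
case: n v v_cover v_min i none => [v' _ _ [] //|n' v' cov min i none].
have := min n' (fun j => v' (lift i j)); rewrite ltnn => h.
have // : false; apply: h => t; apply: contrapT => nt; apply: none.
have [t' [t0 tT At]] := window_turn 0 t; exists t'; rewrite add0r in tT; split=> //.
  have [j hj] := cov t; case: (unliftP i j) => [ji ij|<-]; last exact/At.
  by exfalso; apply: nt; exists ji; rewrite -ij.
move=> j /At hj; case: (unliftP i j) => [ji ij|//].
by exfalso; apply: nt; exists ji; rewrite -ij.
Qed.

(** The private angles in one turn are sorted and continued periodically. Indexing by [nat] turns
    cyclic neighbours into successors. *)
Lemma cyclic_order : exists (C : nat -> V) (th : nat -> R),
  [/\ (forall k, C (k + n)%N = C k) /\ (forall k, th (k + n)%N = th k + T),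
      forall k, th k < th k.+1,
      forall j k, A (C j) (th k) <-> j = k %[mod n],
      forall i, exists k, v i = C k &
      forall k, exists i, C k = v i].
Proof.
have n0 : (0 < n)%N by apply: leq_trans n2.
have [th0 th0P] := choice private_point.
have th0_inj : injective th0.
  by move=> i j e; have [_ _ Ai hi] := th0P i; have [_ _ _ hj] := th0P j; apply: hj; rewrite -e.
pose i0 := Ordinal n0; pose le i j := th0 i <= th0 j.
pose s := sort le (enum 'I_n).
have size_s : size s = n by rewrite size_sort size_enum_ord.
have uniq_s : uniq s by rewrite sort_uniq enum_uniq.
have sorted_s : sorted le s by apply: sort_sorted => i j; exact: le_total.
have le_tr : transitive le by move=> i j k; exact: le_trans.
pose ps k := nth i0 s (k %% n).
have ps_lt j k : (j %% n < k %% n)%N -> th0 (ps j) < th0 (ps k).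
  move=> jk; rewrite lt_neqAle; apply/andP; split.
    apply/eqP => /th0_inj/eqP; rewrite nth_uniq ?size_s ?ltn_mod//.
    by move=> /eqP e; rewrite e ltnn in jk.
  by apply: (sorted_ltn_nth le_tr i0 sorted_s); rewrite ?inE ?size_s ?ltn_mod.
have ps_mod j k : j = k %[mod n] -> ps j = ps k by rewrite /ps => ->.
have ps_inj j k : ps j = ps k -> j = k %[mod n].
  by move=> /eqP; rewrite nth_uniq ?size_s ?ltn_mod// => /eqP.
exists (fun k => v (ps k)), (fun k => th0 (ps k) + (k %/ n)%:R * T); split.
- split=> k; first by rewrite /ps modnDr.
  by rewrite (ps_mod (k + n)%N k) ?modnDr// divnDr// divnn n0 natrD mulrDl mul1r addrA.
- move=> k; have T0 := T_gt0.
  (* Within a turn the sorting decides; after the last index the next angle belongs to the following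
     turn. *)
  have [kn|kn] := ltnP (k %% n).+1 n.
    have e : (k.+1 %% n = (k %% n).+1)%N by rewrite -addn1 -modnDml addn1 modn_small.
    have d : (k.+1 %/ n = k %/ n)%N.
      by rewrite {1}(divn_eq k n) -addnS divnMDl// (divn_small kn) addn0.
    by rewrite d ltrD2r; apply: ps_lt; rewrite e.
  have kn' : ((k %% n).+1 = n)%N by apply/eqP; rewrite eqn_leq kn ltn_mod n0.
  have d : (k.+1 %/ n = (k %/ n).+1)%N.
    by rewrite {1}(divn_eq k n) -addnS kn' divnMDl// divnn n0 addn1.
  rewrite d -natr1.
  have [h1 h2 _ _] := th0P (ps k); have [h3 h4 _ _] := th0P (ps k.+1).
  by rewrite mulrDl; lra.
- move=> j k; split=> [/A_per_nat h|jk].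
    by apply: ps_inj; have [_ _ _ /(_ _ h)] := th0P (ps k).
  by apply/A_per_nat; rewrite (ps_mod _ _ jk); have [] := th0P (ps k).
- move=> i; exists (index i s); rewrite /ps modn_small ?nth_index ?mem_sort ?mem_enum//.
  by rewrite -[ltnRHS]size_s index_mem mem_sort mem_enum.
- by move=> k; exists (ps k).
Qed.

Variables (C : nat -> V) (th : nat -> R).
Hypothesis C_per : forall k, C (k + n) = C k.
Hypothesis th_per : forall k, th (k + n) = th k + T.
Hypothesis th_lt : forall k, th k < th k.+1.
Hypothesis C_th : forall j k, A (C j) (th k) <-> j = k %[mod n].
Hypothesis C_v : forall i, exists k, v i = C k.

Lemma th_mono j k : (j < k)%N -> th j < th k.
Proof.
elim: k => // k IH; rewrite ltnS leq_eqVlt => /orP[/eqP->|/IH h]; first exact: th_lt.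
exact: lt_trans h (th_lt k).
Qed.

Lemma th_le j k : (j <= k)%N -> th j <= th k.
Proof. by rewrite leq_eqVlt => /orP[/eqP->|/th_mono/ltW]. Qed.

Lemma C_cover t : exists k, A (C k) t.
Proof. by have [i Ai] := v_cover t; have [k e] := C_v i; exists k; rewrite -e. Qed.

Lemma C_mod j k : j = k %[mod n] -> C j = C k.
Proof.
have CM m i : C (i + m * n) = C i.
  by elim: m => [|m IH]; [rewrite mul0n addn0|rewrite mulSn [(n + _)%N]addnC addnA C_per].
by move=> e; rewrite (divn_eq j n) (divn_eq k n) e ![(_ * n + _)%N]addnC !CM.
Qed.

Lemma C_inj j k : C j = C k -> j = k %[mod n].
Proof. by move=> e; apply/C_th; rewrite e; apply/C_th. Qed.

Lemma mod_window j k : exists m, [/\ (k <= m)%N, (m < k + n)%N & m = j %[mod n]].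
Proof.
have n0 : (0 < n)%N by apply: leq_trans n2.
exists (k + (j + k * n.-1) %% n)%N; split; first exact: leq_addr.
  by rewrite ltn_add2l ltn_mod.
rewrite modnDmr addnCA -mulnS prednK// -modnDmr modnMl addn0//.
Qed.

Lemma window_neq j m : (j < m)%N -> (m < j + n)%N -> j <> m %[mod n].
Proof.
move=> jm mj /eqP; rewrite eq_sym eqn_mod_dvd ?(ltnW jm)// => /dvdn_leq.
by rewrite subn_gt0 => /(_ jm); rewrite leqNgt ltn_subLR ?mj// ltnW.
Qed.

(** A further arc [C m] over [r] would contain a segment joining [r] to its own private angle [th m]
    one way round, hence the private angle [th k.+1] or [th (k + n)] of another arc. *)
Lemma cover_seg k r : th k <= r <= th k.+1 -> A (C k) r \/ A (C k.+1) r.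
Proof.
move=> kr; have [j Aj] := C_cover r; have [m [km mk mj]] := mod_window j k.
rewrite -(C_mod mj) in Aj.
have [<-|mk0] := eqVneq m k; first by left.
have [<-|mk1] := eqVneq m k.+1; first by right.
have km1 : (k.+1 < m)%N by rewrite ltn_neqAle eq_sym mk1 ltn_neqAle eq_sym mk0.
have h1 := th_lt k; have h2 := th_mono km1; have h3 := th_mono mk.
rewrite th_per in h3; have Am : A (C m) (th m) by apply/C_th.
exfalso; have [|h|h] := A_conv Aj Am; first lra.
  have /C_th/esym := h (th k.+1) ltac:(lra).
  by apply: window_neq => //; rewrite addSn ltnS ltnW.
have /C_th := h (th (k + n)) ltac:(rewrite th_per; lra).
rewrite modnDr => /esym; apply: window_neq => //; exact: ltnW.
Qed.

Lemma C_next k : exists2 t, th k <= t <= th k.+1 & A (C k) t /\ A (C k.+1) t.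
Proof.
apply: A_meet; [exact: ltW|by apply/C_th|by apply/C_th|exact: cover_seg].
Qed.

(** Beyond a neighbouring private angle, the arc would contain that angle or, going round, the one
    on the other side. The index [k.+1] leaves room for the left neighbour. *)
Lemma C_window k t : A (C k.+1) t -> th k <= t <= th (k + n) -> th k < t < th k.+2.
Proof.
move=> At kt; have h1 := th_lt k; have h2 := th_lt k.+1.
have A1 : A (C k.+1) (th k.+1) by apply/C_th.
have n1 : (k.+1 < k + n)%N by rewrite -addn1 ltn_add2l.
have nk : ~ A (C k.+1) (th k).
  by move=> /C_th/esym; apply: window_neq.
have kt0 : th k < t.
  rewrite lt_neqAle; apply/andP; split; last lra.
  by apply/eqP => e; apply: nk; rewrite e.
rewrite kt0 /=; rewrite ltNge; apply/negP => t2.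
rewrite th_per in kt.
have [|h|h] := A_conv A1 At; first lra.
  have /C_th := h (th k.+2) ltac:(lra).
  by apply: window_neq; rewrite // -addn1 ltn_add2l.
apply: nk; apply/A_per; apply: h; lra.
Qed.

Lemma C_meet_consecutive j k t : (j < k)%N -> (k < j + n)%N -> A (C j) t -> A (C k) t ->
  k = j.+1 \/ k.+1 = (j + n)%N.
Proof.
move=> jk kj Aj Ak; apply: contrapT => /not_orP[k1 k2].
have n0 : (0 < n)%N by apply: leq_trans n2.
(* [j0] and [k0] are the predecessors of [j] and [k] modulo [n], one turn later so that they exist
   for index 0. The windows around [j] and [k] are then seen to be disjoint. *)
set j0 := (j + n).-1; have j0E : j0.+1 = (j + n)%N by rewrite /j0 prednK// addn_gt0 n0 orbT.
have [t' [t1 t2 At]] := window_turn (th j0) t.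
have Aj' : A (C j0.+1) t' by apply/At; rewrite j0E C_per.
have w1 : th j0 < t' < th j0.+2 by apply: C_window => //; rewrite th_per; lra.
set k0 := (k + n).-1; have k0E : k0.+1 = (k + n)%N by rewrite /k0 prednK// addn_gt0 n0 orbT.
have jk2 : (j0.+2 <= k0)%N by
    rewrite -ltnS j0E k0E -addSn ltn_add2r ltn_neqAle jk andbT eq_sym; apply/eqP.
have kj2 : (k0.+2 <= j0 + n)%N.
  rewrite -ltnS -addSn j0E k0E -addSn ltn_add2r ltn_neqAle kj andbT; exact/eqP.
have h1 := th_le jk2; have h2 := th_le kj2; rewrite th_per in h2.
have Ak' : A (C k0.+1) (t' + T) by apply/A_per/At; rewrite k0E C_per.
have := th_lt k0; have := th_lt k0.+1 => h3 h4.
have := C_window Ak'; rewrite th_per => /(_ ltac:(lra)); lra.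
Qed.

End CyclicOrder.

(** * Circular-arc graphs *)

Local Notation meets := Defs.meets.

Section ArcGraph.
Context (R : realType) (V : Type) (I : V -> set (R * R)).
Hypothesis hI : arc_family I.
Implicit Types (u w : V).

Let ang w : set R := angles (I w).

Lemma arc_of w : is_arc (I w).
Proof. by case: hI => h; [left|right]. Qed.

Lemma meetsP u w : meets (I u) (I w) <-> exists t, ang u t /\ ang w t.
Proof.
split=> [[p [up wp]]|[t [ut wt]]]; last by exists (circle_pt t).
by have [t e] := arc_circle (arc_of u) up; exists t; rewrite /ang /angles /= e.
Qed.

Lemma meets_refl w : meets (I w) (I w).
Proof. by apply/meetsP; have [t wt] := arc_nonempty (arc_of w); exists t. Qed.

Lemma cover_angles m (v : 'I_m -> V) :
  \bigcup_(i in setT) I (v i) = circle (R := R) <-> forall t, exists i, ang (v i) t.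
Proof.
split=> [e t|h].
  have : circle (circle_pt t) by exact: circle_pt_circle.
  by rewrite -e => -[i _ it]; exists i.
apply/seteqP; split=> p.
  move=> [i _ ip]; have [t <-] := arc_circle (arc_of _) ip; exact: circle_pt_circle.
by move=> /circle_pt_surj[t <-]; have [i it] := h t; exists i.
Qed.

Lemma rho_le_cover m (v : 'I_m -> V) : (forall t, exists i, ang (v i) t) ->
  (rho I <= m%:R%:E)%E.
Proof.
move=> cov; case: m v cov => [v cov|m v cov]; first by have [[]] := cov 0.
pose A := (fun k : nat => v (inord k)) @` `I_m.+1.
have AE : A = range v.
  apply/seteqP; split=> w; first by move=> [k _ <-]; exists (inord k).
  by move=> [i _ <-]; exists i; [exact: ltn_ord|rewrite inord_val].
have fA : finite_set A by apply: finite_image; exact: finite_II.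
have [k Ak] := (finite_setP A).1 fA.
have km : (k <= m.+1)%N.
  by rewrite -card_le_II -(card_le_eql Ak); exact: card_image_le.
apply: (@le_trans _ _ (k%:R%:E)); last by rewrite lee_fin ler_nat.
apply: ereal_inf_lbound; exists k => //; exists A; split=> //; split=> //.
by rewrite AE bigcup_image; apply/cover_angles.
Qed.

Lemma rho_attained : (rho I < +oo)%E -> exists n (v : 'I_n -> V),
  [/\ rho I = n%:R%:E, injective v & forall t, exists i, ang (v i) t].
Proof.
set S := [set n : nat | exists A : set V, total_set I A /\ (A #= `I_n)%card].
move=> hfin.
have [n0 Sn0] : S !=set0.
  apply/set0P/eqP => S0; move: hfin; rewrite /rho -/S S0 image_set0 ereal_inf0.
  by rewrite ltxx.
have ex : exists n, `[< S n >] by exists n0; apply/asboolP.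
have [n /asboolP[A [[fA covA] An]] nmin] := ex_minnP ex.
have rhoE : rho I = n%:R%:E.
  apply/le_anti/andP; split.
    by apply: ereal_inf_lbound; exists n => //; exists A.
  apply: le_ereal_inf_tmp => _ [m Sm <-]; rewrite lee_fin ler_nat.
  by apply: nmin; apply/asboolP.
have [f [g fg gf]] := card_bijP (card_esym An).
pose idx (i : 'I_n) : set_type `I_n := exist _ (val i) (mem_set (ltn_ord i)).
exists n, (fun i => set_val (f (idx i))); split=> //.
  move=> i j e; have := can_inj fg (val_inj e) => /(congr1 set_val) /= e'.
  exact: val_inj.
move=> t; have : circle (circle_pt t) by exact: circle_pt_circle.
rewrite -covA => -[w Aw wt].
pose y := g (exist _ w (mem_set Aw)).
have yn : (set_val y < n)%N by have := set_mem (valP y).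
exists (Ordinal yn); rewrite (_ : idx _ = y) ?gf//.
exact: val_inj.
Qed.

Lemma ang_per w t : ang w (t + turn R) <-> ang w t.
Proof. by have := angles_turn (I w) t 1; rewrite mulr1z mul1r. Qed.

Lemma ang_conv w s t : ang w s -> ang w t -> s <= t <= s + turn R ->
  (forall r, s <= r <= t -> ang w r) \/ (forall r, t <= r <= s + turn R -> ang w r).
Proof. exact: angles_convex (arc_of w). Qed.

Lemma ang_meet u w s t : s <= t -> ang u s -> ang w t ->
  (forall r, s <= r <= t -> ang u r \/ ang w r) ->
  exists2 r, s <= r <= t & ang u r /\ ang w r.
Proof.
apply: segment_meets.
by case: hI => h; [right|left]; split; [exact: closed_arc_angles|exact: closed_arc_angles|
  exact: open_arc_angles|exact: open_arc_angles].
Qed.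

(** A failure yields a point common to [x], [y], [z] and one common to [x], [y], [w], so that [z],
    [x], [w], [y] is a cycle of length 4. *)
Lemma quadfree_inter b : ~ (1%:E <= delta R (igraph I))%E ->
  inter0_property (@nbr_arcs R V I b) \/ inter34_property (@nbr_arcs R V I b).
Proof.
move=> noquad; have [h|h] := pselect (inter0_property (@nbr_arcs R V I b)); first by left.
right; split=> // x y z w xy xz xw yz yw zw; apply: contrapT => /not_orP[].
move=> /eqP/set0P[p [[xp yp] zp]] /eqP/set0P[q [[xq yq] wq]]; apply: noquad.
have neq (c d : {u : V | meets (I u) (I b)}) : c <> d -> sval c <> sval d.
  by move=> cd e; apply: cd; apply: eq_sig_hprop e => u ? ?; exact: Prop_irrelevance.
apply: (@delta_ge_quad R V (igraph I) (sval z) (sval x) (sval w) (sval y)).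
- by split; [exact/nesym/neq|exists p].
- by split; [exact/neq|exists q].
- by split; [exact/nesym/neq|exists q].
- by split; [exact/neq|exists p].
- exact/neq.
- exact/neq.
Qed.

Lemma pentfree_inter1 b : ~ ((5 / 4)%:E <= delta R (igraph I))%E ->
  forall n (c : 'I_n -> {u : V | meets (I u) (I b)}),
    is_cycle (igraph (@nbr_arcs R V I b)) c -> forall i j k : 'I_n, j <> k ->
    meets (@nbr_arcs R V I b (c j)) (@nbr_arcs R V I b (c k)) ->
    meets (@nbr_arcs R V I b (c i)) (@nbr_arcs R V I b (c j) `|` @nbr_arcs R V I b (c k)).
Proof.
move=> nopent n c [n3 cinj cadj] i j k jk mjk; apply: contrapT => nm.
have n0 : (0 < n)%N by apply: leq_trans n3.
pose x l := sval (c l).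
have x_inj l m : x l = x m -> l = m.
  move=> e; apply: cinj; apply: eq_sig_hprop e => u ? ?; exact: Prop_irrelevance.
(* [P] spreads from [c i] along the cycle in both directions until [b] is met; since [b]
   is met on one side at most, it reaches [c j]. *)
pose P y := [/\ y <> b, ~ meets (I y) (I (x j)) & ~ meets (I y) (I (x k))].
have hub l : meets (I (x l)) (I b) := svalP (c l).
have Pi : P (x i).
  split.
  - by move=> e; apply: nm; have [p [pj pb]] := hub j;
      exists p; split; [rewrite /nbr_arcs -/(x i) e|left].
  - by move=> [p [pi pj]]; apply: nm; exists p; split=> //; left.
  - by move=> [p [pi pk]]; apply: nm; exists p; split=> //; right.
have step l m : P (x l) -> adj (igraph I) (x l) (x m) -> x m <> b -> P (x m).
  move=> [lb lj lk] alm mb; apply: contrapT => nP.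
  have xjk : x j <> x k by move=> /x_inj.
  (* If [x m] met [a], the cycle [x l], [x m], [a], [a'], [b] would be a pentagon whose vertex [x l]
     misses both ends of the opposite edge [a a']. *)
  have one a a' : a <> a' -> meets (I a) (I a') -> meets (I a) (I b) -> meets (I a') (I b) ->
      ~ meets (I (x l)) (I a) -> ~ meets (I (x l)) (I a') -> ~ meets (I (x m)) (I a).
    move=> aa' maa' ab a'b la la' ma; apply: nopent.
    have xla z : ~ meets (I (x l)) (I z) -> x l <> z.
      by move=> h e; apply: h; rewrite e; exact: meets_refl.
    have xma : x m <> a by move=> e; apply: la; rewrite -e; case: alm.
    have xma' : x m <> a' by move=> e; apply: la'; rewrite -e; case: alm.
    have an : a <> b by move=> e; apply: la; rewrite e; exact: hub.
    have a'n : a' <> b by move=> e; apply: la'; rewrite e; exact: hub.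
    apply: (@delta_ge_pent R V (igraph I) (x l) (x m) a a' b) => //.
    - by split; [move=> e; apply: lb|exact: Defs.meetsC (hub l)].
    - exact: xla.
    - exact: xla.
    - by move=> [_].
    - by move=> [_].
  apply: nP; split=> //; first exact: (one _ (x k)).
  by apply: (one _ (x j)) => //; [exact: nesym|exact: Defs.meetsC].
pose y e := x (Ordinal (ltn_pmod (i + e) n0)).
have y0 : y 0 = x i.
  by rewrite /y; congr x; apply: val_inj; rewrite /= addn0 modn_small.
have yn : y n = x i.
  by rewrite /y; congr x; apply: val_inj; rewrite /= modnDr modn_small.
have yadj e : adj (igraph I) (y e) (y e.+1).
  have [h1 h2] := cadj (Ordinal (ltn_pmod (i + e) n0)).
  have -> : y e.+1 = x (ordS (Ordinal (ltn_pmod (i + e) n0))).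
    by rewrite /y; congr x; apply: val_inj; rewrite /= addnS -addn1 -[in RHS]addn1 modnDml.
  split=> // e'; apply: h1; congr c; exact: x_inj.
have y_inj e e' : (e < n)%N -> (e' < n)%N -> y e = y e' -> e = e'.
  move=> en en' /x_inj/(congr1 val) /= /eqP; rewrite eqn_modDl => /eqP.
  by rewrite !modn_small.
have fwd d : (forall e, (e <= d)%N -> y e <> b) -> P (y d).
  elim: d => [|d IH] h; first by rewrite y0.
  apply: (step _ _ _ (yadj d)); last exact: h.
  by apply: IH => e ed; apply: h; exact: leqW.
have bwd d : (d <= n)%N -> (forall e, (d <= e)%N -> (e <= n)%N -> y e <> b) -> P (y d).
  move=> dn; rewrite -(subKn dn); elim: (n - d)%N (leq_subr d n) => [|f IH] fn h.
    by rewrite subn0 yn.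
  have e : (n - f = (n - f.+1).+1)%N by rewrite subnSK.
  apply: (step _ _ _ (adj_sym (yadj (n - f.+1)%N))); last by apply: h => //; exact: leq_subr.
  rewrite -e; apply: IH; first exact: ltnW.
  by move=> e' h1 h2; apply: h => //; apply: leq_trans h1; rewrite e.
have [d [dn yd]] : exists d, (d < n)%N /\ y d = x j.
  exists ((j + (n - i)) %% n)%N; rewrite ltn_mod n0; split=> //.
  rewrite /y; congr x; apply: val_inj => /=.
  by rewrite modnDmr addnCA subnKC ?modnDr ?modn_small// ltnW.
have jb : x j <> b by move=> e; have [_ h _] := Pi; apply: h; rewrite e.
have [_ h _] : P (y d); last by apply: h; rewrite yd; exact: meets_refl.
have [[e [ed ye]]|none] := pselect (exists e, (e <= d)%N /\ y e = b); last first.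
  by apply: fwd => e ed ye; apply: none; exists e.
apply: bwd; first exact: ltnW.
move=> e' de' en' ye'; have [e'n|] := ltnP e' n; last first.
  move=> ne'; have e'E : e' = n by apply/eqP; rewrite eqn_leq en'.
  by rewrite e'E yn in ye'; case: Pi.
have ee : e = e' by apply: y_inj => //; [exact: leq_ltn_trans dn|rewrite ye].
by apply: jb; rewrite -yd -ye; congr y; apply/eqP; rewrite eqn_leq ed ee de'.
Qed.

(** * The cycle formed by a minimal cover *)

Section Frame.
Variables (n : nat) (v : 'I_n -> V) (C : nat -> V) (th : nat -> R).
Hypothesis n3 : (3 <= n)%N.
Hypothesis rhoE : rho I = n%:R%:E.
Hypothesis v_cover : forall t, exists i, ang (v i) t.
Hypothesis C_per : forall k, C (k + n) = C k.
Hypothesis th_per : forall k, th (k + n) = th k + turn R.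
Hypothesis th_lt : forall k, th k < th k.+1.
Hypothesis C_th : forall j k, ang (C j) (th k) <-> j = k %[mod n].
Hypothesis v_C : forall i, exists k, v i = C k.
Hypothesis C_v : forall k, exists i, C k = v i.

Let n2 : (2 <= n)%N. Proof. exact: ltnW. Qed.
Let n0 : (0 < n)%N. Proof. exact: ltnW. Qed.

Let Cmod := C_mod C_per.
Let Cinj := C_inj C_th.
Let Ccover := C_cover v_cover v_C.

Lemma frame_adj k : adj (igraph I) (C k) (C k.+1).
Proof.
split.
  move=> /Cinj; apply: (window_neq (n := n)) => //.
  by rewrite -addn1 ltn_add2l.
have [t _ ht] := C_next ang_conv ang_meet n2 v_cover C_per th_per th_lt C_th v_C k.
by apply/meetsP; exists t.
Qed.

Lemma frame_consecutive j k : (j < k)%N -> (k < j + n)%N -> meets (I (C j)) (I (C k)) ->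
  k = j.+1 \/ k.+1 = (j + n)%N.
Proof.
move=> jk kj /meetsP[t [jt kt]].
exact: (C_meet_consecutive (turn_gt0 R) ang_per ang_conv n2 C_per th_per th_lt C_th jk kj jt kt).
Qed.

Lemma frame_window w k : meets (I w) (I (C k.+1)) ->
  exists t, [/\ th k < t, t < th k.+2, ang w t & ang (C k.+1) t].
Proof.
move=> /meetsP[t [wt kt]].
have [t' [t1 t2 ht]] := window_turn (turn_gt0 R) ang_per (th k) t.
have kt' : ang (C k.+1) t' by apply/ht.
have h : th k <= t' <= th (k + n) by rewrite th_per; lra.
have /andP[h1 h2] := C_window ang_per ang_conv n2 th_per th_lt C_th kt' h.
by exists t'; split=> //; apply/ht.
Qed.

(** * Arcs attached to a single hub *)

Section Pendants.
Hypothesis one_hub : forall w, (forall i, w <> v i) -> exists! i, meets (I w) (I (v i)).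

Lemma hub_index w : exists k, (k < n)%N /\
  (C k = w \/ ((forall j, C j <> w) /\ meets (I w) (I (C k)))).
Proof.
have [[j e]|nC] := pselect (exists j, C j = w).
  by exists (j %% n)%N; rewrite ltn_mod; split=> //;
    left; rewrite -e; apply: Cmod; rewrite modn_mod.
have wv i : w <> v i by have [k e] := v_C i; move=> h; apply: nC; exists k; rewrite -e.
have [i [wi _]] := one_hub wv; have [k e] := v_C i.
exists (k %% n)%N; rewrite ltn_mod; split=> //; right; split;
  first by move=> j e'; apply: nC; exists j.
by rewrite (@Cmod (k %% n)%N k) ?modn_mod// -e.
Qed.

Lemma one_hub_mod w j k : (forall i, C i <> w) -> meets (I w) (I (C j)) -> meets (I w) (I (C k)) ->
  j = k %[mod n].
Proof.
move=> wC wj wk; have [i ei] := C_v j; have [l el] := C_v k.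
have wv i' : w <> v i' by have [m e] := v_C i'; rewrite e => h; apply: (wC m).
have [i0 [_ h]] := one_hub wv; rewrite ei in wj; rewrite el in wk.
by apply: Cinj; rewrite ei el -(h _ wj) (h _ wk).
Qed.

Section Kappa.
Variable kappa : V -> nat.
Hypothesis kappaP : forall w, (kappa w < n)%N /\
  (C (kappa w) = w \/ ((forall j, C j <> w) /\ meets (I w) (I (C (kappa w))))).

Lemma kappa_C k : kappa (C k) = (k %% n)%N.
Proof.
have [kn [/Cinj e|[/(_ k)//]]] := kappaP (C k).
by rewrite -e modn_small.
Qed.

Lemma kappa_out w k : (forall j, C j <> w) -> meets (I w) (I (C k)) -> kappa w = (k %% n)%N.
Proof.
move=> wC wk; have [kn [/wC//|[_ h]]] := kappaP w.
by rewrite -(one_hub_mod wC h wk) modn_small.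
Qed.

Lemma kappa_adj u w : adj (igraph I) u w -> kappa u = kappa w \/
  exists k, (u = C k /\ w = C k.+1) \/ (w = C k /\ u = C k.+1).
Proof.
have consec j k : (j < n)%N -> (k < n)%N -> (j < k)%N -> meets (I (C j)) (I (C k)) ->
    exists m, (C j = C m /\ C k = C m.+1) \/ (C k = C m /\ C j = C m.+1).
  move=> jn kn jk /(frame_consecutive jk)[|->|e]; first by rewrite ltn_addl.
    by exists j; left.
  by exists k; right; rewrite e C_per.
move=> [uw muw].
have [[j ej]|uC] := pselect (exists j, C j = u); have [[k ek]|wC] := pselect (exists k, C k = w).
- subst u w; have jm : C j = C (j %% n) by apply: Cmod; rewrite modn_mod.
  have km : C k = C (k %% n) by apply: Cmod; rewrite modn_mod.
  right; rewrite jm km in uw muw *.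
  have jn := ltn_mod j n; have kn := ltn_mod k n; rewrite n0 in jn kn.
  have [jk|kj|e] := ltngtP (j %% n) (k %% n); last by case: uw; rewrite e.
    exact: consec.
  have [m [[e1 e2]|[e1 e2]]] := consec _ _ kn jn kj (Defs.meetsC muw);
    exists m; [right|left]; split=> //.
- left; subst u; rewrite kappa_C (kappa_out (k := j))//; last exact: Defs.meetsC.
  by move=> i e; apply: wC; exists i.
- left; subst w; rewrite kappa_C (kappa_out (k := k))//.
  by move=> i e; apply: uC; exists i.
(* A common angle of two arcs off the cycle is covered by some [C k], which is then the hub of
   both. *)
- left; have [t [ut wt]] := (meetsP _ _).1 muw; have [k kt] := Ccover t.
  rewrite (kappa_out (k := k) (w := u)); last 2 first.
  + by move=> i e; apply: uC; exists i.
  + by apply/meetsP; exists t.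
  rewrite (kappa_out (k := k) (w := w))//; last by apply/meetsP; exists t.
  by move=> i e; apply: wC; exists i.
Qed.

Lemma kappa_hub w : w <> C (kappa w) -> adj (igraph I) w (C (kappa w)).
Proof. by move=> h; split=> //; have [_ [e|[_ //]]] := kappaP w; case: h. Qed.

Lemma pendant_out b w : pendant C kappa b w -> forall j, C j <> w.
Proof.
move=> [wb wnb] j e; apply: wnb; rewrite -wb -e kappa_C; apply: Cmod.
by rewrite modn_mod.
Qed.

(** Each angle of [w] is covered by an arc of the cycle, which meets [w] and so is its hub. *)
Lemma pendant_sub b w t : pendant C kappa b w -> ang w t -> ang b t.
Proof.
move=> bw wt; have wC := pendant_out bw; case: bw => <- _.
have [k kt] := Ccover t.
have e : kappa w = (k %% n)%N by apply: kappa_out => //; apply/meetsP; exists t.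
by rewrite e (@Cmod _ k) ?modn_mod.
Qed.

Lemma pendant_meets b w : pendant C kappa b w -> meets (I w) (I b).
Proof.
move=> bw; have [t wt] := arc_nonempty (arc_of w).
by apply/meetsP; exists t; split=> //; exact: pendant_sub bw wt.
Qed.

Lemma pendant_triple b u w : pendant C kappa b u -> meets (I u) (I w) ->
  I b `&` I u `&` I w !=set0.
Proof.
move=> bu /meetsP[t [ut wt]]; exists (circle_pt t); split=> //; split=> //.
exact: pendant_sub bu ut.
Qed.

Let nb b w (h : meets (I w) (I b)) : {w : V | meets (I w) (I b)} := exist _ w h.

Lemma nb_neq b u w (hu : meets (I u) (I b)) (hw : meets (I w) (I b)) :
  u <> w -> nb hu <> nb hw.
Proof. by move=> uw /(congr1 sval). Qed.

(** The hub [b] and [u] are the pair shared by the triples [b], [u], [a] and [b], [u], [c], both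
    with a common point. *)
Lemma pendant_path b a u c :
    inter0_property (@nbr_arcs R V I b) \/ inter34_property (@nbr_arcs R V I b) ->
    pendant C kappa b a -> pendant C kappa b u -> pendant C kappa b c ->
    adj (igraph I) a u -> adj (igraph I) u c -> a = c.
Proof.
move=> h ba bu bc [au mau] [uc muc]; apply: contrapT => ac.
have ha := pendant_meets ba; have hu := pendant_meets bu; have hc := pendant_meets bc.
have [_ nba] := ba; have [_ nbu] := bu; have [_ nbc] := bc.
have hb := meets_refl b.
have [p1 hp1] := pendant_triple bu (Defs.meetsC mau); have [p2 hp2] := pendant_triple bu muc.
case: h => [h|[_ h]].
  have := h (nb hb) (nb hu) (nb ha) (nb_neq (nesym nbu)) (nb_neq (nesym nba)) (nb_neq (nesym au)).
  by rewrite /nbr_arcs /= => e; rewrite e in hp1.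
have := h (nb hb) (nb hu) (nb ha) (nb hc) (nb_neq (nesym nbu)) (nb_neq (nesym nba))
  (nb_neq (nesym nbc)) (nb_neq (nesym au)) (nb_neq uc) (nb_neq ac).
rewrite /nbr_arcs /= => -[e|e]; first by rewrite e in hp1.
by rewrite e in hp2.
Qed.

(** The hub closes the path to a cycle [a], [u], [c], [d], [b], on which [a] must meet the couple
    [c], [d]. *)
Lemma pendant_inter1 b a u c d : inter1_property (@nbr_arcs R V I b) ->
    pendant C kappa b a -> pendant C kappa b u -> pendant C kappa b c -> pendant C kappa b d ->
    adj (igraph I) a u -> adj (igraph I) u c -> adj (igraph I) c d ->
    a <> c -> a <> d -> u <> d ->
  adj (igraph I) a c \/ adj (igraph I) a d.
Proof.
move=> [_ _ h] ba bu bc bd [au mau] [uc muc] [cd mcd] ac ad ud.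
have ha := pendant_meets ba; have hu := pendant_meets bu; have hc := pendant_meets bc.
have hd := pendant_meets bd; have hb := meets_refl b.
have [_ nba] := ba; have [_ nbu] := bu; have [_ nbc] := bc; have [_ nbd] := bd.
pose f (i : 'I_5) := match val i with
  0 => nb ha | 1 => nb hu | 2 => nb hc | 3 => nb hd | _ => nb hb end.
have fcyc : is_cycle (igraph (@nbr_arcs R V I b)) f.
  split=> //.
    move=> [i hi] [j hj] e; apply: val_inj => /=; move: e; rewrite /f /=.
    by case: i hi => [|[|[|[|[|i]]]]] // hi; case: j hj => [|[|[|[|[|j]]]]] // hj;
      move=> /(congr1 sval) /=; congruence.
  move=> [i hi]; rewrite /f /=.
  by case: i hi => [|[|[|[|[|i]]]]] // hi; (split; [apply: nb_neq; congruence|]);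
    rewrite /nbr_arcs //=; apply: Defs.meetsC.
have := h _ f fcyc (@Ordinal 5 0 isT) (@Ordinal 5 2 isT) (@Ordinal 5 3 isT).
rewrite /f /nbr_arcs /= => /(_ ltac:(by []) mcd) [p [ap [cp|dp]]].
- by left; split=> //; exists p.
- by right; split=> //; exists p.
Qed.

(** Unrolled in the window of [b], pendant arcs are intervals of the line, and one that misses [m]
    lies to its left or to its right. Of two outer points on the same side, the one nearer to [m]
    belongs to both [u] and [u'], since each of these reaches from its own outer point to [m]. *)
Lemma pendant_side b : exists side : V -> V -> bool,
  (forall m w w', pendant C kappa b m -> pendant C kappa b w -> pendant C kappa b w' ->
     ~ nbhd1 (igraph I) w m -> ~ nbhd1 (igraph I) w' m -> adj (igraph I) w w' ->
     side m w = side m w') /\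
  (forall m u u' d d', pendant C kappa b m -> pendant C kappa b u -> pendant C kappa b u' ->
     pendant C kappa b d -> pendant C kappa b d' ->
     adj (igraph I) u m -> adj (igraph I) u' m ->
     ~ nbhd1 (igraph I) d m -> ~ nbhd1 (igraph I) d' m ->
     adj (igraph I) d u -> adj (igraph I) d' u' -> side m d = side m d' ->
     nbhd1 (igraph I) u u').
Proof.
have [[j ej]|nC] := pselect (exists j, C j = b); last first.
  by exists (fun _ _ => true); split=> // m u u' d d' [e _]; exfalso; apply: nC; exists (kappa m).
set k := (j + n).-1.
have kE : k.+1 = (j + n)%N by rewrite /k prednK// addn_gt0 n0 orbT.
have bE : b = C k.+1 by rewrite kE C_per.
pose J w t := [/\ th k < t, t < th k.+2 & ang w t].
have k2n : (k.+2 <= k + n)%N by rewrite -addn2 leq_add2l.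
have th2 := th_le th_lt k2n; rewrite th_per in th2.
have Jconv w t t' r : pendant C kappa b w -> J w t -> J w t' -> t <= r -> r <= t' -> J w r.
  move=> bw [t1 t2 wt] [t1' t2' wt'] tr rt'; split; [lra|lra|].
  have tt' : t <= t' <= t + turn R by lra.
  have [h|h] := ang_conv wt wt' tt'; first by apply: h; lra.
  have /(pendant_sub bw) : ang w (th k.+2) by apply: h; lra.
  rewrite bE => /C_th; have /window_neq h2 : (k.+1 < k.+2)%N by [].
  by move=> e; exfalso; apply: (h2 n) e; rewrite addSn ltnS -addn1 ltn_add2l.
have Jmeet w w' : pendant C kappa b w -> meets (I w) (I w') -> exists2 t, J w t & J w' t.
  move=> bw /meetsP[t [wt wt']].
  have [t' [t1 t2 ht]] := window_turn (turn_gt0 R) ang_per (th k) t.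
  have wt1 : ang w t' by apply/ht.
  have bt' := pendant_sub bw wt1; rewrite bE in bt'.
  have h : th k <= t' <= th (k + n) by rewrite th_per; lra.
  have /andP[h1 h2] := C_window ang_per ang_conv n2 th_per th_lt C_th bt' h.
  by exists t'; split=> //; apply/ht.
have Jdisj w m t : J w t -> J m t -> nbhd1 (igraph I) w m.
  move=> [_ _ wt] [_ _ mt]; have [->|wm] := pselect (w = m); first by left.
  by right; split=> //; apply/meetsP; exists t.
(* One angle of [w] to the left of [m] suffices: if [w] is not near [m], the whole of [w] is then to
   the left. *)
exists (fun m w => `[< exists2 t, J w t & forall t0, J m t0 -> t < t0 >]).
have left_all m w t : pendant C kappa b m -> pendant C kappa b w -> ~ nbhd1 (igraph I) w m ->
    (exists2 t, J w t & forall t0, J m t0 -> t < t0) -> J w t -> forall t0, J m t0 -> t < t0.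
  move=> bm bw wm [t1 wt1 h1] wt t0 mt0; rewrite ltNge; apply/negP => t0t.
  apply: wm; apply: (Jdisj w m t0) => //; apply: (Jconv w t1 t) => //.
  exact: ltW (h1 _ mt0).
split=> [m w w' bm bw bw' wm w'm [ww' mww']
 |m u u' d d' bm bu bu' bd bd' [_ um] [_ u'm] dm d'm [_ du] [_ du'] sd].
  have [t wt w't] := Jmeet _ _ bw mww'.
  apply/asboolP/asboolP => h; exists t => //; first exact: (left_all m w t bm bw wm h).
  exact: (left_all m w' t bm bw' w'm h).
have [p up mp] := Jmeet _ _ bu um; have [p' u'p' mp'] := Jmeet _ _ bu' u'm.
have [q dq uq] := Jmeet _ _ bd du; have [q' dq' u'q'] := Jmeet _ _ bd' du'.
have [h|h] := pselect (exists2 t, J d t & forall t0, J m t0 -> t < t0).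
  have h' : exists2 t, J d' t & forall t0, J m t0 -> t < t0 by
      apply/asboolP; rewrite -sd; apply/asboolP.
  have lq := left_all m d q bm bd dm h dq; have lq' := left_all m d' q' bm bd' d'm h' dq'.
  have [qq|qq] := leP q q'.
    apply: (Jdisj u u' q') => //; apply: (Jconv u q p) => //; exact: ltW (lq' _ mp).
  apply: (Jdisj u u' q) => //; apply: (Jconv u' q' p') => //; [exact: ltW|exact: ltW (lq _ mp')].
have h' : ~ exists2 t, J d' t & forall t0, J m t0 -> t < t0.
  by move=> hd; apply: h; apply/asboolP; rewrite sd; apply/asboolP.
have right_all e t : pendant C kappa b e -> ~ nbhd1 (igraph I) e m ->
    ~ (exists2 t, J e t & forall t0, J m t0 -> t < t0) -> J e t -> forall t0, J m t0 -> t0 < t.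
  move=> be em he et t0 mt0; rewrite ltNge; apply/negP => tt0; apply: he; exists t => // t1 mt1.
  rewrite ltNge; apply/negP => t1t; apply: em; apply: (Jdisj e m t) => //.
  exact: (Jconv m t1 t0).
have rq := right_all d q bd dm h dq; have rq' := right_all d' q' bd' d'm h' dq'.
have [qq|qq] := leP q q'.
  apply: (Jdisj u u' q) => //; apply: (Jconv u' p' q') => //; exact: ltW (rq _ mp').
apply: (Jdisj u u' q') => //; apply: (Jconv u p q) => //; [exact: ltW (rq' _ mp)|exact: ltW].
Qed.

Lemma frame_delta :
    (n = 3%N -> forall i, inter0_property (@nbr_arcs R V I (v i)) \/
       inter34_property (@nbr_arcs R V I (v i))) ->
    (n = 4%N -> forall i, [\/ inter0_property (@nbr_arcs R V I (v i)),
       inter34_property (@nbr_arcs R V I (v i)) | inter1_property (@nbr_arcs R V I (v i))]) ->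
  delta R (igraph I) = (n%:R / 4)%:E.
Proof.
move=> cond3 cond4.
have hubv b w : pendant C kappa b w -> exists i, b = v i.
  by move=> [<- _]; have [i e] := C_v (kappa w); exists i.
apply: (@delta_cactus R V (igraph I) n C kappa n3 C_per frame_adj kappa_C kappa_adj kappa_hub).
- move=> en b a u c ba bu bc au uc; have [i bi] := hubv _ _ ba; subst b.
  exact: (pendant_path (cond3 en i) ba bu bc au uc).
- move=> en b a u c d ba bu bc bd au uc cd ac ad ud; have [i bi] := hubv _ _ ba; subst b.
  have [h|h|h] := cond4 en i.
  + by case: ac; exact: (pendant_path (or_introl h) ba bu bc au uc).
  + by case: ac; exact: (pendant_path (or_intror h) ba bu bc au uc).
  + exact: (pendant_inter1 h ba bu bc bd au uc cd ac ad ud).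
- by move=> _ b; exact: pendant_side.
Qed.

End Kappa.
End Pendants.

(** * Excluding arcs with several hubs *)

Section Converse.
Hypothesis v_inj : injective v.

Lemma frame_some_hub w : exists i, meets (I w) (I (v i)).
Proof.
have [t wt] := arc_nonempty (arc_of w); have [i it] := v_cover t.
by exists i; apply/meetsP; exists t.
Qed.

(** For [n = 3] the arcs of the cover are pairwise adjacent. If [w] meets two of them, these two,
    [w] and the third arc form a cycle of length 4. *)
Lemma quadfree_one_hub w : n = 3%N -> ~ (1%:E <= delta R (igraph I))%E ->
  (forall i, w <> v i) -> exists! i, meets (I w) (I (v i)).
Proof.
move=> en noquad wv; have [i wi] := frame_some_hub w.
exists i; split=> // i' wi'; apply: contrapT => ii'; apply: noquad.
have vC3 l : exists2 k, (k < 3)%N & v l = C k.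
  have [k e] := v_C l; exists (k %% n)%N; first by rewrite -en ltn_mod.
  by rewrite e; apply: Cmod; rewrite modn_mod.
have adj3 a b : (a < 3)%N -> (b < 3)%N -> a <> b -> adj (igraph I) (C a) (C b).
  have h0 := frame_adj 0; have h1 := frame_adj 1; have h2 := frame_adj 2.
  have e3 : C 3 = C 0 by rewrite -(C_per 0) en.
  rewrite e3 in h2.
  by case: a => [|[|[|a]]] //; case: b => [|[|[|b]]] // _ _ _ //; exact: adj_sym.
have [a a3 ea] := vC3 i; have [b b3 eb] := vC3 i'.
have ab : a <> b by move=> h; apply: ii'; apply: v_inj; rewrite ea eb h.
have [c [c3 ca cb]] : exists c, [/\ (c < 3)%N, c <> a & c <> b].
  case: a a3 ab {ea} => [|[|[|a]]] // _; case: b b3 {eb} => [|[|[|b]]] // _ _;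
  by [exists 0%N|exists 1%N|exists 2%N].
have Cw k : C k <> w by have [l e] := C_v k; rewrite e => h; apply: (wv l).
rewrite ea in wi; rewrite eb in wi'.
apply: (@delta_ge_quad R V (igraph I) (C a) w (C b) (C c)).
- by split; [exact: Cw|exact: Defs.meetsC].
- by split=> //; apply: nesym; exact: Cw.
- by apply: adj3 => //; exact: nesym.
- exact: adj3.
- exact: adj_neq (adj3 a b a3 b3 ab).
- exact/nesym/Cw.
Qed.

(** If [w] met all four arcs, it would cover the circle together with two of them. Meeting just two
    or three consecutive ones gives a pentagon. Meeting two opposite ones forces a third, since [w]
    passes over a private angle between them. *)
Lemma pentfree_one_hub w : n = 4%N -> ~ ((5 / 4)%:E <= delta R (igraph I))%E ->
  (forall i, w <> v i) -> exists! i, meets (I w) (I (v i)).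
Proof.
move=> en nopent wv; have [i wi] := frame_some_hub w.
exists i; split=> // i' wi'; apply: contrapT => ii'.
have Cw k : C k <> w by have [l e] := C_v k; rewrite e => h; apply: (wv l).
pose N k := meets (I w) (I (C k)).
have C4 k : C k.+4 = C k by rewrite -[RHS]C_per en addn4.
have N4 k : N k.+4 <-> N k by rewrite /N C4.
have th4 k : th k.+4 = th k + turn R by rewrite -th_per en addn4.
have T0 := turn_gt0 R.
have cover3 a b c : ~ forall t, [\/ ang a t, ang b t | ang c t].
  move=> cov; pose u (l : 'I_3) := match val l with 0 => a | 1 => b | _ => c end.
  have : (rho I <= 3%:R%:E)%E.
    apply: (@rho_le_cover 3 u) => t; case: (cov t) => ?;
      by [exists (@Ordinal 3 0 isT)|exists (@Ordinal 3 1 isT)|exists (@Ordinal 3 2 isT)].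
  by rewrite rhoE lee_fin ler_nat en.
have window3 a b c k : ~ forall t, th k <= t <= th k.+4 -> [\/ ang a t, ang b t | ang c t].
  move=> cov; apply: (cover3 a b c) => t.
  have [t' [t1 t2 ht]] := window_turn T0 ang_per (th k) t.
  have [|h|h|h] := cov t'; first by rewrite th4; lra.
  - by constructor 1; apply/ht.
  - by constructor 2; apply/ht.
  - by constructor 3; apply/ht.
have seg k r : th k <= r <= th k.+1 -> ang (C k) r \/ ang (C k.+1) r.
  exact: (cover_seg ang_conv n2 v_cover C_per th_per th_lt C_th v_C).
have Cth k : ang (C k) (th k) by apply/C_th.
have ltA p q k : (p < q)%N -> (p + k < q + k)%N by rewrite ltn_add2r.
have CthN j k : (j < k)%N -> (k < j.+4)%N -> ~ ang (C j) (th k).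
  by move=> jk kj /C_th; apply: window_neq => //; rewrite en addn4.
have thw k : ang w (th k) -> N k by move=> h; apply/meetsP; exists (th k).
have opp k : N k.+1 -> N k.+3 -> N k.+2 \/ N k.+4.
  move=> /frame_window[x [x1 x2 wx _]] /frame_window[y [y1 y2 wy _]].
  have e4 := th4 k; have xy : x <= y <= x + turn R by lra.
  by have [h|h] := ang_conv wx wy xy; [left|right]; apply: thw; apply: h; lra.
have big k : ~ forall r, th k.+1 <= r <= th k.+4 -> ang w r.
  move=> h; apply: (window3 w (C k) (C k.+1) k) => t tk.
  have [t1|t1] := leP t (th k.+1); last by constructor 1; apply: h; lra.
  have [|h1|h1] := seg k t; first lra; [by constructor 2|by constructor 3].
have notall : ~ forall k, N k.
  move=> Nall; have [[k wk]|allth] := pselect (exists k, ~ ang w (th k)); last first.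
    have wth k : ang w (th k) by apply: contrapT => h; apply: allth; exists k.
    have sub k r : th k <= r <= th k.+1 -> ang w r.
      have l1 := th_lt k; have l2 := th_lt k.+1; have l3 := th_lt k.+2; have l4 := th_lt k.+3.
      have e4 := th4 k; have kk : th k <= th k.+1 <= th k + turn R by lra.
      have [h|h] := ang_conv (wth k) (wth k.+1) kk; first exact: h.
      by exfalso; apply: (big k); rewrite e4.
    apply: (big 0%N) => r r4; have [r2|r2] := leP r (th 2); first by apply: (sub 1%N); lra.
    by have [r3|r3] := leP r (th 3); [apply: (sub 2%N)|apply: (sub 3%N)]; lra.
  (* Cut the circle at [th k], which [w] misses. Depending on the side of the cut on which [w] meets
     [C k], the pair [C k], [C k.+1] or the pair [C k], [C k.+3] covers what [w] leaves. *)
  have [x [x1 x2 wx cx]] := frame_window (Nall k.+1).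
  have [y [y1 y2 wy cy]] := frame_window (Nall k.+3).
  have [z [z1 z2 wz cz]] := frame_window (Nall k.+4).
  have l0 := th_lt k; have l1 := th_lt k.+1; have l2 := th_lt k.+2; have l3 := th_lt k.+3.
  have e4 := th4 k; have e5 := th4 k.+1.
  have wk4 : ~ ang w (th k.+4) by rewrite e4 => /ang_per.
  have [zk|zk] := leP z (th k.+4).
    have xz : x <= z <= x + turn R by lra.
    have wxz r : x <= r <= z -> ang w r.
      have [h|h] := ang_conv wx wz xz; first exact: h.
      by exfalso; apply: wk4; apply: h; lra.
    have cz' r : z <= r <= th k.+4 -> ang (C k) r.
      rewrite -C4; have zk' : z <= th k.+4 <= z + turn R by lra.
      have [h|h] := ang_conv cz (Cth k.+4) zk'; first exact: h.
      exfalso; apply: (CthN k.+4 k.+1.+4); [by []|exact: (ltA 5 8)|apply: h; lra].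
    have cx' r : th k.+1 <= r <= x -> ang (C k.+1) r.
      move=> rx; have kx : th k.+1 <= x <= th k.+1 + turn R by lra.
      have [h|h] := ang_conv (Cth k.+1) cx kx; first exact: h.
      exfalso; apply: (CthN k.+1 k.+4); [exact: (ltA 1 4)|exact: (ltA 4 5)|apply: h; lra].
    apply: (window3 (C k) (C k.+1) w k) => t tk.
    have [tz|tz] := leP z t; first by constructor 1; apply: cz'; lra.
    have [tx|tx] := leP x t; first by constructor 3; apply: wxz; lra.
    have [t1|t1] := leP t (th k.+1); last by constructor 2; apply: cx'; lra.
    have [|h1|h1] := seg k t; first lra; [by constructor 1|by constructor 2].
  have wz' : ang w (z - turn R) by apply/ang_per; rewrite subrK.
  have cz' : ang (C k) (z - turn R) by rewrite -C4; apply/ang_per; rewrite subrK.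
  have zy : z - turn R <= y <= z - turn R + turn R by lra.
  have wzy r : z - turn R <= r <= y -> ang w r.
    have [h|h] := ang_conv wz' wy zy; first exact: h.
    by exfalso; apply: wk4; apply: h; lra.
  have ckz r : th k <= r <= z - turn R -> ang (C k) r.
    have kz : th k <= z - turn R <= th k + turn R by lra.
    have [h|h] := ang_conv (Cth k) cz' kz; first exact: h.
    exfalso; apply: (CthN k k.+1); [by []|exact: (ltA 1 4)|apply: h; lra].
  have cky r : y <= r <= th k.+3 -> ang (C k.+3) r.
    move=> yr; have yk : y <= th k.+3 <= y + turn R by lra.
    have [h|h] := ang_conv cy (Cth k.+3) yk; first exact: h.
    exfalso; apply: (CthN k.+3 k.+4); [by []|exact: (ltA 4 7)|apply: h; lra].
  apply: (window3 (C k) (C k.+3) w k) => t tk.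
  have [tz|tz] := leP t (z - turn R); first by constructor 1; apply: ckz; lra.
  have [ty|ty] := leP t y; first by constructor 3; apply: wzy; lra.
  have [t3|t3] := leP t (th k.+3); first by constructor 2; apply: cky; lra.
  have [|h1|h1] := seg k.+3 t; first lra; [by constructor 2|by constructor 1; rewrite -C4].
have adjwC k : N k -> adj (igraph I) w (C k) by move=> h; split=> //; exact/nesym/Cw.
have Cneq p q k : (p < q)%N -> (q < p + 4)%N -> C (p + k) <> C (q + k).
  move=> pq qp /Cinj; apply: window_neq => //; first exact: ltA.
  by rewrite en addnAC ltn_add2r.
have two k : ~ (N k /\ N k.+1 /\ ~ N k.+2 /\ ~ N k.+3).
  move=> [N0 [N1 [N2 N3]]]; apply: nopent.
  apply: (@delta_ge_pent R V (igraph I) w (C k) (C k.+3) (C k.+2) (C k.+1)).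
  - exact: adjwC.
  - by rewrite -(C4 k); apply: adj_sym; exact: frame_adj.
  - by apply: adj_sym; exact: frame_adj.
  - by apply: adj_sym; exact: frame_adj.
  - by apply: adj_sym; exact: adjwC.
  - exact: (Cneq 0 2).
  - exact: (Cneq 0 1).
  - by apply: nesym; exact: (Cneq 1 3).
  - exact/nesym/Cw.
  - exact/nesym/Cw.
  - by move=> [].
  - by move=> [].
(* Here the vertex that misses the opposite edge is [C k.+3], and that edge joins [C k.+1] to
   [w]. *)
have three k : ~ (N k /\ N k.+1 /\ N k.+2 /\ ~ N k.+3).
  move=> [N0 [N1 [N2 N3]]]; apply: nopent.
  apply: (@delta_ge_pent R V (igraph I) (C k.+3) (C k) (C k.+1) w (C k.+2)).
  - by rewrite -(C4 k); exact: frame_adj.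
  - exact: frame_adj.
  - by apply: adj_sym; exact: adjwC.
  - exact: adjwC.
  - exact: frame_adj.
  - exact: Cw.
  - exact: (Cneq 0 2).
  - exact: (Cneq 1 2).
  - by apply: nesym; exact: (Cneq 1 3).
  - exact: Cw.
  - move=> [_ /Defs.meetsC h].
    have [||/eqP|/eqP] := @frame_consecutive k.+1 k.+3 _ _ h; rewrite ?en ?addn4.
    + exact: (ltA 1 3).
    + exact: (ltA 3 5).
    + by rewrite eqn_leq ltnn.
    + by rewrite eq_sym eqn_leq ltnn.
  - by move=> [_ /Defs.meetsC].
have consec k : ~ (N k /\ N k.+1).
  move=> [N0 N1]; have [N2|N2] := pselect (N k.+2); have [N3|N3] := pselect (N k.+3).
  - apply: notall => j; have [m [km mk mj]] := mod_window n2 j k.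
    rewrite /N -(Cmod mj); move: km mk; rewrite en addn4 => km mk.
    have : [\/ m = k, m = k.+1, m = k.+2 | m = k.+3].
      have [->|mk0] := eqVneq m k; first by constructor 1.
      have [->|mk1] := eqVneq m k.+1; first by constructor 2.
      have [->|mk2] := eqVneq m k.+2; first by constructor 3.
      constructor 4; apply/eqP; rewrite eqn_leq -ltnS mk /=.
      by rewrite ltn_neqAle eq_sym mk2 ltn_neqAle eq_sym mk1 ltn_neqAle eq_sym mk0.
    by move=> [->|->|->|->].
  - exact: (three k).
  - by apply: (three k.+3); do ![split] => //; apply/N4.
  - exact: (two k).
have vC4 l : exists2 k, (k < 4)%N & v l = C k.
  have [k e] := v_C l; exists (k %% n)%N; first by rewrite -en ltn_mod.
  by rewrite e; apply: Cmod; rewrite modn_mod.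
have [a a4 ea] := vC4 i; have [b b4 eb] := vC4 i'.
have ab : a <> b by move=> h; apply: ii'; apply: v_inj; rewrite ea eb h.
have Na : N a by rewrite /N -ea. have Nb : N b by rewrite /N -eb.
have skip k : ~ (N k.+1 /\ N k.+3).
  by move=> [h1 h3]; have [h|h] := opp k h1 h3; [apply: (consec k.+1)|apply: (consec k.+3)].
have pick c d : (c < d)%N -> (d < 4)%N -> N c -> N d -> False.
  case: d => [|[|[|[|d]]]] // ; case: c => [|[|[|c]]] // _ _ Nc Nd.
  - exact: (consec 0%N).
  - by apply: (skip 3%N); split; apply/N4.
  - exact: (consec 1%N).
  - by apply: (consec 3%N); split=> //; apply/N4.
  - exact: (skip 0%N).
  - exact: (consec 2%N).
have [ltab|ltba|//] := ltngtP a b; [exact: (pick a b)|exact: (pick b a)].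
Qed.

End Converse.

End Frame.
End ArcGraph.

Lemma rho_frame (R : realType) (V : Type) (I : V -> set (R * R)) n (v : 'I_n -> V) :
  arc_family I -> rho I = n%:R%:E -> (3 <= n)%N ->
  (forall t, exists i, angles (I (v i)) t) ->
  exists (C : nat -> V) (th : nat -> R),
    [/\ (forall k, C (k + n)%N = C k) /\ (forall k, th (k + n)%N = th k + turn R),
        forall k, th k < th k.+1,
        forall j k, angles (I (C j)) (th k) <-> j = k %[mod n],
        forall i, exists k, v i = C k & forall k, exists i, C k = v i].
Proof.
move=> hI rhoE n3 cov; apply: (cyclic_order (turn_gt0 R) (ang_per I) (ltnW n3) cov).
by move=> m u /(rho_le_cover hI); rewrite rhoE lee_fin ler_nat.
Qed.

Theorem theorem3p5 (R : realType) (V : Type) (I : V -> set (R * R))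
    (hI : arc_family I) (hrho : (3%:R%:E <= rho I)%E) :
  (rho_property I -> delta R (igraph I) = (rho I * (4%:R^-1)%:E)%E) /\
  (delta R (igraph I) = (rho I * (4%:R^-1)%:E)%E ->
   (3%:R%:E <= rho I <= 4%:R%:E)%E -> rho_property I).
Proof.
split.
  move=> [n [v [rhoE [_ /(cover_angles hI) cov] one_hub [cond3 cond4 _]]]].
  have n3 : (3 <= n)%N by move: hrho; rewrite rhoE lee_fin ler_nat.
  have [C [th [[C_per th_per] th_lt C_th v_C C_v]]] := rho_frame hI rhoE n3 cov.
  have [kappa kappaP] := choice (hub_index n3 C_per v_C one_hub).
  by rewrite rhoE -EFinM;
    exact: (frame_delta hI n3 cov C_per th_per th_lt C_th v_C C_v one_hub kappaP cond3 cond4).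
move=> deltaE /andP[_ rho4].
have [n [v [rhoE v_inj cov]]] := rho_attained (le_lt_trans rho4 (ltry _)).
have n3 : (3 <= n)%N by move: hrho; rewrite rhoE lee_fin ler_nat.
have n4 : (n <= 4)%N by move: rho4; rewrite rhoE lee_fin ler_nat.
have [C [th [[C_per th_per] th_lt C_th v_C C_v]]] := rho_frame hI rhoE n3 cov.
have deltan : delta R (igraph I) = (n%:R / 4)%:E by rewrite deltaE rhoE -EFinM.
(* The value [n / 4] is [3/4 < 1] or [1 < 5/4], just below what the forbidden cycle would force. *)
have noquad : n = 3%N -> ~ (1%:E <= delta R (igraph I))%E.
  by move=> e; rewrite deltan e lee_fin; lra.
have nopent : n = 4%N -> ~ ((5 / 4)%:E <= delta R (igraph I))%E.
  by move=> e; rewrite deltan e lee_fin; lra.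
exists n, v; split=> //; first by split=> //; apply/(cover_angles hI).
  have [e3|e4] : n = 3%N \/ n = 4%N.
    by case: n n3 n4 {v rhoE v_inj cov C_per th_per C_th v_C C_v deltan noquad nopent}
      => [|[|[|[|[|n]]]]] // _ _; [left|right].
  - move=> w; apply: (quadfree_one_hub hI n3 cov C_per th_per th_lt C_th v_C C_v v_inj) => //.
    exact: noquad.
  - move=> w; apply: (pentfree_one_hub hI n3 rhoE cov C_per th_per th_lt C_th v_C C_v v_inj) => //.
    exact: nopent.
split=> [e j|e j|e]; last by rewrite e in n4.
  exact/quadfree_inter/noquad.
have [h0|h0] := pselect (inter0_property (@nbr_arcs R V I (v j))); first by constructor 1.
have [h34|h34] := pselect (inter34_property (@nbr_arcs R V I (v j))); first by constructor 2.
constructor 3; split=> // m c cyc i k l kl.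
exact: (pentfree_inter1 hI (nopent e) cyc i kl).
Qed.
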